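(* Let $n\ge 2$ and $1<p<p_0(n)$, and let $R>0$. Assume that $f\in H^1(\mathbf{R}^n)$ is non-negative and does not vanish identically, and that $g\equiv0$. For $\varepsilon>0$, suppose that the initial value problem $$u_{tt}-\Delta u=|u|^p\ \text{ in }\mathbf{R}^n\times[0,\infty),\qquad u(x,0)=\varepsilon f(x),\quad u_t(x,0)=\varepsilon g(x)=0$$ has a solution $u$ on the time interval $[0,T(\varepsilon))$, where $T(\varepsilon)$ is the lifespan, with $(u,u_t)\in C([0,T(\varepsilon)),H^1(\mathbf{R}^n)\times L^2(\mathbf{R}^n))$ and $$\mathrm{supp}(u,u_t)\subset\{(x,t)\in\mathbf{R}^n\times[0,\infty): |x|\le t+R\}.$$ Then there exist a positive constant $\varepsilon_1=\varepsilon_1(f,n,p,R)$ and a positive constant $C$ independent of $\varepsilon$ such that $$T(\varepsilon)\le C\varepsilon^{-2p(p-1)/\gamma(p,n)}\quad\text{for all }0<\varepsilon\le\varepsilon_1.$$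
   Context: Notation: $\gamma(p,n):=2+(n+1)p-(n-1)p^2$, and for $n\ge2$ $$p_0(n)=\frac{n+1+\sqrt{n^2+10n-7}}{2(n-1)}$$ is the positive root (in $p$) of $\gamma(p,n)=0$; thus $\gamma(p,n)>0$ for $1<p<p_0(n)$. Lifespan: for fixed $(f,g)$, $T(\varepsilon)\in(0,\infty]$ is the supremum of all $t>0$ such that a solution $u(x,t)$ of the initial value problem exists up to time $t$. Here a solution in the class $(u,u_t)\in C([0,T),H^1\times L^2)$ is understood in the weak sense: $u(\cdot,0)=\varepsilon f$, $u_t(\cdot,0)=\varepsilon g$, and $u_{tt}-\Delta u=|u|^p$ holds in the sense of distributions on $\mathbf{R}^n\times(0,T)$. (The paper's general convention is that ''solution'' means a classical one when $p\ge2$ and a weak one, or one of the associated integral equation, when $1<p<2$.) The support condition includes the time $t=0$, so $\mathrm{supp}\,f\subset\{|x|\le R\}$. *)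

(* Defs.v *)
From HB Require Import structures.
From mathcomp Require Import all_boot all_order all_algebra.
From mathcomp Require Import all_classical all_reals all_analysis.

Set Implicit Arguments.
Unset Strict Implicit.
Unset Printing Implicit Defensive.

Import Order.TTheory GRing.Theory Num.Theory.
Import numFieldNormedType.Exports.

Local Open Scope classical_set_scope.
Local Open Scope ring_scope.

(* Product sigma-algebra on R^n, which is the Borel sigma-algebra. *)
Section measurable_rV.
Variables (R : realType) (n : nat).

Let coors : 'I_n -> 'rV[R]_n -> measurableTypeR R := fun i x => x ord0 i.

Let rV_set0 : g_sigma_preimage coors set0.
Proof. exact: sigma_algebra0. Qed.

Let rV_setC A : g_sigma_preimage coors A -> g_sigma_preimage coors (~` A).
Proof. exact: sigma_algebraC. Qed.

Let rV_bigcup (F : (set 'rV[R]_n)^nat) : (forall i, g_sigma_preimage coors (F i)) ->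
  g_sigma_preimage coors (\bigcup_i (F i)).
Proof. exact: sigma_algebra_bigcup. Qed.

HB.instance Definition _ := @isMeasurable.Build default_measure_display
  'rV[R]_n (g_sigma_preimage coors) rV_set0 rV_setC rV_bigcup.

Lemma measurable_coord (i : 'I_n) :
  measurable_fun [set: 'rV[R]_n] (fun x => x ord0 i : measurableTypeR R).
Proof.
move=> _ Y mY; rewrite setTI; apply: sub_sigma_algebra => /=.
rewrite -bigcup_seq/=; exists i => /=; first by rewrite mem_index_enum.
by exists Y => //; rewrite setTI.
Qed.

Lemma measurable_fun_coordP d (T : measurableType d) (f : T -> 'rV[R]_n) :
  (forall i, measurable_fun [set: T] (fun x => f x ord0 i : measurableTypeR R)) ->
  measurable_fun [set: T] f.
Proof.
move=> mf _ A mA; rewrite setTI.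
suff : g_sigma_preimage coors `<=` [set A | measurable (f @^-1` A)] by exact.
apply: smallest_sub.
  split => /=.
  - by rewrite preimage_set0; exact: measurable0.
  - by move=> B mB; rewrite setTD -preimage_setC; exact: measurableC.
  - by move=> F mF; rewrite preimage_bigcup; exact: bigcupT_measurable.
rewrite -bigcup_seq => B [i _ [C mC <-]] /=.
by rewrite setTI -comp_preimage -[X in measurable X]setTI; exact: mf.
Qed.

End measurable_rV.

Section lebesgue_rV.
Variable R : realType.

Definition rVcons n (z : measurableTypeR R * 'rV[R]_n) : 'rV[R]_n.+1 :=
  \row_i oapp (z.2 ord0) z.1 (unlift ord0 i).

Lemma measurable_rVcons n : measurable_fun setT (@rVcons n).
Proof.
apply: measurable_fun_coordP => i.
have [j ->|->] := unliftP ord0 i.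
- rewrite (_ : (fun _ => _) = (fun x : 'rV[R]_n => x ord0 j : measurableTypeR R) \o snd).
    by apply: measurableT_comp => //; exact: measurable_coord.
  by apply/funext => z /=; rewrite mxE liftK.
- rewrite (_ : (fun _ => _) = fst); first exact: measurable_fst.
  by apply/funext => z /=; rewrite mxE unlift_none.
Qed.

Definition rVuncons n (x : 'rV[R]_n.+1) : measurableTypeR R * 'rV[R]_n :=
  (x ord0 ord0, \row_i x ord0 (lift ord0 i)).

Lemma measurable_rVuncons n : measurable_fun setT (@rVuncons n).
Proof.
apply/measurable_fun_pairP; split; first exact: measurable_coord.
apply: measurable_fun_coordP => i.
rewrite (_ : (fun _ => _) = (fun x : 'rV[R]_n.+1 => x ord0 (lift ord0 i) : measurableTypeR R)).
  exact: measurable_coord.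
by apply/funext => x; rewrite mxE.
Qed.

Lemma rVconsK_comp n : @rVuncons n \o @rVcons n = idfun.
Proof.
apply/funext => -[x y]; rewrite /rVuncons /= mxE unlift_none /=; congr (_, _).
by apply/rowP => i; rewrite !mxE liftK.
Qed.

Section step.
Variables (n : nat) (mu : {sigma_finite_measure set 'rV[R]_n -> \bar R}).

Definition lebesgue_rVS : set 'rV[R]_n.+1 -> \bar R :=
  pushforward (@lebesgue_measure R \x mu)%E (@rVcons n).

Let lebesgue_rVS0 : lebesgue_rVS set0 = 0%E.
Proof. by rewrite /lebesgue_rVS /pushforward preimage_set0 measure0. Qed.

Let lebesgue_rVS_ge0 A : (0 <= lebesgue_rVS A)%E.
Proof. exact: (@measure_ge0 _ _ _ (@lebesgue_measure R \x mu)%E). Qed.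

Let lebesgue_rVS_sigma_additive : semi_sigma_additive lebesgue_rVS.
Proof.
move=> F mF tF mUF; rewrite /lebesgue_rVS /pushforward preimage_bigcup.
have mcons B : measurable B -> measurable (@rVcons n @^-1` B).
  by move=> mB; rewrite -[X in measurable X]setTI; exact: measurable_rVcons.
apply: measure_semi_sigma_additive.
- by move=> k; exact: mcons.
- apply/trivIsetP => /= i j _ _ ij; rewrite -preimage_setI.
  by move/trivIsetP : tF => /(_ _ _ _ _ ij) ->//; rewrite preimage_set0.
- by rewrite -preimage_bigcup; exact: mcons.
Qed.

HB.instance Definition _ := isMeasure.Build _ _ _ lebesgue_rVS
  lebesgue_rVS0 lebesgue_rVS_ge0 lebesgue_rVS_sigma_additive.

Let lebesgue_rVS_sigma_finite : sigma_finite setT lebesgue_rVS.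
Proof.
have /sigma_finiteP[F [FT ndF Foo]] := sigma_finiteT (@lebesgue_measure R).
have /sigma_finiteP[G [GT ndG Goo]] := sigma_finiteT mu.
exists (fun k => @rVuncons n @^-1` (F k `*` G k)).
  rewrite -preimage_bigcup (_ : \bigcup_k _ = setT) ?preimage_setT//.
  apply/seteqP; split => // -[x y] _.
  have [i _ Fix] : (\bigcup_i F i) x by rewrite -FT.
  have [j _ Gjy] : (\bigcup_j G j) y by rewrite -GT.
  exists (maxn i j) => //; split => /=.
  - by move: x Fix; exact/subsetPset/ndF/leq_maxl.
  - by move: y Gjy; exact/subsetPset/ndG/leq_maxr.
move=> k; have [mF Fk] := Foo k; have [mG Gk] := Goo k; split.
  by rewrite -[X in measurable X]setTI; apply: measurable_rVuncons => //;
    exact: measurableX.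
rewrite /lebesgue_rVS /pushforward -comp_preimage rVconsK_comp preimage_id.
by rewrite product_measure1E// lte_mul_pinfty// ge0_fin_numE.
Qed.

HB.instance Definition _ := Measure_isSigmaFinite.Build _ _ _ lebesgue_rVS
  lebesgue_rVS_sigma_finite.

End step.

(* Lebesgue measure on R^n; lebesgue_rV_box below characterizes it. *)
Fixpoint lebesgue_rV n : {sigma_finite_measure set 'rV[R]_n -> \bar R} :=
  if n is m.+1 then lebesgue_rVS (lebesgue_rV m) else \d_(0 : 'rV[R]_0).

Lemma lebesgue_rV_box n (A : 'I_n -> set (measurableTypeR R)) :
  (forall i, measurable (A i)) ->
  lebesgue_rV n [set x | forall i, A i (x ord0 i)] =
  (\prod_(i < n) lebesgue_measure (A i))%E.
Proof.
elim: n A => [|n IHn] A mA.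
  rewrite big_ord0 /= diracE mem_set//.
  by move=> [].
rewrite big_ord_recl -(IHn (fun i => A (lift ord0 i)))//.
rewrite -product_measure1E//.
  rewrite /= /lebesgue_rVS /pushforward; congr (_ _).
  apply/seteqP; split => [[x y]/= Axy|[x y]/= [Ax Ay] i].
    split=> [|i]; first by have := Axy ord0; rewrite mxE unlift_none.
    by have := Axy (lift ord0 i); rewrite mxE liftK.
  by rewrite mxE; case: unliftP => [j ->|->].
have E : [set x : 'rV[R]_n | forall i, A (lift ord0 i) (x ord0 i)] =
    \bigcap_(i in [set: 'I_n])
      ((fun x : 'rV[R]_n => x ord0 i) @^-1` A (lift ord0 i)).
  by apply/seteqP; split => x /= h i => [_|]; apply: h.
rewrite [X in measurable X]E; apply: fin_bigcap_measurable => // i _.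
by rewrite -[X in measurable X]setTI; exact: measurable_coord.
Qed.

End lebesgue_rV.

Section test_functions.
Variables (R : realType) (V : normedModType R).
Implicit Types (phi : V -> R) (D : set V).

(* In finite dimension, continuity of all iterated directional derivatives up
   to order k is the usual C^k. *)
Fixpoint Ck k phi : Prop :=
  if k is k'.+1 then
    [/\ continuous phi, forall x v, derivable phi x v &
        forall v, Ck k' (fun x => 'D_v phi x)]
  else continuous phi.

Definition smooth phi := forall k, Ck k phi.

Definition supp phi : set V := closure [set x | phi x != 0].

Definition test_function D phi :=
  [/\ smooth phi, compact (supp phi) & supp phi `<=` D].

End test_functions.

Section sobolev.
Variables (R : realType) (n : nat).
Implicit Types (f g : 'rV[R]_n -> R) (i : 'I_n).

(* The norm that the library puts on 'rV[R]_n is the sup norm. *)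
Definition enorm (x : 'rV[R]_n) : R := Num.sqrt (\sum_i x ord0 i ^+ 2).

Definition evec i : 'rV[R]_n := delta_mx ord0 i.

Definition L2norm f : \bar R := 'N[lebesgue_rV R n]_2%:E [EFin \o f]%E.

Definition L2 f := f \in Lfun (lebesgue_rV R n) 2%:E.

Definition is_weak_partial i f g :=
  forall phi, test_function setT phi ->
    \int[lebesgue_rV R n]_x (f x * 'D_(evec i) phi x) =
    - \int[lebesgue_rV R n]_x (g x * phi x).

Definition H1 f :=
  L2 f /\ forall i, exists2 g, L2 g & is_weak_partial i f g.

(* Chosen among the weak derivatives, which agree almost everywhere. *)
Definition weak_partial i f : 'rV[R]_n -> R :=
  xget (cst 0) [set g | L2 g /\ is_weak_partial i f g].

Definition H1norm f : \bar R :=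
  ((L2norm f `^ 2 + \sum_(i < n) L2norm (weak_partial i f) `^ 2) `^ 2^-1)%E.

End sobolev.

Section wave_equation.
Variables (R : realType) (n : nat).
Implicit Types (u v : 'rV[R]_n -> R -> R) (f g : 'rV[R]_n -> R).
Implicit Types (h phi : 'rV[R]_n * R -> R) (D : set ('rV[R]_n * R)).
Implicit Types (T : \bar R).

Definition time_interval T : set R := [set t | 0 <= t /\ (t%:E < T)%E].

Definition spacetime T : set ('rV[R]_n * R) :=
  [set z | 0 < z.2 /\ (z.2%:E < T)%E].

Local Notation dxdt := (lebesgue_rV R n \x @lebesgue_measure R)%E.

(* Makes h a distribution on D, so that the integrals of h against test
   functions below are genuine ones; it includes joint measurability. *)
Definition locally_integrable_st D h :=
  forall K, K `<=` D -> compact K -> dxdt.-integrable K (EFin \o h).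

Definition dt phi (z : 'rV[R]_n * R) : R := 'D_(0, 1) phi z.

Definition dx i phi (z : 'rV[R]_n * R) : R := 'D_(evec R i, 0) phi z.

Definition box phi (z : 'rV[R]_n * R) : R :=
  dt (dt phi) z - \sum_(i < n) dx i (dx i phi) z.

Definition is_weak_time_derivative T u v :=
  [/\ locally_integrable_st (spacetime T) (fun z => u z.1 z.2),
      locally_integrable_st (spacetime T) (fun z => v z.1 z.2) &
      forall phi, test_function (spacetime T) phi ->
        \int[dxdt]_(z in spacetime T) (u z.1 z.2 * dt phi z) =
        - \int[dxdt]_(z in spacetime T) (v z.1 z.2 * phi z)].

Definition is_weak_wave_solution (p : R) T u :=
  [/\ locally_integrable_st (spacetime T) (fun z => u z.1 z.2),
      locally_integrable_st (spacetime T) (fun z => `|u z.1 z.2| `^ p) &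
      forall phi, test_function (spacetime T) phi ->
        \int[dxdt]_(z in spacetime T) (u z.1 z.2 * box phi z) =
        \int[dxdt]_(z in spacetime T) (`|u z.1 z.2| `^ p * phi z)].

Definition continuous_curve (norm : ('rV[R]_n -> R) -> \bar R) T u :=
  forall t, time_interval T t ->
    norm (fun x => u x s - u x t) @[s --> within (time_interval T) (nbhs t)]
      --> 0%E.

Definition energy_class T u v :=
  [/\ forall t, time_interval T t -> H1 (u ^~ t) /\ L2 (v ^~ t),
      continuous_curve (@H1norm R n) T u &
      continuous_curve (@L2norm R n) T v].

(* u and v = u_t are functions of (x, t) read as curves of classes of functions
   of x, hence the almost everywhere conditions at each fixed time. *)
Record is_solution (p : R) f g (eps : R) T u v : Prop := IsSolution {
  solution_energy : energy_class T u v ;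
  solution_ut : is_weak_time_derivative T u v ;
  solution_eq : is_weak_wave_solution p T u ;
  solution_init : {ae lebesgue_rV R n, forall x, u x 0 = eps * f x} ;
  solution_init_t : {ae lebesgue_rV R n, forall x, v x 0 = eps * g x} }.

Definition lifespan (p : R) f g (eps : R) : \bar R :=
  ereal_sup [set t%:E | t in
    [set t : R | 0 < t /\ exists u v, is_solution p f g eps t%:E u v]].

Definition supported_in_cone (r : R) T u v :=
  forall t, time_interval T t ->
    {ae lebesgue_rV R n, forall x, t + r < enorm x -> u x t = 0 /\ v x t = 0}.

End wave_equation.

Definition gamma (R : realType) (p : R) (n : nat) : R :=
  2 + (n%:R + 1) * p - (n%:R - 1) * p ^+ 2.

Definition p0 (R : realType) (n : nat) : R :=
  (n%:R + 1 + Num.sqrt (n%:R ^+ 2 + 10 * n%:R - 7)) / (2 * (n%:R - 1)).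

(* Main.v *)
(** The idea is the test function method. Let [q = p / (p - 1)], let [A] be a
    smooth cutoff in time with [A t = 1] for [t <= 1/2] and [A t = 0] for
    [1 <= t], and let [Y] be the integral of [|u|^p A (t / tau)] over the light
    cone, where [1 <= tau < T]. Testing the equation with [A (t / tau)] gives
    [Y <= a tau^(n + 1 - 2 q)] by Young's inequality. Testing it with
    [e^(w . x - t) A (t / tau)], where [|w| = 1], and averaging over directions
    [w] gives a lower bound: the average of [e^(w . x - t)] decays like
    [tau^(- (n - 1) / 2) e^((|x| - t) / 2)], so that for every [nu > 0]
    [c eps <= nu Y + nu^(- 1 / (p - 1)) b tau^(n - q (n + 1) / 2)].
    Optimizing in [nu] yields [eps^p <= C tau^(- gamma / (2 (p - 1)))], which is
    the claim. The initial data enter through an additional cutoff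
    [1 - S (t / d)] as [d] tends to [0]: the weak form of [u_t = v] turns the
    resulting boundary layer into integrals over [d / 2 <= t <= d] that only
    involve [u], [v] and [S'], and these are controlled by continuity in time. *)
Require Import Defs.
From HB Require Import structures.
From mathcomp Require Import all_boot all_order all_algebra.
From mathcomp Require Import all_classical all_reals all_analysis.
From mathcomp Require Import measurable_realfun zify ring lra.
Import Order.TTheory GRing.Theory Num.Theory.
Import numFieldNormedType.Exports.
Local Open Scope classical_set_scope.
Local Open Scope ring_scope.

Set Implicit Arguments.
Unset Strict Implicit.
Unset Printing Implicit Defensive.

(** * Smooth functions on the line *)

(** Averaging over directions costs nothing on the data side, because every unit vector [w] yields
    the same lower bound. For fixed [x], however, [e^(w . x)] is large only for [w] near [x / |x|],
    which is where the factor [tau^(- (n - 1) / 2)] comes from. As the weak form is linear in the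
    test function, finitely many directions depending on [tau] suffice. Only an upper bound for the
    average is needed, so the directions may all lie in one small patch of the sphere.

    The natural decay factor is a power of [|x|], not of [tau]. Half of the exponent [|x| - t] is
    given up to bridge this: far inside the cone that half beats every power of [tau], and the other
    half is kept for the integral over the cone.

    The condition on [p] enters through exponents only. If [E1] and [E2] are the powers of [tau] in
    the bound for [Y] and in the last term, then [E1 / (p - 1) + E2 = - gamma / (2 (p - 1)^2)], so
    [gamma > 0] says that the optimized bound decays in [tau]. *)

Section smooth_line.
Variable R : realType.
Implicit Types (f g : R -> R) (x c d : R) (k : nat).

(** Continuity of the last derivative is not demanded. Once all [k] are taken together this is
    ordinary smoothness, and inductions on [k] only have to exhibit derivatives. *)
Fixpoint Dk k f : Prop :=
  if k is k'.+1 then (forall x, derivable f x 1) /\ Dk k' (derive1 f) else True.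

Definition smooth1 f := forall k, Dk k f.

Lemma smooth1P f : smooth1 f <-> (forall x, derivable f x 1) /\ smooth1 (derive1 f).
Proof.
split=> [sf|[df sf] [|k]//].
by split=> [|k]; [case: (sf 1%N)|case: (sf k.+1)].
Qed.

Lemma smooth1_derivable f x : smooth1 f -> derivable f x 1.
Proof. by move=> /smooth1P[]. Qed.

Lemma smooth1_derive f : smooth1 f -> smooth1 (derive1 f).
Proof. by move=> /smooth1P[]. Qed.

Lemma smooth1_continuous f : smooth1 f -> continuous f.
Proof.
by move=> sf x; apply/differentiable_continuous/derivable1_diffP/smooth1_derivable.
Qed.

Lemma smooth1_is_derive f x : smooth1 f -> is_derive x 1 f ((derive1 f) x).
Proof. by move=> sf; rewrite derive1E; exact/derivableP/smooth1_derivable. Qed.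

Lemma is_derive1_eq f g : (forall x, is_derive x 1 f (g x)) -> (derive1 f) = g.
Proof. by move=> fg; apply/funext => x; rewrite derive1E; case: (fg x). Qed.

Lemma is_derive1_derivable f g : (forall x, is_derive x 1 f (g x)) ->
  forall x, derivable f x 1.
Proof. by move=> fg x; case: (fg x). Qed.

Lemma DkW k f : Dk k.+1 f -> Dk k f.
Proof. by elim: k f => // k IH f [df f'] ; split=> //; exact: IH. Qed.

Lemma Dk_derive k f g : (forall x, is_derive x 1 f (g x)) -> Dk k g -> Dk k.+1 f.
Proof.
by move=> fg gk; split; [exact: is_derive1_derivable fg|rewrite (is_derive1_eq fg)].
Qed.

Lemma Dk_is_derive k f : Dk k.+1 f -> forall x, is_derive x 1 f ((derive1 f) x).
Proof. by move=> [df _] x; rewrite derive1E; exact/derivableP. Qed.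

Lemma Dk_cst k c : Dk k (cst c).
Proof.
by elim: k c => // k IH c; apply: (@Dk_derive _ _ (cst 0)).
Qed.

Lemma DkD k f g : Dk k f -> Dk k g -> Dk k (f \+ g).
Proof.
elim: k f g => // k IH f g fk gk.
apply: (@Dk_derive _ _ ((derive1 f) \+ (derive1 g))); last by apply: IH; [case: fk|case: gk].
move=> x; have := Dk_is_derive fk x; have := Dk_is_derive gk x => *.
exact: is_deriveD.
Qed.

Lemma DkM k f g : Dk k f -> Dk k g -> Dk k (f \* g).
Proof.
elim: k f g => // k IH f g fk gk.
apply: (@Dk_derive _ _ ((f \* (derive1 g)) \+ (g \* (derive1 f)))); last first.
  by apply: DkD; apply: IH; do ?[exact: DkW]; [case: gk|case: fk].
move=> x; have := Dk_is_derive fk x; have := Dk_is_derive gk x => *.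
exact: is_deriveM.
Qed.

Lemma is_derive1_affine f c d x l : is_derive (c * x + d) 1 f l ->
  is_derive x 1 (fun y => f (c * y + d)) (c * l).
Proof.
move=> ff; have h : is_derive x 1 (fun y => c * y + d) (c%R).
  have -> : (fun y => c * y + d) = c *: (@id R) + cst d by [].
  by apply: is_derive_eq; rewrite addr0 /GRing.scale/= mulr1.
by have := @is_derive1_comp _ f _ x l c ff h; rewrite mulrC.
Qed.

Lemma Dk_affine k f c d : Dk k f -> Dk k (fun x => f (c * x + d)).
Proof.
elim: k f => // k IH f fk.
apply: (@Dk_derive _ _ (cst c \* (fun x => (derive1 f) (c * x + d)))); last first.
  by apply: DkM; [exact: Dk_cst|apply: IH; case: fk].
by move=> x; apply: is_derive1_affine; exact: Dk_is_derive fk _.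
Qed.

Lemma DkV k f : (forall x, f x != 0) -> Dk k f -> Dk k (fun x => (f x)^-1).
Proof.
move=> f0; elim: k => // k IH fk; have f'k := DkW fk.
apply: (@Dk_derive _ _ (cst (-1) \*
   (((fun x => (f x)^-1) \* (fun x => (f x)^-1)) \* (derive1 f)))); last first.
  by do ![apply: DkM]; [exact: Dk_cst|exact: IH|exact: IH|case: fk].
move=> x; have := Dk_is_derive fk x => df.
by apply: is_derive_eq (@is_deriveV _ f x _ 1 (f0 x) df) _; rewrite /= /GRing.scale/= expr2 invfM mulN1r mulNr.
Qed.

Lemma Dk_expR k : Dk k (@expR R).
Proof.
elim: k => // k IH; apply: Dk_derive IH => x; exact: is_derive_expR.
Qed.

(** The negative powers are included so that the family is closed under differentiation up to linear
    combinations; smoothness of [flat 0] alone would not support an induction. *)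
Definition flat m x := if 0 < x then x ^- m * expR (- x^-1) else 0.

Lemma flat_ge0 m x : 0 <= flat m x.
Proof.
by rewrite /flat; case: ifP => // x0; rewrite mulr_ge0 ?expR_ge0// invr_ge0 exprn_ge0// ltW.
Qed.

(** With [y = 1 / x] this is [y^(m + 1) <= (m + 1)! e^y], one term of the exponential series. It
    gives continuity at 0. *)
Lemma flat_le m x : flat m x <= (m.+1)`!%:R * `|x|.
Proof.
rewrite /flat; case: ifPn => x0; last by rewrite mulr_ge0.
rewrite gtr0_norm// expRN -exprVn.
have y0 : 0 < x^-1 by rewrite invr_gt0.
set y := x^-1 in y0 *; have -> : x = y^-1 by rewrite invrK.
rewrite ler_pdivrMr ?expR_gt0// mulrAC ler_pdivlMr// mulrC -exprS.
rewrite mulrC -ler_pdivrMr ?ltr0n ?fact_gt0//.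
by apply: le_trans (expR_ge1Dxn m (ltW y0)); rewrite lerDr.
Qed.

Lemma flat_div m x : x^-1 * flat m x = flat m.+1 x.
Proof.
by rewrite /flat; case: ifP => // x0; rewrite ?mulr0// mulrA -invfM -exprS.
Qed.

Lemma flat_is_derive m x : is_derive x 1 (flat m) (flat m.+2 x - m%:R * flat m.+1 x).
Proof.
have [x0|x0|<-] := ltgtP 0 x.
- have E i : flat i x = x ^- i * expR (- x^-1) by rewrite /flat x0.
  rewrite !E.
  apply: (@near_eq_is_derive R R R (fun y : R => y ^- m * expR (- y^-1))).
    near=> y; rewrite /flat ifT//; near: y; exact: lt_nbhsr.
  have xn : x != 0 by rewrite gt_eqF.
  have dV : is_derive x 1 (fun y : R => y^-1) (- x ^- 2 *: 1).
    exact: (@is_deriveV _ id x 1 1 xn).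
  have dN : is_derive x 1 (fun y : R => - y^-1) (- (- x ^- 2 *: 1)).
    exact: is_deriveN.
  have dE := @is_derive1_comp _ expR _ x _ _ (is_derive_expR (- x^-1)) dN.
  have dX := @is_deriveX _ _ (fun y : R => y^-1) m x 1 _ dV.
  have -> : (fun y : R => y ^- m * expR (- y^-1)) =
     ((fun y : R => y^-1) ^+ m * (expR \o (fun y => - y^-1))).
    by apply/funext => y; rewrite mulrfctE exprfctE /= exprVn.
  apply: is_derive_eq; rewrite /= /GRing.scale/=.
  rewrite -!exprVn !mulr1 opprK.
  rewrite !exprfctE.
  case: m {dX} => [|m]; first by rewrite !mul0r !mulr0 !subr0 addr0 expr0 !mul1r mulrC.
  rewrite !exprS.
  ring.
- have E i : flat i x = 0 by rewrite /flat ltNge (ltW x0).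
  rewrite !E mulr0 subr0.
  apply: (@near_eq_is_derive R R R (cst 0)).
    by near=> y; rewrite /flat /= ifF//; apply/negbTE; rewrite -leNgt ltW//; near: y; exact: lt_nbhsl.
- have E i : flat i 0 = 0 by rewrite /flat ltxx.
  rewrite !E mulr0 subr0.
  (* By [flat_div] the difference quotient at 0 is [flat m.+1] itself, which [flat_le] squeezes to
     0. *)
  have cv : (fun h => h^-1 *: ((flat m \o shift 0) (h *: 1) - flat m 0)) @ 0^' --> (0 : R).
    have -> : (fun h : R => h^-1 *: ((flat m \o shift 0) (h *: 1) - flat m 0)) = flat m.+1.
      apply/funext => h /=; rewrite E subr0 addr0.
      by rewrite -flat_div /GRing.scale/= mulr1.
    suff c0 : flat m.+1 x @[x --> (0:R)] --> (0:R) by exact: cvg_within_filter.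
    apply: (@squeeze_cvgr _ _ _ R (cst 0) (fun x => (m.+2)`!%:R * `|x|) (flat m.+1)).
    + by near=> y; rewrite flat_ge0 flat_le.
    + exact: cvg_cst.
    + have := @cvgMl_tmp R R (nbhs (0 : R)) _ Num.norm (m.+2)`!%:R _ (@norm_continuous _ _ (0 : R)).
      by rewrite normr0 mulr0; exact.
  apply: DeriveDef; first by apply/cvg_ex; exists 0.
  by rewrite /derive; exact: cvg_lim.
Unshelve. all: by end_near. Qed.

Lemma Dk_flat k m : Dk k (flat m).
Proof.
elim: k m => // k IH m; apply: (Dk_derive (flat_is_derive m)).
apply: DkD => //; have -> : (fun x => - (m%:R * flat m.+1 x)) = cst (- m%:R) \* flat m.+1.
  by apply/funext => x /=; rewrite mulNr.
by apply: DkM => //; exact: Dk_cst.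
Qed.

Lemma flat0_gt0 x : 0 < x -> 0 < flat 0 x.
Proof. by move=> x0; rewrite /flat x0 expr0 invr1 mul1r expR_gt0. Qed.

Lemma flat0_le0 x : x <= 0 -> flat 0 x = 0.
Proof. by move=> x0; rewrite /flat ltNge x0. Qed.

(** Falls from 1 on [x <= 1/2] to 0 on [1 <= x]. The denominator is positive because [1 - x] and
    [x - 1/2] are never both nonpositive. *)
Definition smooth_step x := flat 0 (1 - x) / (flat 0 (1 - x) + flat 0 (x - 2^-1)).

Let step_den x : 0 < flat 0 (1 - x) + flat 0 (x - 2^-1).
Proof.
have [x1|x1] := ltP x 1.
  by rewrite ltr_wpDr ?flat_ge0// flat0_gt0// subr_gt0.
rewrite ltr_wpDl ?flat_ge0// flat0_gt0// subr_gt0 (lt_le_trans _ x1)//.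
by rewrite invf_lt1// ltr1n.
Qed.

Lemma smooth1_step : smooth1 smooth_step.
Proof.
move=> k.
have h1 : Dk k (fun x : R => flat 0 (1 - x)).
  have -> : (fun x : R => flat 0 (1 - x)) = (fun x => flat 0 (-1 * x + 1)).
    by apply/funext => x; rewrite mulN1r addrC.
  exact/Dk_affine/Dk_flat.
have h2 : Dk k (fun x : R => flat 0 (x - 2^-1)).
  have -> : (fun x : R => flat 0 (x - 2^-1)) = (fun x => flat 0 (1 * x - 2^-1)).
    by apply/funext => x; rewrite mul1r.
  exact/Dk_affine/Dk_flat.
apply: DkM => //; apply: DkV; last exact: DkD.
by move=> x; rewrite gt_eqF//; exact: step_den.
Qed.

Lemma smooth_step_ge0 x : 0 <= smooth_step x.
Proof. by rewrite divr_ge0 ?flat_ge0// ltW//; exact: step_den. Qed.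

Lemma smooth_step_le1 x : smooth_step x <= 1.
Proof. by rewrite ler_pdivrMr ?step_den// mul1r lerDl flat_ge0. Qed.

Lemma smooth_step1 x : x <= 2^-1 -> smooth_step x = 1.
Proof.
move=> x1; rewrite /smooth_step (@flat0_le0 (x - _)) ?subr_le0 ?addr0 ?divff// gt_eqF//.
rewrite flat0_gt0// subr_gt0 (le_lt_trans x1)//; lra.
Qed.

Lemma smooth_step0 x : 1 <= x -> smooth_step x = 0.
Proof. by move=> x1; rewrite /smooth_step flat0_le0 ?subr_le0// mul0r. Qed.

End smooth_line.

(** * Test functions of product form *)

Section Ck_algebra.
Variables (R : realType) (V : normedModType R).
Implicit Types (f g : V -> R) (x v : V) (k : nat).

Lemma CkW k f : Ck k.+1 f -> Ck k f.
Proof.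
elim: k f => [f [] //|k IH f [cf df Df]].
by split=> // v; exact: IH.
Qed.

Lemma Ck_cst k (c : R) : Ck k (cst c : V -> R).
Proof.
elim: k c => [|k IH] c; first exact: cst_continuous.
split=> [|x v|v]; [exact: cst_continuous|exact: derivable_cst|].
by rewrite (_ : (fun x => _) = cst 0) //; apply/funext => x; rewrite derive_cst.
Qed.

Lemma CkD k f g : Ck k f -> Ck k g -> Ck k (f \+ g).
Proof.
elim: k f g => [|k IH] f g fk gk.
  by move=> x; apply: continuousD; [exact: fk|exact: gk].
have [cf df Df] := fk; have [cg dg Dg] := gk.
split=> [x|x v|v]; [exact: continuousD (cf x) (cg x)|exact: derivableD|].
have -> : (fun x => 'D_v (f \+ g) x) = (fun x => 'D_v f x) \+ (fun x => 'D_v g x).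
  by apply/funext => x; rewrite deriveD.
exact: IH (Df v) (Dg v).
Qed.

Lemma CkM k f g : Ck k f -> Ck k g -> Ck k (f \* g).
Proof.
elim: k f g => [|k IH] f g fk gk.
  by move=> x; apply: continuousM; [exact: fk|exact: gk].
have [cf df Df] := fk; have [cg dg Dg] := gk.
split=> [x|x v|v]; [exact: continuousM (cf x) (cg x)|exact: derivableM|].
have -> : (fun x => 'D_v (f \* g) x) =
    (f \* (fun x => 'D_v g x)) \+ (g \* (fun x => 'D_v f x)).
  by apply/funext => x; rewrite deriveM.
by apply: CkD; apply: IH; [exact: CkW fk|exact: Dg|exact: CkW gk|exact: Df].
Qed.

Lemma Ck_prod k (I : Type) (s : seq I) (F : I -> V -> R) :
  (forall i, Ck k (F i)) -> Ck k (fun x => \prod_(i <- s) F i x).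
Proof.
move=> Fk; elim: s => [|i s IH].
  rewrite (_ : (fun x => _) = cst 1); first exact: Ck_cst.
  by apply/funext => x; rewrite big_nil.
rewrite (_ : (fun x => _) = F i \* (fun x => \prod_(i <- s) F i x)).
  exact: CkM.
by apply/funext => x; rewrite big_cons.
Qed.

Lemma is_derive_line f x v (d : R) :
  is_derive (0 : R) 1 (fun s : R => f (s *: v + x)) d -> is_derive x v f d.
Proof.
move=> [df fd]; apply: DeriveDef; [exact/derivable1P|apply: etrans fd].
rewrite /derive; set g1 := fun h => h^-1 *: _; set g2 := fun h => h^-1 *: _.
suff -> : g1 = g2 by [].
by rewrite funeqE /g1 /g2 => h /=; rewrite addr0 scale0r add0r [_%:A]mulr1.
Qed.

Lemma is_derive_lin (h : R -> R) (l : {linear V -> R}) x v (d : R) :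
  is_derive (l x) 1 h d -> is_derive x v (h \o l) (l v * d).
Proof.
move=> hd; apply: is_derive_line.
rewrite (_ : (fun s => _) = (fun s => h (l v * s + l x))).
  by apply: is_derive1_affine; rewrite mulr0 add0r.
by apply/funext => s /=; rewrite linearD linearZ/= mulrC.
Qed.

(** A directional derivative of [h \o l] is a constant times [h' \o l], so the induction stays in
    one variable. Together with [CkM] it makes products of functions of single coordinates
    smooth. *)
Lemma Ck_lin k (h : R -> R) (l : {linear V -> R}) :
  smooth1 h -> continuous l -> Ck k (h \o l).
Proof.
move=> + cl; elim: k h => [|k IH] h sh.
  move=> x; apply: continuous_comp; first exact: cl.
  exact: smooth1_continuous.
have hd x v := @is_derive_lin h l x v _ (smooth1_is_derive (l x) sh).
split=> [x|x v|v].
- apply: continuous_comp; [exact: cl|exact: smooth1_continuous].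
- by case: (hd x v).
- have -> : (fun x => 'D_v (h \o l) x) = cst (l v) \* (derive1 h \o l).
    by apply/funext => x; case: (hd x v).
  by apply: CkM; [exact: Ck_cst|apply: IH; exact: smooth1_derive].
Qed.

End Ck_algebra.

Section tensor.
Variables (R : realType) (n : nat).
Implicit Types (a : R -> R) (h : 'I_n -> R -> R) (z : 'rV[R]_n * R).

(** All test functions have this form: [e^(w . x)] factors over the coordinates, and each partial
    derivative acts on a single factor. *)
Definition tens a h z := a z.2 * \prod_(i < n) h i (z.1 ord0 i).

Let time (z : 'rV[R]_n * R) : R := z.2.
Let coord i (z : 'rV[R]_n * R) : R := z.1 ord0 i.

Let time_lin : linear time. Proof. by []. Qed.
HB.instance Definition _ := GRing.isLinear.Build R _ R _ time time_lin.

Let coord_lin i : linear (coord i).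
Proof. by move=> c x y; rewrite /coord /= !mxE. Qed.
HB.instance Definition _ i := GRing.isLinear.Build R _ R _ (coord i) (coord_lin i).

Let time_cont : continuous time.
Proof. by move=> z; exact: cvg_snd. Qed.

Let coord_cont i : continuous (coord i).
Proof.
move=> z; rewrite /coord.
apply: (@continuous_comp _ _ _ fst (fun x : 'rV[R]_n => x ord0 i)).
  exact: cvg_fst.
exact: coord_continuous.
Qed.

Lemma smooth_tens a h : smooth1 a -> (forall i, smooth1 (h i)) -> smooth (tens a h).
Proof.
move=> sa sh k; apply: (@CkM _ _ _ (a \o time)); first exact: (@Ck_lin R _ k a time sa time_cont).
by apply: (@Ck_prod _ _ k _ _ (fun i => h i \o coord i)) => i; exact: (@Ck_lin R _ k (h i) (coord i) (sh i) (@coord_cont i)).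
Qed.

Lemma dt_tens a h : smooth1 a -> dt (tens a h) = tens (derive1 a) h.
Proof.
move=> sa; apply/funext => z; rewrite /dt.
suff [_ ->] : is_derive z (0, 1) (tens a h) (tens (derive1 a) h z) by [].
apply: is_derive_line.
rewrite (_ : (fun s => _) = (\prod_(i < n) h i (z.1 ord0 i)) *: (fun s => a (1 * s + z.2))).
  apply: is_derive_eq.
    by apply: is_deriveZ; apply: is_derive1_affine; rewrite mulr0 add0r; exact: smooth1_is_derive.
  by rewrite /GRing.scale/= mul1r mulrC.
apply/funext => s; rewrite /tens /= [RHS]mulrC; congr (_ * _).
  by rewrite mulrC.
by apply: eq_bigr => i _; rewrite !mxE mulr0 add0r.
Qed.

Lemma dx_tens i a h : smooth1 (h i) ->
  dx i (tens a h) = tens a (fun j => if j == i then derive1 (h j) else h j).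
Proof.
move=> sh; apply/funext => z; rewrite /dx.
set h' := fun j => _.
suff [_ ->] : is_derive z (evec R i, 0) (tens a h) (tens a h' z) by [].
apply: is_derive_line.
rewrite (_ : (fun s => _) = (a z.2 * \prod_(j < n | j != i) h j (z.1 ord0 j)) *:
    (fun s => h i (1 * s + z.1 ord0 i))).
  apply: is_derive_eq.
    by apply: is_deriveZ; apply: is_derive1_affine; rewrite mulr0 add0r; exact: smooth1_is_derive.
  rewrite /tens [in RHS](bigD1 i)//= /h' eqxx mul1r /GRing.scale/= -mulrA; congr (_ * _).
  rewrite mulrC; congr (_ * _); apply: eq_bigr => j /negbTE -> //.
apply/funext => s; rewrite /tens /= [in LHS](bigD1 i)//= scalrfctE /GRing.scale/=.
rewrite mulr0 add0r -mulrA; congr (_ * _); rewrite mulrC; congr (_ * _).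
  by apply: eq_bigr => j /negbTE ji; rewrite !mxE/= ji mulr0 add0r.
by rewrite !mxE !eqxx/= mulr1 mul1r.
Qed.

Lemma box_tens a h z : smooth1 a -> (forall i, smooth1 (h i)) ->
  box (tens a h) z = tens (derive1 (derive1 a)) h z -
  \sum_(i < n) tens a (fun j => if j == i then derive1 (derive1 (h j)) else h j) z.
Proof.
move=> sa sh; rewrite /box !dt_tens//; last exact: smooth1_derive.
congr (_ - _); apply: eq_bigr => i _; rewrite !dx_tens ?eqxx//.
  by congr tens; apply/funext => j; case: eqP => // ->; rewrite eqxx.
exact: smooth1_derive.
Qed.

Definition cube (L : R) := [set x : 'rV[R]_n | forall i, `[- L, L]%classic (x ord0 i)].

(** A compact set, as local integrability requires, and a product of intervals, so that its measure
    is explicit. *)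
Definition slab (L t0 t1 : R) : set ('rV[R]_n * R) := cube L `*` `[t0, t1].

Lemma compact_slab (L t0 t1 : R) : compact (slab L t0 t1).
Proof.
apply: compact_setX; last exact: segment_compact.
by apply: (@rV_compact _ n (fun=> `[- L, L]%classic)) => i; exact: segment_compact.
Qed.

Lemma supp_tens a h (t0 t1 L : R) :
  (forall t, a t != 0 -> t0 <= t <= t1) ->
  (forall i s, h i s != 0 -> - L <= s <= L) ->
  supp (tens a h) `<=` slab L t0 t1.
Proof.
move=> ha hh; apply: subset_trans (closureS (_ : _ `<=` slab L t0 t1)) _.
  move=> z /=; rewrite /tens mulf_eq0 negb_or => /andP[/ha az hz]; split => /=.
    move=> i; rewrite /= in_itv/=; apply: (hh i); apply: contraNN hz => /eqP hz.
    by rewrite (bigD1 i)//= hz mul0r.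
  by rewrite in_itv.
rewrite -(closure_id _).1//; apply: compact_closed; first exact: norm_hausdorff.
exact: compact_slab.
Qed.

Lemma slab_spacetime (T : \bar R) (L t0 t1 : R) : 0 < t0 -> (t1%:E < T)%E ->
  slab L t0 t1 `<=` @spacetime R n T.
Proof.
move=> t00 t1T z [_ /=]; rewrite in_itv/= => /andP[t0z zt1]; split.
  exact: lt_le_trans t0z.
by apply: le_lt_trans t1T; rewrite lee_fin.
Qed.

Lemma test_tens a h (t0 t1 L : R) (T : \bar R) :
  smooth1 a -> (forall i, smooth1 (h i)) ->
  0 < t0 -> (t1%:E < T)%E ->
  (forall t, a t != 0 -> t0 <= t <= t1) ->
  (forall i s, h i s != 0 -> - L <= s <= L) ->
  test_function (@spacetime R n T) (tens a h).
Proof.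
move=> sa sh t00 t1T ha hh; have sK := supp_tens ha hh; split.
- exact: smooth_tens.
- exact: (subclosed_compact (@closed_closure _ _) (@compact_slab L t0 t1)).
- exact: subset_trans sK (slab_spacetime t00 t1T).
Qed.

Lemma measurable_cube (L : R) : measurable (cube L).
Proof.
rewrite (_ : cube L = \bigcap_(i in [set: 'I_n])
    ((fun x : 'rV[R]_n => x ord0 i) @^-1` `[- L, L]%classic)).
  apply: fin_bigcap_measurable => // i _.
  by rewrite -[X in measurable X]setTI; exact: measurable_coord.
by apply/seteqP; split => x /= h i => [_|]; apply: h.
Qed.

Lemma measurable_slab (L t0 t1 : R) : measurable (slab L t0 t1).
Proof. by apply: measurableX => //; exact: measurable_cube. Qed.

Lemma cube_measure (L : R) : 0 <= L ->
  lebesgue_rV R n (cube L) = ((2 * L) ^+ n)%:E.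
Proof.
move=> L0; rewrite /cube (@lebesgue_rV_box R n (fun=> `[- L, L]%classic))//.
rewrite (eq_bigr (fun=> (2 * L)%:E)).
  by rewrite prodEFin big_const_ord iter_mulr_1.
move=> i _; rewrite lebesgue_measure_itv/= lte_fin.
case: ltP => [_|LL]; first by rewrite -EFinB opprK mulr_natl.
have -> : L = 0 by lra.
by rewrite mulr0.
Qed.

End tensor.

(** * Cutoffs and plane waves *)

Section cutoffs.
Variable R : realType.
Implicit Types (f g : R -> R) (x c d s t : R) (k : nat).

Lemma derive1_eq_on f g (D : set R) : open D -> {in D, f =1 g} -> {in D, derive1 f =1 derive1 g}.
Proof.
move=> oD fg x xD; rewrite !derive1E; apply: near_eq_derive.
have : nbhs x D by apply: open_nbhs_nbhs; split=> //; rewrite inE in xD.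
by apply: filterS => y Dy; apply: fg; rewrite inE.
Qed.

Lemma smooth1M f g : smooth1 f -> smooth1 g -> smooth1 (f \* g).
Proof. by move=> sf sg k; exact: DkM. Qed.

Lemma smooth1_cst c : smooth1 (cst c : R -> R).
Proof. by move=> k; exact: Dk_cst. Qed.

Lemma smooth1D f g : smooth1 f -> smooth1 g -> smooth1 (f \+ g).
Proof. by move=> sf sg k; exact: DkD. Qed.

Lemma smooth1_affine f c d : smooth1 f -> smooth1 (fun x => f (c * x + d)).
Proof. by move=> sf k; exact: Dk_affine. Qed.

Lemma smooth1_scale f c : smooth1 f -> smooth1 (fun x => f (c * x)).
Proof.
move=> /(@smooth1_affine _ c 0); congr smooth1.
by apply/funext => x; rewrite addr0.
Qed.

Lemma smooth1_expR c : smooth1 (fun x : R => expR (c * x)).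
Proof. by apply: smooth1_scale => k; exact: Dk_expR. Qed.

Lemma smooth1X f k : smooth1 f -> smooth1 (fun x => f x ^+ k).
Proof.
move=> sf; elim: k => [|k IH].
  exact: smooth1_cst.
have -> : (fun x => f x ^+ k.+1) = f \* (fun x => f x ^+ k).
  by apply/funext => x; rewrite exprS.
exact: smooth1M.
Qed.

Lemma derive1_mul f g : smooth1 f -> smooth1 g ->
  derive1 (f \* g) = (derive1 f \* g) \+ (f \* derive1 g).
Proof.
move=> sf sg; apply: is_derive1_eq => x.
have df := smooth1_is_derive x sf; have dg := smooth1_is_derive x sg.
apply: is_derive_eq (@is_deriveM R R f g x 1 _ _ df dg) _.
by rewrite /GRing.scale/= addrC mulrC.
Qed.

Lemma derive1_add f g : smooth1 f -> smooth1 g ->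
  derive1 (f \+ g) = derive1 f \+ derive1 g.
Proof.
move=> sf sg; apply: is_derive1_eq => x.
have df := smooth1_is_derive x sf; have dg := smooth1_is_derive x sg.
exact: (@is_deriveD R R R f g x 1 _ _ df dg).
Qed.

Lemma derive1_scale f c : smooth1 f ->
  derive1 (fun x => f (c * x)) = fun x => c * derive1 f (c * x).
Proof.
move=> sf; apply: is_derive1_eq => x.
have := @is_derive1_affine R f c 0 x (derive1 f (c * x)).
rewrite addr0; under eq_fun do rewrite addr0.
by apply; exact: smooth1_is_derive.
Qed.

Lemma derive1_expR_scale c : derive1 (fun x : R => expR (c * x)) = fun x => c * expR (c * x).
Proof.
rewrite derive1_scale; last by move=> k; exact: Dk_expR.
by apply/funext => x; rewrite derive1E derive_val.
Qed.

Lemma smooth1_bounded f a b : a <= b -> smooth1 f -> (forall s, f s != 0 -> a <= s <= b) ->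
  exists2 C, 0 <= C & forall s, `|f s| <= C.
Proof.
move=> ab sf f0.
have [|c _ hc] := @EVT_max R (fun s => `|f s|) a b ab.
  apply: continuous_subspaceT => x; apply: continuous_comp; last exact: norm_continuous.
  exact: smooth1_continuous.
exists `|f c| => // s; have [->|/f0 sab] := eqVneq (f s) 0; first by rewrite normr0.
by apply: hc; rewrite in_itv.
Qed.

Lemma derive1_locally_cst f c (D : set R) : open D -> (forall s, D s -> f s = c) ->
  forall s, D s -> derive1 f s = 0.
Proof.
move=> oD fc s Ds.
rewrite (@derive1_eq_on f (cst c) D oD)//; last by rewrite inE.
  by rewrite derive1_cst.
by move=> y; rewrite inE => /fc.
Qed.

Local Notation S := (@smooth_step R).

Lemma derive1_cst_outside f c1 c2 a b : (forall s, s < a -> f s = c1) ->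
  (forall s, b < s -> f s = c2) -> forall s, derive1 f s != 0 -> a <= s <= b.
Proof.
move=> f1 f2 s fs; apply/andP; split; rewrite leNgt; apply: contraNN fs => h; apply/eqP.
- exact: (@derive1_locally_cst f c1 [set x | x < a] (@open_lt _ _) f1 _ h).
- exact: (@derive1_locally_cst f c2 [set x | b < x] (@open_gt _ _) f2 _ h).
Qed.

Lemma derive1_step_supp s : derive1 S s != 0 -> 2^-1 <= s <= 1.
Proof.
apply: (@derive1_cst_outside _ 1 0) => t ht.
- by rewrite smooth_step1// ltW.
- by rewrite smooth_step0// ltW.
Qed.

(** Differentiating [S (A + B) = A] gives [S' (A + B) = (1 - S) A' - S B'], where [A] decreases, [B]
    increases and [0 <= S <= 1]. The sign makes [- S'] a nonnegative weight near the initial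
    time. *)
Lemma derive1_step_le0 s : derive1 S s <= 0.
Proof.
pose A (x : R) := flat 0 (1 - x); pose B (x : R) := flat 0 (x - 2^-1).
have AE : A = fun x => flat 0 (- 1 * x + 1).
  by apply/funext => x; rewrite /A mulN1r addrC.
have BE : B = fun x => flat 0 (1 * x - 2^-1).
  by apply/funext => x; rewrite /B mul1r.
have sf : smooth1 (flat 0 : R -> R) by move=> k; exact: Dk_flat.
have sA : smooth1 A by rewrite AE; exact: smooth1_affine.
have sB : smooth1 B by rewrite BE; exact: smooth1_affine.
have f' x : is_derive x 1 (flat 0 : R -> R) (flat 2 x).
  by apply: is_derive_eq (flat_is_derive 0 x) _; rewrite mul0r subr0.
have A' : derive1 A s <= 0.
  rewrite AE derive1E.
  have [_ ->] := @is_derive1_affine R _ (- 1) 1 s _ (f' _).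
  by rewrite mulN1r oppr_le0 flat_ge0.
have B' : 0 <= derive1 B s.
  rewrite BE derive1E.
  have [_ ->] := @is_derive1_affine R _ 1 (- 2^-1) s _ (f' _).
  by rewrite mul1r flat_ge0.
have dAB : 0 < A s + B s.
  have [s1|s1] := ltP s 1.
    by rewrite ltr_wpDr ?flat_ge0// flat0_gt0// subr_gt0.
  by rewrite ltr_wpDl ?flat_ge0// flat0_gt0//; lra.
have SE : S \* (A \+ B) = A.
  apply/funext => x /=; rewrite /smooth_step -/(A x) -/(B x) divfK// gt_eqF//.
  have [x1|x1] := ltP x 1.
    by rewrite ltr_wpDr ?flat_ge0// flat0_gt0// subr_gt0.
  by rewrite ltr_wpDl ?flat_ge0// flat0_gt0//; lra.
have := congr1 (fun f => derive1 f s) SE.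
rewrite derive1_mul; [|exact: smooth1_step|exact: smooth1D].
rewrite derive1_add//= => h.
have S0 := smooth_step_ge0 s; have S1 := smooth_step_le1 s.
rewrite -(@pmulr_lle0 _ (A s + B s))//.
nra.
Qed.

Lemma derive1_exp f k s : smooth1 f ->
  derive1 (fun x => f x ^+ k) s = k%:R * f s ^+ k.-1 * derive1 f s.
Proof.
move=> sf; have df := smooth1_is_derive s sf; rewrite derive1E.
by have [_] := @is_deriveX R R f k s _ _ df; rewrite exprfctE => ->.
Qed.

(* The power makes the derivatives of [A] controlled by [A `^ p^-1]. *)
Lemma power_cutoff (p : R) : 1 < p -> exists A : R -> R, exists C : R,
  [/\ smooth1 A, forall s, s <= 2^-1 -> A s = 1, forall s, 1 <= s -> A s = 0,
      forall s, 0 <= A s <= 1 & [/\ 0 <= C,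
      forall s, `|derive1 A s| <= C * A s `^ p^-1 &
      forall s, `|derive1 (derive1 A) s| <= C * A s `^ p^-1]].
Proof.
move=> p1; have p0 : 0 < p by exact: lt_trans p1.
have sS := @smooth1_step R; have sS' := smooth1_derive sS.
have [C1 C10 hC1] : exists2 C, 0 <= C & forall s, `|derive1 S s| <= C.
  by apply: (@smooth1_bounded _ 2^-1 1 _ sS' derive1_step_supp); lra.
have [C2 C20 hC2] : exists2 C, 0 <= C & forall s, `|derive1 (derive1 S) s| <= C.
  apply: (@smooth1_bounded _ 2^-1 1 _ (smooth1_derive sS')); first lra.
  apply: (@derive1_cst_outside _ 0 0) => t ht; apply/eqP; apply/negPn/negP => /derive1_step_supp.
    by rewrite leNgt ht.
  by rewrite [X in _ && X]leNgt ht andbF.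
(* The worst factor in the second derivative of [S^m] is [S^(m - 2)]. As [0 <= S <= 1], it is at
   most [S^(m / p)] as soon as [m / p <= m - 2]. *)
have [m hm] : exists m : nat, 2 / (1 - p^-1) < m%:R.
  by eexists; apply: archi_boundP; rewrite divr_ge0// subr_ge0 invf_le1// ltW.
have pV : 0 < p^-1 < 1 by rewrite invr_gt0 p0 invf_lt1.
have hm2 : 2 < m%:R * (1 - p^-1) by rewrite -ltr_pdivrMr// subr_gt0; case/andP: pV.
have m2 : (2 < m)%N by rewrite -(ltr_nat R); have := ler0n R m; nra.
pose A s := S s ^+ m; exists A.
exists (m%:R * C1 + (m%:R * m.-1%:R * C1 ^+ 2 + m%:R * C2)).
have SA s : S s ^+ m.-2 <= A s `^ p^-1.
  have [S0|S0] := eqVneq (S s) 0.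
    by rewrite S0 expr0n (_ : (_ == _) = false) ?powR_ge0//; lia.
  have Spos : 0 < S s by rewrite lt_neqAle eq_sym S0 smooth_step_ge0.
  rewrite /A -(powR_mulrn m.-2 (ltW Spos)) -(powR_mulrn m (ltW Spos)) -powRrM.
  apply: ger_powR; first by rewrite Spos smooth_step_le1.
  have -> : m.-2%:R = m%:R - 2 :> R by rewrite -subn2 natrB// ltnW.
  nra.
have S01 s : 0 <= S s <= 1 by rewrite smooth_step_ge0 smooth_step_le1.
have dA s : derive1 A s = m%:R * S s ^+ m.-1 * derive1 S s by exact: derive1_exp.
have dA' : derive1 A = (cst m%:R \* (fun s => S s ^+ m.-1)) \* derive1 S.
  by apply/funext => s; rewrite dA.
have sX := smooth1X _ sS.
split=> [||s s1|s|]; first exact: smooth1X.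
- by move=> s s1; rewrite /A smooth_step1// expr1n.
- by rewrite /A smooth_step0// expr0n (_ : (_ == _) = false)//; lia.
- by rewrite exprn_ge0 ?smooth_step_ge0// exprn_ile1 ?smooth_step_ge0 ?smooth_step_le1.
have Sm s : S s ^+ m.-1 <= S s ^+ m.-2.
  by apply: ler_wiXn2l; rewrite ?smooth_step_ge0 ?smooth_step_le1// leq_pred.
have X0 s k : 0 <= S s ^+ k by rewrite exprn_ge0 ?smooth_step_ge0.
split=> [|s|s].
- by rewrite !addr_ge0 ?mulr_ge0 ?exprn_ge0.
- rewrite dA !normrM normr_nat (ger0_norm (X0 _ _)).
  apply: (@le_trans _ _ ((m%:R * C1) * A s `^ p^-1)); last first.
    by rewrite ler_wpM2r ?powR_ge0// lerDl addr_ge0 ?mulr_ge0 ?exprn_ge0.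
  rewrite mulrAC ler_pM ?mulr_ge0// ?ler_wpM2l//.
  exact: le_trans (Sm s) (SA s).
- rewrite dA' derive1_mul//; last by apply: smooth1M => //; exact: smooth1_cst.
  rewrite derive1_mul//; last exact: smooth1_cst.
  rewrite /= derive1_cst mul0r add0r derive1_exp//.
  apply: (@le_trans _ _ ((m%:R * m.-1%:R * C1 ^+ 2 + m%:R * C2) * A s `^ p^-1)); last first.
    by rewrite ler_wpM2r ?powR_ge0// lerDr mulr_ge0.
  apply: le_trans (ler_normD _ _) _; rewrite mulrDl lerD//.
    rewrite !normrM !normr_nat (ger0_norm (X0 _ _)) expr2.
    rewrite (_ : _ * _ = m%:R * m.-1%:R * (`|derive1 S s| * `|derive1 S s|) * S s ^+ m.-2).
      rewrite ler_pM ?mulr_ge0//; rewrite ler_wpM2l ?mulr_ge0//.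
      by rewrite ler_pM.
    ring.
  rewrite !normrM !normr_nat (ger0_norm (X0 _ _)).
  rewrite mulrAC ler_pM ?mulr_ge0// ?ler_wpM2l//.
  exact: le_trans (Sm s) (SA s).
Qed.

(** Test functions need compact support. The two-sided cutoff is 1 for [|s| <= L] and 0 for
    [|s| >= 2 L], so it is invisible on a cone that stays within [L]. *)
Definition plane (w L s : R) := expR (w * s) * (S ((2 * L)^-1 * s) * S ((- (2 * L)^-1) * s)).

Lemma smooth1_plane w L : smooth1 (plane w L).
Proof.
apply: (@smooth1M (fun s => expR (w * s))); first exact: smooth1_expR.
apply: (@smooth1M (fun s => S ((2 * L)^-1 * s))); apply: smooth1_scale; exact: smooth1_step.
Qed.

Lemma plane_supp w L s : 0 < L -> plane w L s != 0 -> - (2 * L) <= s <= 2 * L.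
Proof.
move=> L0; have L20 : 0 < 2 * L by rewrite mulr_gt0.
rewrite /plane mulf_eq0 negb_or (mulf_eq0 (S _)) negb_or => /and3P[_ h1 h2]; apply/andP; split.
- rewrite leNgt; apply/negP => h; move/eqP: h2.  apply; rewrite smooth_step0//.
  by rewrite mulNr -mulrN mulrC ler_pdivlMr// mul1r lerNr ltW.
- rewrite leNgt; apply/negP => h; move/eqP: h1; apply; rewrite smooth_step0//.
  by rewrite mulrC ler_pdivlMr// mul1r ltW.
Qed.

Lemma planeE w L s : 0 < L -> `|s| <= L -> plane w L s = expR (w * s).
Proof.
move=> L0; rewrite ler_norml => /andP[s1 s2]; have L20 : 0 < 2 * L by rewrite mulr_gt0.
have h (x : R) : x <= L -> (2 * L)^-1 * x <= 2^-1.
  by move=> xL; rewrite invfM -mulrA ler_piMr ?invr_ge0// mulrC ler_pdivrMr// mul1r.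
rewrite /plane !smooth_step1 ?mulr1 ?h//.
by rewrite mulNr -mulrN h// lerNl.
Qed.

Lemma plane_D2 w L s : 0 < L -> `|s| < L ->
  derive1 (derive1 (plane w L)) s = w ^+ 2 * expR (w * s).
Proof.
move=> L0 sL; set D := [set x : R | `|x| < L].
have oD : open D.
  have -> : D = Num.norm @^-1` [set x | x < L] by [].
  by apply: open_comp; [move=> x _; exact: norm_continuous|exact: open_lt].
have h1 : {in D, plane w L =1 (fun s => expR (w * s))}.
  by move=> x; rewrite inE => xD; apply: planeE => //; exact: ltW.
have h2 := derive1_eq_on oD h1; have h3 := derive1_eq_on oD h2.
rewrite h3 ?inE//.
rewrite derive1_expR_scale.
have -> : (fun x => w * expR (w * x)) = cst w \* (fun x => expR (w * x)) by [].
rewrite derive1_mul; [|exact: smooth1_cst|exact: smooth1_expR].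
rewrite derive1_expR_scale /= derive1_cst mul0r add0r expr2 mulrA//.
Qed.

End cutoffs.

(** * Integration over space-time *)

Lemma le_of_eq disp (T : porderType disp) (x y : T) : x = y -> (x <= y)%O.
Proof. by move=> ->. Qed.

Section spacetime_measure.
Variables (R : realType) (n : nat).
Local Notation mu := (lebesgue_rV R n).
Local Notation leb := (@lebesgue_measure R).
Local Notation M := (mu \x leb)%E.
Local Notation X := 'rV[R]_n.
Implicit Types (w : X -> R -> R).

Lemma measurable_enorm : measurable_fun [set: X] (fun x : X => enorm x : measurableTypeR R).
Proof.
apply: (@measurableT_comp _ _ _ _ _ _ (@Num.sqrt R)).
  exact: (continuous_measurable_fun (@sqrt_continuous R)).
apply: measurable_sum => i; apply: measurable_funX; exact: measurable_coord.
Qed.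

Lemma enorm_ge0 (x : X) : 0 <= enorm x. Proof. exact: sqrtr_ge0. Qed.

Definition cone (r : R) := [set z : X * R | enorm z.1 <= z.2 + r].

Lemma measurable_cone r : measurable (cone r : set (X * measurableTypeR R)).
Proof.
pose g (z : X * measurableTypeR R) : measurableTypeR R := z.2 + r - enorm z.1.
have mg : measurable_fun setT g.
  apply: measurable_funB; first by apply: measurable_funD => //; exact: measurable_snd.
  apply: (@measurableT_comp _ _ _ _ _ _ (fun x : X => enorm x : measurableTypeR R)).
    exact: measurable_enorm.
  exact: measurable_fst.
rewrite (_ : cone r = g @^-1` `[0, +oo[).
  by rewrite -[X in measurable X]setTI; apply: mg => //; exact: measurable_itv.
by apply/seteqP; split => z /=; rewrite in_itv/= andbT subr_ge0.
Qed.

Lemma coord_le_enorm (x : X) i : `|x ord0 i| <= enorm x.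
Proof.
rewrite /enorm -sqrtr_sqr ler_wsqrtr// (bigD1 i)//= lerDl.
by apply: sumr_ge0 => j _; exact: sqr_ge0.
Qed.

(** The support condition holds almost everywhere at each fixed time. Joint measurability on [K]
    makes the exceptional set [N] measurable, its time sections are null, and Tonelli makes [N] null
    in space-time. *)
Lemma ae_cone w (K : set (X * measurableTypeR R)) (r : R) (I : set R) :
  measurable K -> measurable_fun K (fun z => w z.1 z.2) ->
  K `<=` [set z | I z.2] ->
  (forall t, I t -> {ae mu, forall x, t + r < enorm x -> w x t = 0}) ->
  {ae M, forall z, K z -> ~ cone r z -> w z.1 z.2 = 0}.
Proof.
move=> mK mw KI w0.
pose N := K `&` (~` cone r) `&` (K `&` (fun z => w z.1 z.2) @^-1` (~` [set 0])).
have mN : measurable N.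
  apply: measurableI; first by apply: measurableI => //; apply: measurableC; exact: measurable_cone.
  by apply: mw => //; apply: measurableC.
exists N; split=> //; last first.
  move=> z /= /not_implyP[Kz] /not_implyP[Cz wz]; split; split => //.
rewrite -[N]setIT -(@integral_indic _ _ _ M setT measurableT N mN).
rewrite (fubini_tonelli2 (EFin \o \1_N)) /=; last 2 first.
- by apply/measurable_EFinP; exact: measurable_indic.
- by move=> z; rewrite lee_fin.
apply: integral0_eq => t _; rewrite /fubini_G /=.
have [It|nIt] := pselect (I t); last first.
  apply: integral0_eq => x _; rewrite indicE memNset// => -[[/KI /=]].
  by move=> h; exfalso; exact: nIt h.
have -> : (fun x => (\1_N (x, t))%:E : \bar R) = (fun x => (\1_(ysection N t) x)%:E).
  by apply/funext => x; rewrite !indicE mem_ysection.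
rewrite integral_indic ?setIT//; last exact: measurable_ysection.
have [A [mA A0 hA]] := w0 t It.
apply: (subset_measure0 _ mA _ A0); first exact: measurable_ysection.
move=> x; rewrite /ysection /= inE => -[[_ Cx] [_ /= wx]].
by apply: hA => /= h; apply: wx; apply: h; rewrite ltNge; apply/negP.
Qed.

(** For the initial layer, where continuity in time bounds the space integral uniformly in [t]. *)
Lemma ge0_tonelli_le (F : X -> R -> \bar R) (B : set X) (I : set R) (c : \bar R) :
  measurable B -> measurable (I : set (measurableTypeR R)) ->
  measurable_fun (B `*` I : set (X * measurableTypeR R)) (fun z => F z.1 z.2) ->
  (forall x t, (0 <= F x t)%E) ->
  (forall t, I t -> (\int[mu]_(x in B) F x t <= c)%E) ->
  (\int[M]_(z in B `*` I) F z.1 z.2 <= c * leb I)%E.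
Proof.
move=> mB mI mF F0 Fc.
have mBI : measurable (B `*` I : set (X * measurableTypeR R)) by exact: measurableX.
have mFr : measurable_fun setT ((fun z => F z.1 z.2) \_ (B `*` I)).
  by apply/(measurable_restrictT _ mBI).
have Fr0 z : (0 <= ((fun z => F z.1 z.2) \_ (B `*` I)) z)%E by exact: erestrict_ge0.
rewrite integral_mkcond fubini_tonelli2//.
have E : fubini_G mu ((fun z => F z.1 z.2) \_ (B `*` I)) =
   (fun t => \int[mu]_(x in B) F x t)%E \_ I.
  apply/funext => t; rewrite /fubini_G [RHS]patchE; case: ifPn => [tI|tI].
    rewrite [RHS]integral_mkcond; apply: eq_integral => x _.
    by rewrite !patchE in_setX tI andbT.
  by apply: integral0_eq => x _; rewrite patchE in_setX (negbTE tI) andbF.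
have mG := measurable_fun_fubini_tonelli_G (m1 := mu) _ mFr Fr0.
rewrite E in mG.
apply: (@le_trans _ _ (\int[leb]_(t in I) (\int[mu]_(x in B) F x t))%E).
  rewrite [leRHS]integral_mkcond; apply: le_of_eq; apply: eq_integral => t _.
  exact: (congr1 (@^~ t) E).
rewrite -integral_cst//; apply: ge0_le_integral => //.
- by move=> t _; exact: integral_ge0.
- exact/(measurable_restrictT _ mI).
Qed.

(** The other order of integration, for exponentials of [|x| - t], whose time integral is bounded
    uniformly in [x]. *)
Lemma ge0_tonelli_le2 (F : X -> R -> \bar R) (B : set X) (I : set R) (c : \bar R) :
  measurable B -> measurable (I : set (measurableTypeR R)) ->
  measurable_fun (B `*` I : set (X * measurableTypeR R)) (fun z => F z.1 z.2) ->
  (forall x t, (0 <= F x t)%E) ->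
  (forall x, B x -> (\int[leb]_(t in I) F x t <= c)%E) ->
  (\int[M]_(z in B `*` I) F z.1 z.2 <= c * mu B)%E.
Proof.
move=> mB mI mF F0 Fc.
have mBI : measurable (B `*` I : set (X * measurableTypeR R)) by exact: measurableX.
have mFr : measurable_fun setT ((fun z => F z.1 z.2) \_ (B `*` I)).
  by apply/(measurable_restrictT _ mBI).
have Fr0 z : (0 <= ((fun z => F z.1 z.2) \_ (B `*` I)) z)%E by exact: erestrict_ge0.
rewrite integral_mkcond fubini_tonelli1//.
have E : fubini_F leb ((fun z => F z.1 z.2) \_ (B `*` I)) =
   (fun x => \int[leb]_(t in I) F x t)%E \_ B.
  apply/funext => t; rewrite /fubini_F [RHS]patchE; case: ifPn => [tI|tI].
    rewrite [RHS]integral_mkcond; apply: eq_integral => x _.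
    by rewrite !patchE in_setX tI.
  by apply: integral0_eq => x _; rewrite patchE in_setX (negbTE tI).
have mG := measurable_fun_fubini_tonelli_F (m2 := leb) _ mFr Fr0.
rewrite E in mG.
apply: (@le_trans _ _ (\int[mu]_(x in B) (\int[leb]_(t in I) F x t))%E).
  rewrite [leRHS]integral_mkcond; apply: le_of_eq; apply: eq_integral => x _.
  exact: (congr1 (@^~ x) E).
rewrite -integral_cst//; apply: ge0_le_integral => //.
- by move=> x _; exact: integral_ge0.
- exact/(measurable_restrictT _ mB).
Qed.

Lemma ge0_tonelli_prod (f : X -> \bar R) (g : R -> \bar R) (B : set X) (I : set R) :
  measurable B -> measurable (I : set (measurableTypeR R)) ->
  measurable_fun B f -> measurable_fun (I : set (measurableTypeR R)) g ->
  (forall x, (0 <= f x)%E) -> (forall t, (0 <= g t)%E) ->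
  (\int[M]_(z in B `*` I) (f z.1 * g z.2) =
   \int[mu]_(x in B) f x * \int[leb]_(t in I) g t)%E.
Proof.
move=> mB mI mf mg f0 g0.
have mBI : measurable (B `*` I : set (X * measurableTypeR R)) by exact: measurableX.
have E : ((fun z => (f z.1 * g z.2)%E) \_ (B `*` I)) =
    (fun z => (f \_ B) z.1 * (g \_ I) z.2)%E.
  apply/funext => z; rewrite !patchE in_setX.
  by case: ifPn => [/andP[-> ->]//|]; rewrite negb_and => /orP[]/negbTE ->;
    rewrite ?mul0e ?mule0.
have mf' : measurable_fun setT (f \_ B) by apply/(measurable_restrictT _ mB).
have mg' : measurable_fun setT (g \_ I : measurableTypeR R -> \bar R).
  by apply/(measurable_restrictT _ mI).
have f0' x : (0 <= (f \_ B) x)%E by exact: erestrict_ge0.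
have g0' x : (0 <= (g \_ I) x)%E by exact: erestrict_ge0.
rewrite integral_mkcond E fubini_tonelli1/=; last 2 first.
- apply: emeasurable_funM; first by apply: measurableT_comp => //; exact: measurable_fst.
  by apply: measurableT_comp => //; exact: measurable_snd.
- by move=> z; exact: mule_ge0.
rewrite /fubini_F /= [in RHS]integral_mkcond [X in (_ * X)%E]integral_mkcond.
rewrite -ge0_integralZr//; last exact: integral_ge0.
by apply: eq_integral => x _; rewrite ge0_integralZl.
Qed.

Lemma slab_measure (L t0 t1 : R) : 0 <= L -> t0 <= t1 ->
  M (@slab R n L t0 t1) = ((2 * L) ^+ n * (t1 - t0))%:E.
Proof.
move=> L0 t01; rewrite product_measure1E//; last exact: measurable_cube.
rewrite EFinM; congr (_ * _)%E; first exact: cube_measure.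
apply: etrans (lebesgue_measure_itv _) _; rewrite /= lte_fin.
case: ltP => [_|t10]; first by rewrite EFinB.
by rewrite (_ : t1 = t0) ?subrr//; apply/eqP; rewrite eq_le t10.
Qed.

(** Only the lower endpoint of the antiderivative counts, so the bound does not depend on [N]. For
    [s = |x|] the interval starts at the time [|x| - r] at which the cone reaches [x]. *)
Lemma integral_exp_le (s r N c : R) : 0 < c -> 0 < N ->
  (\int[leb]_(t in `[(s - r)%R, (s - r + N)%R]) (expR (c * (s - t)))%:E
    <= (expR (c * r) / c)%:E)%E.
Proof.
move=> c0 N0.
pose G (t : R) : R := - c^-1 * expR (c * (s - t)).
have dG (t : R) : is_derive t 1 G (expR (c * (s - t))).
  have h : is_derive t 1 (fun t : R => expR (- c * t + c * s)) (- c * expR (- c * t + c * s)).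
    exact: is_derive1_affine.
  have -> : G = - c^-1 *: (fun t : R => expR (- c * t + c * s)).
    by apply/funext => y; rewrite /G; congr (_ * expR _); ring.
  apply: is_derive_eq; rewrite /GRing.scale/= mulrA mulrNN mulVf ?gt_eqF// mul1r.
  by congr expR; ring.
have cf : continuous (fun t : R => expR (c * (s - t))).
  move=> t; apply: continuous_comp; last exact: continuous_expR.
  apply: (@cvgMl_tmp R R); apply: cvgB; [exact: cvg_cst|exact: cvg_id].
have cG : continuous G.
  by move=> t; apply/differentiable_continuous/derivable1_diffP; case: (dG t).
rewrite (@continuous_FTC2 _ _ G).
- rewrite -EFinB lee_fin /G.
  have -> : s - (s - r) = r by ring.
  rewrite !mulNr opprK addrC lerBlDr [X in _ <= X + _]mulrC lerDl.
  by rewrite mulr_ge0 ?invr_ge0 ?expR_ge0// ltW.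
- by rewrite ltrDl.
- exact: continuous_subspaceT.
- split; [by move=> x _; case: (dG x)|exact/cvg_at_right_filter/cG|exact/cvg_at_left_filter/cG].
- by move=> x _; rewrite derive1E; case: (dG x).
Qed.

End spacetime_measure.

(** * Continuity at the initial time *)

Section initial_layer.
Variables (R : realType) (n : nat).
Local Notation mu := (lebesgue_rV R n).
Local Notation X := 'rV[R]_n.
Implicit Types (w : X -> R -> R) (h : X -> R).

Lemma L2_measurable h : L2 h -> measurable_fun [set: X] h.
Proof. by move=> /sub_Lfun_mfun; rewrite inE. Qed.

(** Hölder against the indicator of the cube; adding 1 to its [L^2] norm makes the constant
    positive. *)
Lemma cube_L1 (L : R) : 0 <= L -> exists2 C : R, 0 < C &
  forall h, measurable_fun [set: X] h ->
  (\int[mu]_(x in cube (n:=n) L) `|h x|%:E <= C%:E * L2norm h)%E.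
Proof.
move=> L0; set B := cube L.
have mB : measurable B := measurable_cube L.
have N2 : ('N[mu]_2%:E[EFin \o \1_B] < +oo)%E.
  rewrite unlock.
  have -> : (\int[mu]_x `|(EFin \o \1_B) x| `^ 2)%E = mu B.
    rewrite -[in RHS](setIT B) -integral_indic//; apply: eq_integral => x _ /=.
    rewrite indicE; case: (x \in B) => /=.
      by rewrite normr1 powR1.
    by rewrite normr0 powR0.
  by rewrite cube_measure// poweR_EFin ltry.
exists (fine 'N[mu]_2%:E[EFin \o \1_B] + 1).
  by rewrite ltr_wpDl// fine_ge0// Lnorm_ge0.
move=> h mh.
have m1 : measurable_fun [set: X] (\1_B : X -> R) by exact: measurable_indic.
have := @hoelder _ X R mu h (\1_B) 2 2 mh m1.
rewrite ltr0n => /(_ isT isT) H.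
have h1 : (2^-1 + 2^-1 = 1 :> R)%R by lra.
have {H} := H h1; rewrite Lnorm1.
have -> : (\int[mu]_x `|(EFin \o (h \* \1_B)%R) x| = \int[mu]_(x in B) `|h x|%:E)%E.
  rewrite [RHS]integral_mkcond; apply: eq_integral => x _ /=.
  rewrite patchE indicE; case: (x \in B) => /=.
    by rewrite mulr1.
  by rewrite mulr0 normr0.
move=> /le_trans; apply; rewrite muleC lee_wpmul2r ?Lnorm_ge0//.
by rewrite -[leLHS]fineK ?ge0_fin_numE ?Lnorm_ge0// lee_fin lerDl.
Qed.

Lemma L2norm_le_H1norm h : (L2norm h <= H1norm h)%E.
Proof.
have N0 (g : X -> R) : (0 <= L2norm g)%E by exact: Lnorm_ge0.
rewrite /H1norm -[X in (X <= _)%E](@poweRe1 R) ?N0//.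
rewrite -[in X in (_ `^ X <= _)%E](@mulfV R 2)//.
rewrite poweRrM; apply: gt0_ler_poweR => //.
- by rewrite in_itv/= leey poweR_ge0.
- by rewrite in_itv/= leey adde_ge0// ?sume_ge0// ?poweR_ge0// => i _; exact: poweR_ge0.
- by rewrite leeDl// sume_ge0// => i _; exact: poweR_ge0.
Qed.

(** The norm is a parameter because [u] is continuous in [H^1] and [v] only in [L^2]; domination of
    the [L^2] norm is all that [cube_L1] needs. *)
Lemma small_layer (norm : (X -> R) -> \bar R) (T : \bar R) w (w0 : X -> R) (L e : R) :
  (forall h, (L2norm h <= norm h)%E) ->
  continuous_curve norm T w ->
  (forall t, time_interval T t -> L2 (w ^~ t)) ->
  (0 < T)%E -> measurable_fun [set: X] w0 ->
  {ae mu, forall x, w x 0 = w0 x} -> 0 <= L -> 0 < e ->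
  exists2 d, 0 < d & forall t, 0 <= t -> t < d -> (t%:E < T)%E ->
    (\int[mu]_(x in cube (n:=n) L) `|(w x t - w0 x)%R|%:E <= e%:E)%E.
Proof.
move=> hnorm cw L2w T0 mw0 w00 L0 e0.
have [C C0 hC] := cube_L1 L0.
have I0 : time_interval T 0 by split.
have eC : (0 < (e / C)%:E)%E by rewrite lte_fin divr_gt0.
have /= := cw 0 I0 [set y | (y < (e / C)%:E)%E] (open_ereal_lt' eC).
rewrite /within /= => -[d /= d0 hd].
exists d => // t t0 td tT.
have It : time_interval T t by split.
have /= h := hd t; rewrite sub0r normrN ger0_norm// in h.
have {}h := h td It.
have mB : measurable (cube (n:=n) L) := measurable_cube L.
have mw s : time_interval T s -> measurable_fun [set: X] (w ^~ s).
  by move=> /L2w; exact: L2_measurable.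
have -> : (\int[mu]_(x in cube (n:=n) L) `|(w x t - w0 x)%R|%:E =
  \int[mu]_(x in cube (n:=n) L) `|(w x t - w x 0)%R|%:E)%E.
  apply: ge0_ae_eq_integral => //.
  - apply/measurable_EFinP/measurableT_comp => //.
    apply: measurable_funTS; apply: measurable_funB => //; exact: mw.
  - apply/measurable_EFinP/measurableT_comp => //.
    by apply: measurable_funTS; apply: measurable_funB => //; exact: mw.
  - by apply: filterS w00 => x -> _.
apply: le_trans (hC (fun x => w x t - w x 0) _) _.
  by apply: measurable_funB; exact: mw.
have {}h := le_lt_trans (hnorm _) h.
rewrite muleC -lee_pdivlMr// -EFinM; exact: ltW.
Qed.

End initial_layer.

(** * The weak formulation on the light cone *)

Section planar.
Variables (R : realType) (n : nat).
Local Notation mu := (lebesgue_rV R n).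
Local Notation leb := (@lebesgue_measure R).
Local Notation M := (mu \x leb)%E.
Local Notation X := 'rV[R]_n.
Implicit Types (w : 'I_n -> R) (x : X) (a b : R -> R).

Definition dotp w x := \sum_(i < n) w i * x ord0 i.

Lemma enorm_sqr x : enorm x ^+ 2 = \sum_i x ord0 i ^+ 2.
Proof. by rewrite sqr_sqrtr// sumr_ge0// => i _; exact: sqr_ge0. Qed.

(** Expand the squared distance between the unit vectors [w] and [x / |x|]. As a function of [w],
    [e^(w . x)] thus becomes [e^|x|] times a Gaussian centred at [x / |x|]. *)
Lemma dotp_gap w x : \sum_i w i ^+ 2 = 1 -> enorm x != 0 ->
  dotp w x = enorm x - enorm x / 2 * \sum_i (w i - x ord0 i / enorm x) ^+ 2.
Proof.
move=> w1 x0.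
have -> : \sum_i (w i - x ord0 i / enorm x) ^+ 2 = 2 - 2 / enorm x * dotp w x.
  under eq_bigr do rewrite sqrrB.
  rewrite !big_split/= w1 sumrN.
  have -> : \sum_(i < n) (x ord0 i / enorm x) ^+ 2 = 1.
    under eq_bigr do rewrite exprMn.
    by rewrite -mulr_suml -enorm_sqr -exprMn divff// expr1n.
  rewrite /dotp mulr_sumr.
  have -> : \sum_(i < n) (w i * (x ord0 i / enorm x)) *+ 2 =
      \sum_(i < n) 2 / enorm x * (w i * x ord0 i).
    by apply: eq_bigr => i _; rewrite -mulr_natr; ring.
  by ring.
by field.
Qed.

(** A case of Cauchy-Schwarz, from [dotp_gap] applied to [w] and to [- w]; the cases [w = 0] and
    [enorm x = 0], which that formula excludes, are immediate. *)
Lemma dotp_le w x lam : \sum_i w i ^+ 2 = lam -> lam = 0 \/ lam = 1 ->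
  `|dotp w x| <= enorm x.
Proof.
move=> wl [l0|l1].
  have w0 i : w i = 0.
    move: wl; rewrite l0 => /eqP; rewrite psumr_eq0; last by move=> j _; exact: sqr_ge0.
    by move=> /allP /(_ i); rewrite mem_index_enum => /(_ isT) /=; rewrite sqrf_eq0 => /eqP.
  by rewrite /dotp big1 ?normr0 ?enorm_ge0// => i _; rewrite w0 mul0r.
rewrite l1 in wl.
have [x0|x0] := eqVneq (enorm x) 0.
  have xi i : x ord0 i = 0.
    by apply/eqP; rewrite -normr_le0 -x0; exact: coord_le_enorm.
  by rewrite /dotp big1 ?normr0 ?enorm_ge0// => i _; rewrite xi mulr0.
have e0 : 0 <= enorm x := enorm_ge0 x.
have key w' : \sum_i w' i ^+ 2 = 1 -> dotp w' x <= enorm x.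
  move=> /dotp_gap ->//; rewrite gerBl mulr_ge0 ?divr_ge0// sumr_ge0// => i _.
  exact: sqr_ge0.
rewrite ler_norml key// andbT lerNl.
have -> : - dotp w x = dotp (fun i => - w i) x.
  by rewrite /dotp -sumrN; apply: eq_bigr => i _; rewrite mulNr.
by apply: key; rewrite -wl; apply: eq_bigr => i _; rewrite sqrrN.
Qed.

Definition planes w L (i : 'I_n) := plane (w i) L.

Lemma tens_planes a w (L : R) (z : X * R) : 0 < L -> (forall i, `|z.1 ord0 i| <= L) ->
  tens a (planes w L) z = a z.2 * expR (dotp w z.1).
Proof.
move=> L0 zL; rewrite /tens; congr (_ * _); rewrite /dotp expR_sum.
by apply: eq_bigr => i _; rewrite /planes planeE.
Qed.

Lemma box_planes a w (L : R) (z : X * R) : smooth1 a -> 0 < L ->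
  (forall i, `|z.1 ord0 i| < L) ->
  box (tens a (planes w L)) z =
  (derive1 (derive1 a) z.2 - (\sum_i w i ^+ 2) * a z.2) * expR (dotp w z.1).
Proof.
move=> sa L0 zL; have zL' i : `|z.1 ord0 i| <= L by exact/ltW.
rewrite box_tens//; last by move=> i; exact: smooth1_plane.
rewrite tens_planes// mulrBl; congr (_ - _).
rewrite !mulr_suml; apply: eq_bigr => i _; rewrite /tens -mulrA.
rewrite mulrCA; congr (_ * _).
rewrite (bigD1 i)//= eqxx plane_D2// -mulrA; congr (_ * _).
rewrite /dotp expR_sum [in RHS](bigD1 i)//=; congr (_ * _).
by apply: eq_bigr => j /negbTE ->; rewrite /planes planeE.
Qed.

Lemma measurable_dotp w : measurable_fun [set: X] (dotp w).
Proof.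
apply: measurable_sum => i; apply: measurable_funM => //; exact: measurable_coord.
Qed.

Lemma measurable_tens a (h : 'I_n -> R -> R) : smooth1 a -> (forall i, smooth1 (h i)) ->
  measurable_fun [set: X * measurableTypeR R] (tens a h).
Proof.
move=> sa sh; apply: measurable_funM.
  apply: (measurableT_comp (continuous_measurable_fun (smooth1_continuous sa))).
  exact: measurable_snd.
apply: measurable_prod => i _.
apply: (measurableT_comp (continuous_measurable_fun (smooth1_continuous (sh i)))).
apply: (@measurableT_comp _ _ _ _ _ _ (fun x : X => x ord0 i)).
  exact: measurable_coord.
exact: measurable_fst.
Qed.

Lemma smooth1_if (g h : R -> R) (b : bool) : smooth1 g -> smooth1 h ->
  smooth1 (if b then g else h).
Proof. by case: b. Qed.

Lemma measurable_box_tens a (h : 'I_n -> R -> R) : smooth1 a -> (forall i, smooth1 (h i)) ->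
  measurable_fun [set: X * measurableTypeR R] (box (tens a h)).
Proof.
move=> sa sh.
rewrite (_ : box _ = fun z => tens (derive1 (derive1 a)) h z -
  \sum_(i < n) tens a (fun j => if j == i then derive1 (derive1 (h j)) else h j) z).
  apply: measurable_funB.
    by apply: measurable_tens => //; do 2 apply: smooth1_derive.
  apply: measurable_sum => i; apply: measurable_tens => // j.
  by apply: smooth1_if => //; do 2 apply: smooth1_derive.
by apply/funext => z; rewrite box_tens.
Qed.

Lemma integrable_bounded_mul d' (T' : measurableType d')
  (nu : {measure set T' -> \bar R}) (D : set T') (g h : T' -> R) (c : R) :
  measurable D -> nu.-integrable D (EFin \o g) -> measurable_fun D h ->
  (forall y, D y -> `|h y| <= c) ->
  nu.-integrable D (EFin \o (fun y => g y * h y)).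
Proof.
move=> mD ig mh hc.
rewrite (_ : EFin \o _ = (EFin \o g) \* (EFin \o h))%E; last by apply/funext => y.
apply: integrableMl => //; exists c; split; first exact: num_real.
move=> c1 cc1 y Dy; exact: le_trans (hc y Dy) (ltW cc1).
Qed.

End planar.

Section localization.
Variables (R : realType) (n : nat) (r : R) (T : \bar R).
Local Notation mu := (lebesgue_rV R n).
Local Notation leb := (@lebesgue_measure R).
Local Notation M := (mu \x leb)%E.
Local Notation X := 'rV[R]_n.
Implicit Types (w : X -> R -> R).

(* The part of the truncated light cone used for a test function supported in
   [d / 2 <= t <= tau]; the cutoff planes equal plane waves on it. *)
Definition dom (tau d : R) := slab (n:=n) (2 * (tau + r + 1)) (d / 2) tau `&` cone r.

Lemma measurable_dom tau d : measurable (dom tau d : set (X * measurableTypeR R)).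
Proof. by apply: measurableI; [exact: measurable_slab|exact: measurable_cone]. Qed.

Lemma dom_time tau d z : dom tau d z -> d / 2 <= z.2 <= tau.
Proof. by move=> [[_ /=]]; rewrite in_itv. Qed.

Lemma dom_enorm tau d z : dom tau d z -> enorm z.1 <= tau + r.
Proof.
by move=> Dz; have /andP[_ zt] := dom_time Dz; case: Dz => _ /le_trans; apply; rewrite lerD2r.
Qed.

Lemma dom_coord tau d z i : dom tau d z -> `|z.1 ord0 i| < tau + r + 1.
Proof.
move=> /dom_enorm zr; apply: le_lt_trans (coord_le_enorm _ _) _.
by apply: le_lt_trans zr _; rewrite ltrDl.
Qed.

(** Outside the slab [psi] vanishes, and outside the cone [w] vanishes almost everywhere by
    [ae_cone]. The measurability this needs comes from integrability on the compact slab. *)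
Lemma Rintegral_dom w (psi : X * R -> R) tau d :
  locally_integrable_st (spacetime T) (fun z : X * R => w z.1 z.2) ->
  (forall t, time_interval T t -> {ae mu, forall x, t + r < enorm x -> w x t = 0}) ->
  0 < d -> (tau%:E < T)%E ->
  measurable_fun [set: X * measurableTypeR R] psi ->
  (forall z, psi z != 0 -> slab (2 * (tau + r + 1)) (d / 2) tau z) ->
  \int[M]_(z in spacetime T) (w z.1 z.2 * psi z) =
  \int[M]_(z in dom tau d) (w z.1 z.2 * psi z).
Proof.
move=> wT wcone d0 tauT mpsi hpsi; set K := slab _ _ _ in hpsi *.
have mK : measurable (K : set (X * measurableTypeR R)) := measurable_slab _ _ _.
have KT : K `<=` spacetime T by apply: slab_spacetime => //; rewrite divr_gt0.
have iK := wT K KT (@compact_slab _ _ _ _ _).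
have mw : measurable_fun (K : set (X * measurableTypeR R)) (fun z => w z.1 z.2).
  by apply/measurable_EFinP; exact: measurable_int iK.
have mF : measurable_fun (K : set (X * measurableTypeR R)) (fun z => w z.1 z.2 * psi z).
  by apply: measurable_funM => //; exact: measurable_funTS.
transitivity (\int[M]_(z in K) (w z.1 z.2 * psi z)).
  rewrite Rintegral_mkcond [RHS]Rintegral_mkcond; apply: eq_Rintegral => z _.
  rewrite !patchE; case: ifPn => zT; case: ifPn => // zK.
    by have [->|/hpsi h] := eqVneq (psi z) 0; [rewrite mulr0|move: zK; rewrite notin_setE].
  by exfalso; move: zT; rewrite notin_setE; apply; apply: KT; rewrite inE in zK.
rewrite /dom -/K [RHS]Rintegral_mkcondr /Rintegral; congr fine.
have mC := @measurable_cone R n r.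
apply: (@ae_eq_integral _ (X * measurableTypeR R)%type R M K
  (EFin \o ((fun z => w z.1 z.2 * psi z) \_ (cone r)))) => //.
- by apply/measurable_EFinP.
- apply/measurable_EFinP/(measurable_restrict _ mC mK); rewrite setIC in mF *.
  by apply: measurable_funS mF => // z [].
- have := @ae_cone R n w K r (time_interval T) mK mw _ wcone.
  have KI : K `<=` [set z | time_interval T z.2].
    by move=> z /KT [z0 zT]; split => //; exact: ltW.
  move=> /(_ KI); apply: filterS => z h Kz; rewrite /= patchE.
  case: ifPn => // zC; rewrite h ?mul0r//.
  by move=> Cz; move: zC; rewrite notin_setE.
Qed.

Lemma integrable_dom w tau d :
  locally_integrable_st (spacetime T) (fun z : X * R => w z.1 z.2) -> 0 < d -> (tau%:E < T)%E ->
  M.-integrable (dom tau d) (EFin \o (fun z => w z.1 z.2)).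
Proof.
move=> wT d0 tauT; have iK := wT (slab (2 * (tau + r + 1)) (d / 2) tau) _ _.
apply: integrableS (iK _ _).
- exact: measurable_slab.
- exact: measurable_dom.
- by move=> z [].
- by apply: slab_spacetime => //; rewrite divr_gt0.
- exact: compact_slab.
Qed.

End localization.

Section supports.
Variables (R : realType) (n : nat).
Implicit Types (a b s : R -> R) (h : 'I_n -> R -> R).

Lemma derive1_supp a (t0 t1 : R) : (forall t, a t != 0 -> t0 <= t <= t1) ->
  forall t, derive1 a t != 0 -> t0 <= t <= t1.
Proof.
move=> ha; apply: (@derive1_cst_outside _ a 0 0) => t ht; apply/eqP/negPn/negP => /ha.
- by rewrite leNgt ht.
- by rewrite [X in _ && X]leNgt ht andbF.
Qed.

Lemma tens_slab a h (t0 t1 L : R) z :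
  (forall t, a t != 0 -> t0 <= t <= t1) ->
  (forall i y, h i y != 0 -> - L <= y <= L) ->
  tens a h z != 0 -> slab L t0 t1 z.
Proof.
move=> ha hh; rewrite /tens mulf_eq0 negb_or => /andP[/ha az hz]; split => /=.
  move=> i; rewrite /= in_itv/=; apply: (hh i); apply: contraNN hz => /eqP hz.
  by rewrite (bigD1 i)//= hz mul0r.
by rewrite in_itv.
Qed.

Lemma box_tens_slab a h (t0 t1 L : R) z :
  smooth1 a -> (forall i, smooth1 (h i)) ->
  (forall t, a t != 0 -> t0 <= t <= t1) ->
  (forall i y, h i y != 0 -> - L <= y <= L) ->
  box (tens a h) z != 0 -> slab L t0 t1 z.
Proof.
move=> sa sh ha hh; rewrite box_tens// => hz; apply: contrapT => nz.
move/eqP: hz; apply; rewrite big1 ?subr0.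
  apply/eqP/negPn/negP => /tens_slab h'; apply: nz; apply: h' => //.
  by do 2 apply: derive1_supp.
move=> i _; apply/eqP/negPn/negP => /tens_slab h'; apply: nz; apply: h' => // j y.
by case: ifP => _; [move: y; do 2 apply: derive1_supp; exact: hh|exact: hh].
Qed.

(** The second derivative of [s] is kept inside the total derivative of [a s']: paired with [u],
    that term turns into one with [v] and no derivative of [s']. *)
Lemma derive2_damped a s t : smooth1 a -> smooth1 s ->
  derive1 (derive1 (a \* (cst 1 \+ (cst (-1) \* s)))) t =
  derive1 (derive1 a) t * (1 - s t) - derive1 a t * derive1 s t
  - derive1 (a \* derive1 s) t.
Proof.
move=> sa ss; have ss' := smooth1_derive ss; have sa' := smooth1_derive sa.
have sc (c : R) := @smooth1_cst R c.
have sN : smooth1 (cst (-1) \* s) by apply: smooth1M.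
have sq : smooth1 (cst 1 \+ (cst (-1) \* s)) by apply: smooth1D.
have dq : derive1 (cst 1 \+ (cst (-1) \* s)) = cst (-1) \* derive1 s.
  rewrite derive1_add// derive1_mul//; apply/funext => y /=.
  by rewrite !derive1_cst mul0r !add0r.
rewrite derive1_mul// dq derive1_add; [|exact: smooth1M|by apply: smooth1M => //; apply: smooth1M].
rewrite !derive1_mul//; last by apply: smooth1M.
by rewrite dq /= !derive1_cst; ring.
Qed.

(** The term [lam^2 b] cancels against the Laplacian of [e^(w . x)] when [|w|^2 = lam^2], which
    leaves only derivatives of the cutoff. *)
Lemma derive2_exp_mul (lam : R) b t : smooth1 b ->
  derive1 (fun y : R => expR (- lam * y) * b y) t = expR (- lam * t) * (derive1 b t - lam * b t) /\
  derive1 (derive1 (fun y : R => expR (- lam * y) * b y)) t =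
  expR (- lam * t) * (derive1 (derive1 b) t - 2 * lam * derive1 b t + lam ^+ 2 * b t).
Proof.
move=> sb; pose E (y : R) := expR (- lam * y).
have sE : smooth1 E by exact: smooth1_expR.
have sb' := smooth1_derive sb; have sE' := smooth1_derive sE.
have dE : derive1 E = fun y => - lam * E y by exact: derive1_expR_scale.
have -> : (fun y : R => expR (- lam * y) * b y) = E \* b by [].
have dEE : derive1 (fun y => - lam * E y) = fun y => - lam * (- lam * E y).
  have -> : (fun y => - lam * E y) = cst (- lam) \* E by [].
  rewrite derive1_mul//; last exact: smooth1_cst.
  by apply/funext => y /=; rewrite derive1_cst mul0r add0r dE.
have d1 : derive1 (E \* b) = (derive1 E \* b) \+ (E \* derive1 b) by exact: derive1_mul.
split; first by rewrite d1 dE /= /E; ring.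
rewrite d1 derive1_add; [|exact: smooth1M|exact: smooth1M].
rewrite !derive1_mul// dE dEE /= /E; ring.
Qed.

End supports.

(** * The initial layer and the contribution of the data *)

Section layer_bound.
Variables (R : realType) (n : nat) (r : R).
Local Notation mu := (lebesgue_rV R n).
Local Notation leb := (@lebesgue_measure R).
Local Notation M := (mu \x leb)%E.
Local Notation X := 'rV[R]_n.

Lemma fine_le_real (x : \bar R) (y : R) : (0 <= x)%E -> (x <= y%:E)%E -> fine x <= y.
Proof.
move=> x0 xy; rewrite -lee_fin fineK// ge0_fin_numE//.
by apply: le_lt_trans xy _; rewrite ltry.
Qed.

(** The layer has thickness [d / 2], which compensates for a weight [G] of size [1 / d] such as
    [S_d']; what remains is the smallness [e1] of [w] at each time. *)
Lemma layer_bound (w : X -> R -> R) (G : X * R -> R) (tau d c e1 : R) :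
  0 < d -> d <= tau -> 0 <= c ->
  measurable_fun (slab (2 * (tau + r + 1)) (d / 2) tau : set (X * measurableTypeR R))
    (fun z => w z.1 z.2) ->
  M.-integrable (dom r tau d) (EFin \o (fun z => w z.1 z.2 * G z)) ->
  (forall t, 0 <= t -> t <= d ->
     (\int[mu]_(x in cube (2 * (tau + r + 1))) `|w x t|%:E <= e1%:E)%E) ->
  (forall z, dom r tau d z -> `|G z| <= c) -> (forall z, G z != 0 -> z.2 <= d) ->
  `|\int[M]_(z in dom r tau d) (w z.1 z.2 * G z)| <= c * (e1 * (d / 2)).
Proof.
move=> d0 dtau c0 mw iwG he hG hGd.
have mD : measurable (dom r tau d : set (X * measurableTypeR R)) by exact: measurable_dom.
apply: le_trans (le_normr_Rintegral mD iwG) _.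
set B := cube (n:=n) _ in he; pose I := `[d / 2, d]%classic : set R.
have mB : measurable B by exact: measurable_cube.
have mI : measurable (I : set (measurableTypeR R)) by exact: measurable_itv.
have mBI : measurable (B `*` I : set (X * measurableTypeR R)) by exact: measurableX.
have mwBI : measurable_fun (B `*` I : set (X * measurableTypeR R))
    (fun z => (`|w z.1 z.2|%:E)).
  apply/measurable_EFinP/measurableT_comp => //.
  apply: measurable_funS mw; first exact: measurable_slab.
  move=> z [Bz]; rewrite /I /= in_itv/= => /andP[z1 z2]; split => //=.
  by rewrite in_itv/= z1 (le_trans z2).
apply: fine_le_real; first exact: integral_ge0.
apply: (@le_trans _ _ (\int[M]_(z in B `*` I) (c%:E * `|w z.1 z.2|%:E))%E).
  rewrite integral_mkcond [leRHS]integral_mkcond; apply: ge0_le_integral => //.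
  - by move=> z _; apply: erestrict_ge0 => y _; rewrite lee_fin.
  - apply/(measurable_restrictT _ mD)/measurable_EFinP/measurableT_comp => //.
    by apply/measurable_EFinP; exact: measurable_int iwG.
  - apply/(measurable_restrictT _ mBI); apply: emeasurable_funM => //.
  - move=> z _; rewrite !patchE; case: ifPn => zD; last first.
      by case: ifP => // _; rewrite mule_ge0// lee_fin.
    rewrite inE in zD; have [G0|G0] := eqVneq (G z) 0.
      by rewrite G0 mulr0 normr0; case: ifP => // _; rewrite mule_ge0// lee_fin.
    rewrite mem_set.
      by rewrite -EFinM lee_fin normrM mulrC ler_wpM2r// hG.
    have := zD => -[[zB _] _]; split => //; rewrite /I /= in_itv/= hGd// andbT.
    by have /andP[] := dom_time zD.
rewrite ge0_integralZl//.
rewrite EFinM; apply: lee_wpmul2l; first by rewrite lee_fin.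
apply: le_trans (ge0_tonelli_le (F := fun x t => `|w x t|%:E) (c := e1%:E) _ _ _ _ _) _ => //.
  move=> t; rewrite /I /= in_itv/= => /andP[t1 t2]; apply: he => //.
  by apply: le_trans t1; rewrite divr_ge0// ltW.
(* That [e1] is nonnegative follows from the bound [he] at time 0. *)
rewrite EFinM; apply: lee_wpmul2l.
  by rewrite -(@fineK _ e1%:E)//; apply: le_trans (he 0 _ _) => //; [exact: integral_ge0|exact: ltW].
apply: le_of_eq; apply: etrans (lebesgue_measure_itv _) _; rewrite /= lte_fin ifT; last lra.
by rewrite -EFinB; congr EFin; lra.
Qed.

End layer_bound.

Section initial_data.
Variables (R : realType) (n : nat) (r : R).
Local Notation mu := (lebesgue_rV R n).
Local Notation leb := (@lebesgue_measure R).
Local Notation M := (mu \x leb)%E.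
Local Notation X := 'rV[R]_n.
Local Notation S := (@smooth_step R).

Definition eball := [set x : X | enorm x <= r].

Lemma measurable_eball : measurable eball.
Proof.
rewrite (_ : eball = (fun x : X => enorm x : measurableTypeR R) @^-1` `]-oo, r]).
  by rewrite -[X in measurable X]setTI; apply: measurable_enorm => //; exact: measurable_itv.
by apply/seteqP; split => z /=; rewrite in_itv.
Qed.

Lemma derive1_step_scale (d t : R) :
  derive1 (fun y => S (d^-1 * y)) t = d^-1 * derive1 S (d^-1 * t).
Proof. by rewrite derive1_scale//; exact: smooth1_step. Qed.

(** The cutoff falls from 1 at [d / 2] to 0 at [d], so the negative of its derivative is a
    probability density on the layer. *)
Lemma integral_step (d : R) : 0 < d ->
  (\int[leb]_(t in `[(d / 2)%R, d]) (- derive1 (fun y => S (d^-1 * y)) t)%:E = 1)%E.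
Proof.
move=> d0; pose s (y : R) := S (d^-1 * y).
have ss : smooth1 s by apply: smooth1_scale; exact: smooth1_step.
pose G := (cst (-1) \* s).
have sG : smooth1 G by apply: smooth1M => //; exact: smooth1_cst.
have dG t : derive1 G t = - derive1 s t.
  rewrite derive1_mul//=; last exact: smooth1_cst.
  by rewrite derive1_cst mul0r add0r mulN1r.
rewrite (@continuous_FTC2 _ _ G).
- have s1 : s d = 0 by rewrite /s mulVf ?gt_eqF// smooth_step0.
  have s2 : s (d / 2) = 1 by rewrite /s mulrA mulVf ?gt_eqF// mul1r smooth_step1.
  by rewrite -EFinB /G /= s1 s2; congr EFin; ring.
- lra.
- have -> : (fun t => - derive1 (fun y => S (d^-1 * y)) t) = derive1 G.
    by apply/funext => t; rewrite dG.
  by apply: continuous_subspaceT; apply: smooth1_continuous; exact: smooth1_derive.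
- have cG := smooth1_continuous sG.
  split; [by move=> x _; exact: smooth1_derivable|
    exact/cvg_at_right_filter/cG|exact/cvg_at_left_filter/cG].
- by move=> x _; rewrite dG.
Qed.

(** The integrand is nonnegative, so the domain may be shrunk to the ball times [[d / 2, d]]. There
    [w . x >= - r] and [t <= 1] bound the wave below by [e^(- r - 1)], and the time integral is 1 by
    [integral_step]. *)
Lemma initial_lower (f : X -> R) (w : 'I_n -> R) (tau d : R) :
  0 < r -> 0 < d -> d <= 1 -> d <= tau ->
  measurable_fun [set: X] f ->
  (\int[mu]_(x in eball) `|f x|%:E < +oo)%E ->
  (forall x : X, `|dotp w x| <= enorm x) ->
  M.-integrable (dom r tau d) (EFin \o (fun z => `|f z.1| *
    (expR (dotp w z.1 - z.2) * - derive1 (fun y => S (d^-1 * y)) z.2))) ->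
  expR (- r - 1) * \int[mu]_(x in eball) `|f x| <=
  \int[M]_(z in dom r tau d) (`|f z.1| *
    (expR (dotp w z.1 - z.2) * - derive1 (fun y => S (d^-1 * y)) z.2)).
Proof.
move=> r0 d0 d1 dtau mf f1 wx iG.
set s' := derive1 (fun y => S (d^-1 * y)) in iG *.
have s'0 t : 0 <= - s' t.
  rewrite /s' derive1_step_scale oppr_ge0 mulr_ge0_le0 ?invr_ge0 ?(ltW d0)//.
  exact: derive1_step_le0.
have cs' : continuous s'.
  apply: smooth1_continuous; apply: smooth1_derive; apply: smooth1_scale.
  exact: smooth1_step.
pose I := `[d / 2, d]%classic : set R.
have mB := measurable_eball.
have mI : measurable (I : set (measurableTypeR R)) by exact: measurable_itv.
have mBI : measurable (eball `*` I : set (X * measurableTypeR R)) by exact: measurableX.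
have mD : measurable (dom r tau d : set (X * measurableTypeR R)) by exact: measurable_dom.
have BID : eball `*` I `<=` dom r tau d.
  move=> z [/= zB]; rewrite /I /= in_itv/= => /andP[z1 z2].
  have zz : 0 <= z.2 by apply: le_trans z1; rewrite divr_ge0// ltW.
  split; first split => /=.
  - move=> i; rewrite /= in_itv/= -ler_norml; apply: le_trans (coord_le_enorm _ _) _.
    by apply: le_trans zB _; lra.
  - by rewrite in_itv/= z1 (le_trans z2).
  - by rewrite /cone/=; apply: le_trans zB _; lra.
have ms : measurable_fun (I : set (measurableTypeR R)) (fun t => (- s' t)%:E).
  apply/measurable_EFinP; apply: measurable_funTS; apply: measurableT_comp => //.
  exact: continuous_measurable_fun.
have mf' : measurable_fun eball (fun x => (expR (- r - 1) * `|f x|)%:E).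
  apply/measurable_EFinP; apply: measurable_funTS; apply: measurable_funM => //.
  exact: measurableT_comp.
have key : ((expR (- r - 1))%:E * \int[mu]_(x in eball) `|f x|%:E <=
  \int[M]_(z in dom r tau d) (`|f z.1| * (expR (dotp w z.1 - z.2) * - s' z.2))%:E)%E.
  rewrite -ge0_integralZl//; last first.
    by apply/measurable_EFinP; apply: measurable_funTS; exact: measurableT_comp.
  have -> : (\int[mu]_(x in eball) ((expR (- r - 1))%:E * `|f x|%:E) =
     \int[M]_(z in eball `*` I) ((expR (- r - 1) * `|f z.1|)%:E * (- s' z.2)%:E))%E.
    rewrite (@ge0_tonelli_prod _ _ (fun x => (expR (- r - 1) * `|f x|)%:E) (fun t => (- s' t)%:E))//.
    by rewrite [X in (_ * X)%E]integral_step// mule1.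
  have mG := measurable_int _ iG.
  apply: (@le_trans _ _ (\int[M]_(z in eball `*` I) (`|f z.1| * (expR (dotp w z.1 - z.2) * - s' z.2))%:E)%E).
    apply: ge0_le_integral => //.
    - by move=> z _; rewrite -EFinM lee_fin !mulr_ge0 ?expR_ge0.
    - apply: emeasurable_funM.
        apply/measurable_EFinP; apply: measurable_funTS; apply: measurable_funM => //.
        apply: measurableT_comp => //; apply: measurableT_comp => //; exact: measurable_fst.
      apply/measurable_EFinP; apply: measurable_funTS; apply: measurableT_comp => //.
      apply: (measurableT_comp (continuous_measurable_fun cs')); exact: measurable_snd.
    - by apply: measurable_funS mG.
    - move=> z [/= zB]; rewrite /I /= in_itv/= => /andP[z1 z2].
      rewrite -EFinM lee_fin -mulrA mulrCA ler_wpM2l// ler_wpM2r// ler_expR.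
      have := wx z.1; rewrite ler_norml => /andP[h _]; have : enorm z.1 <= r by [].
      by lra.
  apply: ge0_subset_integral => //.
  by move=> z _; rewrite lee_fin !mulr_ge0 ?expR_ge0.
rewrite /Rintegral -[expR _]/(fine (expR _)%:E) -fineM//; last first.
  by rewrite ge0_fin_numE//; exact: integral_ge0.
apply: fine_le => //.
  by rewrite fin_numM// ge0_fin_numE//; exact: integral_ge0.
exact: (integrable_fin_num mD iG).
Qed.

End initial_data.

Lemma continuous_bounded (R : realType) (g : R -> R) (a b : R) : a <= b -> continuous g ->
  exists2 C, 0 <= C & forall s, a <= s <= b -> `|g s| <= C.
Proof.
move=> ab cg; have [|c _ hc] := @EVT_max R (fun s => `|g s|) a b ab.
  apply: continuous_subspaceT => x; apply: continuous_comp; last exact: norm_continuous.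
  exact: cg.
by exists `|g c| => // s sab; apply: hc; rewrite in_itv.
Qed.

(** * The integral identity for damped plane waves *)

Section identity.
Variables (R : realType) (n : nat) (r : R).
Local Notation mu := (lebesgue_rV R n).
Local Notation leb := (@lebesgue_measure R).
Local Notation M := (mu \x leb)%E.
Local Notation X := 'rV[R]_n.
Local Notation S := (@smooth_step R).

Implicit Types (w : 'I_n -> R) (lam : R) (z : X * R).

(** A solution of the free wave equation when [|w|^2 = lam^2]: the constant 1 for [lam = 0], a plane
    wave for [lam = 1]. *)
Definition wave (w : 'I_n -> R) (lam : R) (z : X * R) := expR (dotp w z.1 - lam * z.2).

Lemma wave_ge0 w lam z : 0 <= wave w lam z. Proof. exact: expR_ge0. Qed.

Lemma measurable_time (g : R -> R) : continuous g ->
  measurable_fun [set: X * measurableTypeR R] (fun z => g z.2).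
Proof.
move=> cg; apply: (measurableT_comp (continuous_measurable_fun cg)).
exact: measurable_snd.
Qed.

Lemma measurable_space (g : X -> R) : measurable_fun [set: X] g ->
  measurable_fun [set: X * measurableTypeR R] (fun z => g z.1).
Proof. by move=> mg; apply: (measurableT_comp mg); exact: measurable_fst. Qed.

Lemma measurable_wave w lam : measurable_fun [set: X * measurableTypeR R] (wave w lam).
Proof.
apply: (measurableT_comp (@measurable_expR R)); apply: measurable_funB.
  by apply: measurable_space; exact: measurable_dotp.
apply: measurable_funM => //; exact: measurable_snd.
Qed.

Lemma integrable_dom_mul (g : X -> R -> R) (G : X * R -> R) tau d c :
  M.-integrable (dom r tau d) (EFin \o (fun z => g z.1 z.2)) ->
  measurable_fun [set: X * measurableTypeR R] G ->
  (forall z, dom r tau d z -> `|G z| <= c) ->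
  M.-integrable (dom r tau d) (EFin \o (fun z => g z.1 z.2 * G z)).
Proof.
move=> iw mG Gc.
apply: (@integrable_bounded_mul R _ (X * measurableTypeR R)%type M _ _ _ c) => //.
  exact: measurable_dom.
exact: measurable_funTS.
Qed.

Lemma dotp_dom w lam tau d z : \sum_i w i ^+ 2 = lam -> lam = 0 \/ lam = 1 ->
  dom r tau d z -> `|dotp w z.1| <= tau + r.
Proof.
by move=> wl l01 /dom_enorm; apply: le_trans; exact: dotp_le wl l01.
Qed.

Lemma wave_le w lam tau d z : \sum_i w i ^+ 2 = lam -> lam = 0 \/ lam = 1 -> 0 < d ->
  dom r tau d z -> `|wave w lam z| <= expR (tau + r).
Proof.
move=> wl l01 d0 Dz; rewrite ger0_norm ?wave_ge0// ler_expR.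
have := dotp_dom wl l01 Dz; rewrite ler_norml => /andP[_ h].
apply: le_trans h; rewrite gerBl mulr_ge0//.
  by case: l01 => ->.
by have /andP[z0 _] := dom_time Dz; apply: le_trans z0; rewrite divr_ge0// ltW.
Qed.

(* The test functions are [a (1 - S_d)] for the wave equation and [a S_d'] for
   [u_t = v], each times [planes w L], with [a t = e^(- lam t) B t]. The cases
   [lam = 0], [w = 0] and [lam = 1], [|w| = 1] are treated at once: both satisfy
   [lam ^ 2 = lam = |w| ^ 2]. *)
Lemma wave_identity (p eps : R) (f : X -> R) (T : \bar R) (u v : X -> R -> R)
    (tau d lam : R) (w : 'I_n -> R) (B : R -> R) :
  let s' := derive1 (fun y => S (d^-1 * y)) in
  0 < r -> 0 < p ->
  is_solution p f (cst 0) eps T u v -> supported_in_cone r T u v ->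
  1 <= tau -> (tau%:E < T)%E ->
  smooth1 B -> (forall t, t <= tau / 2 -> B t = 1) -> (forall t, tau <= t -> B t = 0) ->
  0 < d -> d < tau / 2 -> lam = 0 \/ lam = 1 -> \sum_i w i ^+ 2 = lam ->
  \int[M]_(z in dom r tau d) (`|u z.1 z.2| `^ p *
      (B z.2 * (1 - S (d^-1 * z.2)) * wave w lam z)) =
  \int[M]_(z in dom r tau d) (u z.1 z.2 * (wave w lam z *
      (derive1 (derive1 B) z.2 - 2 * lam * derive1 B z.2))) +
  \int[M]_(z in dom r tau d) (v z.1 z.2 * (wave w lam z * s' z.2)) +
  lam * \int[M]_(z in dom r tau d) (u z.1 z.2 * (wave w lam z * s' z.2)).
Proof.
move=> s' r0 p0 sol sc tau1 tauT sB B1 B0 d0 dtau l01 wl.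
have tau0 : 0 < tau by apply: lt_le_trans tau1.
set L := tau + r + 1; have L0 : 0 < L by rewrite /L; lra.
pose s (y : R) := S (d^-1 * y); have ss : smooth1 s.
  by apply: smooth1_scale; exact: smooth1_step.
have ss' : smooth1 s' by exact: smooth1_derive.
pose a (y : R) := expR (- lam * y) * B y.
have sa : smooth1 a by apply: smooth1M => //; exact: smooth1_expR.
have lam2 : lam ^+ 2 = lam by case: l01 => ->; rewrite ?expr0n ?expr1n.
pose a1 := a \* (cst 1 \+ (cst (-1) \* s)).
pose b := a \* s'.
have sa1 : smooth1 a1.
  by apply: smooth1M => //; apply: smooth1D; [|apply: smooth1M => //]; exact: smooth1_cst.
have sb : smooth1 b by exact: smooth1M.
pose h := planes w L.
have sh i : smooth1 (h i) by exact: smooth1_plane.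
have hsupp i y : h i y != 0 -> - (2 * L) <= y <= 2 * L by exact: plane_supp.
have dV t : (d^-1 * t <= 1) = (t <= d) by rewrite mulrC ler_pdivrMr// mul1r.
have dV2 t : (2^-1 <= d^-1 * t) = (d / 2 <= t).
  by rewrite [d^-1 * t]mulrC ler_pdivlMr// mulrC.
have s'E t : s' t = d^-1 * derive1 S (d^-1 * t) by exact: derive1_step_scale.
have s'supp t : s' t != 0 -> d / 2 <= t <= d.
  by rewrite s'E mulf_eq0 negb_or => /andP[_ /derive1_step_supp]; rewrite dV dV2.
have a_tau t : a t != 0 -> t <= tau.
  by move=> at0; rewrite leNgt; apply/negP => /ltW/B0 Bt; move/eqP: at0; apply; rewrite /a Bt mulr0.
have a1supp t : a1 t != 0 -> d / 2 <= t <= tau.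
  rewrite /a1 mulf_eq0 negb_or => /andP[/a_tau -> st]; rewrite andbT leNgt.
  apply/negP => td; move/eqP: st; apply.
  by rewrite /= /s smooth_step1; [ring|rewrite ltW// ltNge dV2 -ltNge].
have bsupp t : b t != 0 -> d / 2 <= t <= tau.
  by rewrite /b mulf_eq0 negb_or => /andP[/a_tau -> /s'supp /andP[-> _]].
have d20 : 0 < d / 2 by rewrite divr_gt0.
have [_ [uL vL weakv] [_ upL weaku] _ _] := sol.
have tphi1 : test_function (@spacetime R n T) (tens a1 h).
  exact: test_tens a1supp hsupp.
have tphi2 : test_function (@spacetime R n T) (tens b h).
  exact: test_tens bsupp hsupp.
have ucone t : time_interval T t -> {ae mu, forall x, t + r < enorm x -> u x t = 0}.
  by move=> /sc; apply: filterS => x hx /hx[].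
have vcone t : time_interval T t -> {ae mu, forall x, t + r < enorm x -> v x t = 0}.
  by move=> /sc; apply: filterS => x hx /hx[].
have upcone t : time_interval T t ->
    {ae mu, forall x, t + r < enorm x -> `|u x t| `^ p = 0}.
  by move=> /ucone; apply: filterS => x hx /hx ->; rewrite normr0 powR0// gt_eqF.
have D i z : dom r tau d z -> `|z.1 ord0 i| < L by exact: dom_coord.
have D' i z : dom r tau d z -> `|z.1 ord0 i| <= L by move=> /D => /(_ i)/ltW.
have Ewave z : wave w lam z = expR (- lam * z.2) * expR (dotp w z.1).
  by rewrite /wave addrC expRD mulNr.
have E1 := weaku _ tphi1.
rewrite (Rintegral_dom uL ucone d0 tauT (measurable_box_tens sa1 sh)) in E1; last first.
  by move=> z; exact: box_tens_slab.
rewrite (@Rintegral_dom _ _ r T (fun x t => `|u x t| `^ p) _ _ _ upL upcone d0 tauT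
  (measurable_tens sa1 sh)) in E1; last first.
  by move=> z; exact: tens_slab.
have E2 := weakv _ tphi2.
rewrite dt_tens// in E2.
rewrite (Rintegral_dom uL ucone d0 tauT (measurable_tens (smooth1_derive sb) sh)) in E2; last first.
  by move=> z; apply: tens_slab => //; exact: derive1_supp.
rewrite (Rintegral_dom vL vcone d0 tauT (measurable_tens sb sh)) in E2; last first.
  by move=> z; exact: tens_slab.
pose P1 z := wave w lam z * (derive1 (derive1 B) z.2 - 2 * lam * derive1 B z.2).
pose P2 z := derive1 b z.2 * expR (dotp w z.1).
pose P4 z := wave w lam z * s' z.2.
have B'0 t : t < tau / 2 -> derive1 B t = 0.
  apply: (@derive1_locally_cst _ B 1 [set x | x < tau / 2] (@open_lt _ _)) => y /= yt.
  by rewrite B1// ltW.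
have B''0 t : t < tau / 2 -> derive1 (derive1 B) t = 0.
  by apply: (@derive1_locally_cst _ _ 0 [set x | x < tau / 2] (@open_lt _ _)) => y /= /B'0.
have s0 t : tau / 2 <= t -> s t = 0.
  by move=> tt; rewrite /s smooth_step0// mulrC ler_pdivlMr// mul1r ltW// (lt_le_trans dtau).
have s'0 t : tau / 2 <= t -> s' t = 0.
  move=> tt; apply/eqP/negPn/negP => /s'supp /andP[_ td].
  by have := le_lt_trans (le_trans tt td) dtau; rewrite ltxx.
have boxE z : dom r tau d z -> box (tens a1 h) z = P1 z - P2 z + lam * P4 z.
  move=> Dz; rewrite box_planes//; last by move=> i; exact: D.
  rewrite wl derive2_damped// /P1 /P2 /P4 Ewave.
  have [-> ->] := derive2_exp_mul lam z.2 sB.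
  rewrite -/s' -/b /a1 /= /a lam2.
  (* The two cutoffs do not interact: [B] is constant before [tau / 2], and [s] and [s'] vanish
     after it because [d < tau / 2]. *)
  have [zt|zt] := ltP z.2 (tau / 2).
    by rewrite B'0// B''0// B1 ?ltW//; ring.
  by rewrite s0// s'0//; ring.
have P4E z : dom r tau d z -> tens b h z = P4 z.
  move=> Dz; rewrite tens_planes//; last by move=> i; exact: D'.
  rewrite /P4 Ewave /b /= /a.
  have [zt|zt] := ltP z.2 (tau / 2).
    by rewrite B1 ?ltW//; ring.
  by rewrite s'0//; ring.
have mD : measurable (dom r tau d : set (X * measurableTypeR R)) by exact: measurable_dom.
have iu := integrable_dom r uL d0 tauT; have iv := integrable_dom r vL d0 tauT.
have tau0' : 0 <= tau by exact: ltW.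
have hz z : dom r tau d z -> 0 <= z.2 <= tau.
  by move=> /dom_time/andP[z1 ->]; rewrite andbT (le_trans (ltW d20)).
have cB : continuous (fun t => derive1 (derive1 B) t - 2 * lam * derive1 B t).
  move=> t; apply: cvgB; first by apply: smooth1_continuous; do 2 apply: smooth1_derive.
  by apply: (@cvgMl_tmp R R); apply: smooth1_continuous; exact: smooth1_derive.
have cs' := smooth1_continuous ss'.
have cb' := smooth1_continuous (smooth1_derive sb).
have [c1 c10 hc1] := continuous_bounded tau0' cB.
have [c2 c20 hc2] := continuous_bounded tau0' cb'.
have [c4 c40 hc4] := continuous_bounded tau0' cs'.
have iP1 : M.-integrable (dom r tau d) (EFin \o (fun z => u z.1 z.2 * P1 z)).
  apply: (@integrable_dom_mul u P1 tau d (expR (tau + r) * c1) iu).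
    by apply: measurable_funM; [exact: measurable_wave|exact: (measurable_time cB)].
  by move=> z Dz; rewrite normrM; apply: ler_pM => //; [exact: wave_le wl l01 d0 Dz|apply: hc1; exact: hz].
have iP2 : M.-integrable (dom r tau d) (EFin \o (fun z => u z.1 z.2 * P2 z)).
  apply: (@integrable_dom_mul u P2 tau d (c2 * expR (tau + r)) iu).
    apply: measurable_funM; first exact: (measurable_time cb').
    apply: (measurableT_comp (@measurable_expR R)).
    by apply: measurable_space; exact: measurable_dotp.
  move=> z Dz; rewrite normrM; apply: ler_pM => //; first by apply: hc2; exact: hz.
  rewrite ger0_norm ?expR_ge0// ler_expR.
  by have := dotp_dom wl l01 Dz; rewrite ler_norml => /andP[].
have iP4 (g : X -> R -> R) :
    M.-integrable (dom r tau d) (EFin \o (fun z => g z.1 z.2)) ->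
    M.-integrable (dom r tau d) (EFin \o (fun z => g z.1 z.2 * P4 z)).
  move=> ig; apply: (@integrable_dom_mul g P4 tau d (expR (tau + r) * c4) ig).
    by apply: measurable_funM; [exact: measurable_wave|exact: (measurable_time cs')].
  by move=> z Dz; rewrite normrM; apply: ler_pM => //; [exact: wave_le wl l01 d0 Dz|apply: hc4; exact: hz].
transitivity (\int[M]_(z in dom r tau d) (`|u z.1 z.2| `^ p * tens a1 h z)).
  apply: eq_Rintegral => z; rewrite inE => Dz; congr (_ * _).
  rewrite tens_planes//; last by move=> i; exact: D'.
  have [zt|zt] := ltP z.2 (tau / 2); rewrite Ewave /a1 /= /a /s; ring.
rewrite -E1.
have -> : \int[M]_(z in dom r tau d) (u z.1 z.2 * box (tens a1 h) z) =
  \int[M]_(z in dom r tau d) ((u z.1 z.2 * P1 z - u z.1 z.2 * P2 z)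
    + lam * (u z.1 z.2 * P4 z)).
  by apply: eq_Rintegral => z; rewrite inE => Dz; rewrite boxE//; ring.
have il : M.-integrable (dom r tau d) (EFin \o (fun z => lam * (u z.1 z.2 * P4 z))).
  rewrite (_ : _ \o _ = (fun z => lam%:E * (u z.1 z.2 * P4 z)%:E)%E); last first.
    by apply/funext => z /=; rewrite EFinM.
  by apply: integrableZl => //; exact: iP4.
have i12 : M.-integrable (dom r tau d) (EFin \o (fun z => u z.1 z.2 * P1 z - u z.1 z.2 * P2 z)).
  rewrite (_ : _ \o _ = (fun z => (u z.1 z.2 * P1 z)%:E - (u z.1 z.2 * P2 z)%:E)%E); last first.
    by apply/funext => z /=; rewrite EFinB.
  exact: integrableB.
rewrite RintegralD// RintegralB// RintegralZl//; last exact: iP4.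
congr (_ + _); congr (_ + _).
(* The total derivative of [a s'] is traded for [v] by the weak form [E2] of [u_t = v]. *)
have -> : \int[M]_(z in dom r tau d) (u z.1 z.2 * P2 z) =
    \int[M]_(z in dom r tau d) (u z.1 z.2 * tens (derive1 b) h z).
  apply: eq_Rintegral => z; rewrite inE => Dz; rewrite tens_planes//.
  by move=> i; exact: D'.
rewrite E2 opprK; apply: eq_Rintegral => z; rewrite inE => Dz.
by rewrite P4E.
Qed.

End identity.

(** * Passing from the layer to the initial data *)

Section layer_removal.
Variables (R : realType) (n : nat) (r : R).
Local Notation mu := (lebesgue_rV R n).
Local Notation leb := (@lebesgue_measure R).
Local Notation M := (mu \x leb)%E.
Local Notation X := 'rV[R]_n.
Local Notation S := (@smooth_step R).
Implicit Types (w : 'I_n -> R) (lam : R) (z : X * R).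

Lemma cube_L1_finite (L : R) (h : X -> R) : 0 <= L -> L2 h ->
  (\int[mu]_(x in cube (n:=n) L) `|h x|%:E < +oo)%E.
Proof.
move=> L0 h2; have [C C0 hC] := @cube_L1 R n L L0.
apply: le_lt_trans (hC h (L2_measurable h2)) _.
rewrite lte_mul_pinfty ?lee_fin ?ltW//.
have := sub_Lfun_finLfun h2; rewrite inE; exact.
Qed.

Lemma integrable_dom_space (h : X -> R) (tau d : R) : 0 < r -> 0 < d -> d / 2 <= tau -> L2 h ->
  M.-integrable (dom r tau d) (EFin \o (fun z => `|h z.1|)).
Proof.
move=> r0 d0 dtau h2; have mh := L2_measurable h2.
have L0 : 0 <= 2 * (tau + r + 1) by lra.
have mB := @measurable_cube R n (2 * (tau + r + 1)).
apply: (@integrableS _ (X * measurableTypeR R)%type R M (slab (2 * (tau + r + 1)) (d / 2) tau)).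
- exact: measurable_slab.
- exact: measurable_dom.
- by move=> z [].
have mhz : measurable_fun [set: X * measurableTypeR R] (fun z => `|h z.1|).
  by apply: measurableT_comp => //; exact: measurable_space.
apply/integrableP; split.
  by apply/measurable_EFinP; exact: measurable_funTS.
rewrite (_ : (fun z => _) = (fun z => `|h z.1|%:E * (cst 1%E z.2))%E); last first.
  by apply/funext => z; rewrite /= normr_id mule1.
rewrite (@ge0_tonelli_prod R n (fun x => `|h x|%:E) (cst 1%E))//.
- rewrite integral_cst// mul1e.
  rewrite [X in (_ * X)%E](_ : _ = (tau - d / 2)%:E); last first.
    apply: etrans (lebesgue_measure_itv _) _; rewrite /= lte_fin.
    case: ltP => [_|t0]; first by rewrite EFinB.
    by rewrite (_ : tau = d / 2) ?subrr//; apply/eqP; rewrite eq_le t0.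
  apply: lte_mul_pinfty.
  + exact: integral_ge0.
  + by rewrite ge0_fin_numE ?integral_ge0//; exact: cube_L1_finite.
  + by rewrite ltry.
- by apply/measurable_EFinP; apply: measurable_funTS; exact: measurableT_comp.
Qed.

(** In the two layer integrals of [wave_identity], [v] is close to 0 and [u] to [eps |f|], and each
    replacement costs at most [e / 2]. The thickness [d] is chosen before [lam] and [w], so that one
    domain serves all directions in the later average. [|f|] replaces [f], which is nonnegative only
    almost everywhere. *)
Lemma test_inequality (p eps : R) (f : X -> R) (T : \bar R) (u v : X -> R -> R) (tau e : R) (B : R -> R) :
  0 < r -> 0 < p -> 0 < eps -> L2 f -> {ae mu, forall x, 0 <= f x} -> (0 < T)%E ->
  is_solution p f (cst 0) eps T u v -> supported_in_cone r T u v ->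
  1 <= tau -> (tau%:E < T)%E ->
  smooth1 B -> (forall t, t <= tau / 2 -> B t = 1) -> (forall t, tau <= t -> B t = 0) ->
  0 < e ->
  exists d, [/\ 0 < d, d < tau / 2 & forall lam w, lam = 0 \/ lam = 1 -> \sum_i w i ^+ 2 = lam ->
  \int[M]_(z in dom r tau d) (`|u z.1 z.2| `^ p *
      (B z.2 * (1 - S (d^-1 * z.2)) * wave w lam z)) +
    lam * (eps * (expR (- r - 1) * \int[mu]_(x in eball r) `|f x|)) <=
  \int[M]_(z in dom r tau d) (`|u z.1 z.2| * (wave w lam z *
      `|derive1 (derive1 B) z.2 - 2 * lam * derive1 B z.2|)) + e].
Proof.
move=> r0 p0 eps0 f2 f0 T0 sol sc tau1 tauT sB B1 B0 e0.
have tau0 : 0 < tau by apply: lt_le_trans tau1.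
have mf := L2_measurable f2.
have [[uv_class ucurve vcurve] [uL vL _] _ initu initv] := sol.
have [CS CS0 hCS] : exists2 C, 0 <= C & forall s, `|derive1 S s| <= C.
  have sS' := smooth1_derive (@smooth1_step R).
  by apply: (@smooth1_bounded R _ 2^-1 1 _ sS' (@derive1_step_supp R)); lra.
pose L := 2 * (tau + r + 1); have L0 : 0 <= L by rewrite /L; lra.
pose CL := expR (tau + r); have CL0 : 0 < CL by exact: expR_gt0.
(* On the domain the wave is at most [CL] and [S_d'] at most [CS / d], so a layer integral is at
   most [CL CS e1 / 2]; the 1 keeps the denominator positive. *)
pose e1 := e / (CL * CS + 1).
have e10 : 0 < e1 by rewrite divr_gt0// ltr_wpDl// mulr_ge0// ltW.
have mU : measurable_fun [set: X] (fun x => eps * `|f x|).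
  by apply: measurable_funM => //; exact: measurableT_comp.
have [d1 d10 hd1] : exists2 d, 0 < d & forall t, 0 <= t -> t < d -> (t%:E < T)%E ->
    (\int[mu]_(x in cube (n:=n) L) `|(u x t - eps * `|f x|)%R|%:E <= e1%:E)%E.
  apply: (small_layer _ ucurve) => //; first by move=> h; exact: L2norm_le_H1norm.
  - by move=> t /uv_class[[]].
  - by apply: filterS2 initu f0 => x -> fx; rewrite ger0_norm.
have [d2 d20 hd2] : exists2 d, 0 < d & forall t, 0 <= t -> t < d -> (t%:E < T)%E ->
    (\int[mu]_(x in cube (n:=n) L) `|(v x t - cst 0 x)%R|%:E <= e1%:E)%E.
  apply: (small_layer _ vcurve) => //.
  - by move=> t /uv_class[].
  - by apply: filterS initv => x ->; rewrite mulr0.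
(* The halves leave room for times equal to [d], and [1 / 4] ensures [d < tau / 2] because
   [1 <= tau]. *)
pose d := Num.min (Num.min (d1 / 2) (d2 / 2)) 4^-1.
have d0 : 0 < d by rewrite !lt_min !divr_gt0//= invr_gt0.
have dd1 : d < d1.
  by apply: (@le_lt_trans _ _ (d1 / 2)); [rewrite !ge_min lexx|lra].
have dd2 : d < d2.
  by apply: (@le_lt_trans _ _ (d2 / 2)); [rewrite !ge_min lexx orbT|lra].
have d4 : d <= 4^-1 by rewrite ge_min lexx orbT.
have dtau : d < tau / 2 by lra.
have dtau' : d <= tau by lra.
exists d; split => // lam w l01 wl.
rewrite (wave_identity r0 p0 sol sc tau1 tauT sB B1 B0 d0 dtau l01 wl).
set s' := derive1 (fun y => S (d^-1 * y)).
have ss : smooth1 (fun y => S (d^-1 * y)) by apply: smooth1_scale; exact: smooth1_step.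
have ss' : smooth1 s' by exact: smooth1_derive.
have cs' := smooth1_continuous ss'.
have s'E t : s' t = d^-1 * derive1 S (d^-1 * t) by exact: derive1_step_scale.
have s'd t : s' t != 0 -> t <= d.
  rewrite s'E mulf_eq0 negb_or => /andP[_ /derive1_step_supp/andP[_]].
  by rewrite mulrC ler_pdivrMr// mul1r.
pose P4 z := wave w lam z * s' z.2.
have mP4 : measurable_fun [set: X * measurableTypeR R] P4.
  by apply: measurable_funM; [exact: measurable_wave|exact: (measurable_time cs')].
have P4c z : dom r tau d z -> `|P4 z| <= CL * (d^-1 * CS).
  move=> Dz; rewrite normrM; apply: ler_pM => //; first exact: wave_le wl l01 d0 Dz.
  by rewrite s'E normrM ger0_norm ?invr_ge0 ?(ltW d0)// ler_wpM2l ?invr_ge0 ?(ltW d0).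
have P4d z : P4 z != 0 -> z.2 <= d.
  by rewrite mulf_eq0 negb_or => /andP[_ /s'd].
have c0 : 0 <= CL * (d^-1 * CS) by rewrite !mulr_ge0// ?ltW// invr_gt0.
have ce : CL * (d^-1 * CS) * (e1 * (d / 2)) <= e / 2.
  have -> : CL * (d^-1 * CS) * (e1 * (d / 2)) = CL * CS / (CL * CS + 1) * (e / 2).
    have h1 : d != 0 by rewrite gt_eqF.
    have h2 : CL * CS + 1 != 0 by rewrite gt_eqF// ltr_wpDl// mulr_ge0// ltW.
    by rewrite /e1; field; rewrite h1 h2.
  rewrite ler_piMl//; first by rewrite divr_ge0// ltW.
  by rewrite ler_pdivrMr ?mul1r ?lerDl// ltr_wpDl// mulr_ge0// ltW.
have mD : measurable (dom r tau d : set (X * measurableTypeR R)) by exact: measurable_dom.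
have iu := integrable_dom r uL d0 tauT; have iv := integrable_dom r vL d0 tauT.
have KT : slab L (d / 2) tau `<=` @spacetime R n T.
  by apply: slab_spacetime => //; rewrite divr_gt0.
have muK := measurable_int _ (uL _ KT (@compact_slab _ _ _ _ _)).
have mvK := measurable_int _ (vL _ KT (@compact_slab _ _ _ _ _)).
have tT t : t <= d -> (t%:E < T)%E.
  by move=> td; apply: le_lt_trans tauT; rewrite lee_fin (le_trans td).
have hv : \int[M]_(z in dom r tau d) (v z.1 z.2 * P4 z) <= e / 2.
  apply: le_trans ce; apply: le_trans (ler_norm _) _.
  apply: layer_bound => //.
  - by apply/measurable_EFinP.
  - exact: integrable_dom_mul P4c.
  - move=> t t0 td; have := hd2 t t0 (le_lt_trans td dd2) (tT t td).
    by under eq_integral do rewrite /= subr0.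
have d2tau : d / 2 <= tau by lra.
have ifn := integrable_dom_space r0 d0 d2tau f2.
have iU : M.-integrable (dom r tau d) (EFin \o (fun z => eps * `|f z.1|)).
  rewrite (_ : _ \o _ = (fun z => eps%:E * `|f z.1|%:E)%E); last first.
    by apply/funext => z /=; rewrite EFinM.
  exact: integrableZl.
have iuU : M.-integrable (dom r tau d) (EFin \o (fun z => u z.1 z.2 - eps * `|f z.1|)).
  rewrite (_ : _ \o _ = (fun z => (u z.1 z.2)%:E - (eps * `|f z.1|)%:E)%E); last first.
    by apply/funext => z /=; rewrite EFinB.
  exact: integrableB.
have hu : \int[M]_(z in dom r tau d) ((u z.1 z.2 - eps * `|f z.1|) * P4 z) <= e / 2.
  apply: le_trans ce; apply: le_trans (ler_norm _) _.
  apply: (@layer_bound R n r (fun x t => u x t - eps * `|f x|)) => //.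
  - apply: measurable_funB; first by apply/measurable_EFinP.
    by apply: measurable_funTS; exact: (measurable_space mU).
  - exact: (@integrable_dom_mul _ _ _ (fun x t => u x t - eps * `|f x|)) P4c.
  - by move=> t t0 td; exact: hd1 t t0 (le_lt_trans td dd1) (tT t td).
have iuP := @integrable_dom_mul _ _ r u P4 tau d _ iu mP4 P4c.
have iUP := @integrable_dom_mul _ _ r (fun x t => eps * `|f x|) P4 tau d _ iU mP4 P4c.
have ifP := @integrable_dom_mul _ _ r (fun x t => `|f x|) P4 tau d _ ifn mP4 P4c.
(* For [lam = 1], split [u] into [u - eps |f|], a layer error, and [eps |f|]. The weight [S_d'] is
   nonpositive, so [initial_lower] bounds the second part above by minus the data term. *)
have main : lam * \int[M]_(z in dom r tau d) (u z.1 z.2 * P4 z) +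
    lam * (eps * (expR (- r - 1) * \int[mu]_(x in eball r) `|f x|)) <= e / 2.
  case: l01 => l; first by rewrite l !mul0r addr0; lra.
  rewrite l !mul1r; rewrite l in wl.
  have -> : \int[M]_(z in dom r tau d) (u z.1 z.2 * P4 z) =
    \int[M]_(z in dom r tau d) ((u z.1 z.2 - eps * `|f z.1|) * P4 z) -
    eps * \int[M]_(z in dom r tau d) (`|f z.1| * (wave w 1 z * - s' z.2)).
    have iN : M.-integrable (dom r tau d) (EFin \o (fun z => `|f z.1| * (wave w 1 z * - s' z.2))).
      rewrite (_ : _ \o _ = (fun z => - (`|f z.1| * P4 z)%:E)%E); last first.
        by apply/funext => z; rewrite -EFinN /P4 l /=; congr EFin; ring.
      exact: integrableN.
    rewrite -RintegralZl// -RintegralB//.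
    - by apply: eq_Rintegral => z _; rewrite /P4 l; ring.
    - exact: (@integrable_dom_mul _ _ r (fun x t => u x t - eps * `|f x|) P4 tau d _ iuU mP4 P4c).
    - rewrite (_ : _ \o _ = (fun z => eps%:E * (`|f z.1| * (wave w 1 z * - s' z.2))%:E)%E); last first.
        by apply/funext => z /=; rewrite EFinM.
      exact: integrableZl.
  have wx x : `|dotp w x| <= enorm x by apply: (@dotp_le _ _ _ _ 1) => //; right.
  have WE : (fun z => `|f z.1| * (wave w 1 z * - s' z.2)) =
      (fun z => `|f z.1| * (expR (dotp w z.1 - z.2) * - s' z.2)).
    by apply/funext => z; rewrite /wave mul1r.
  have fin : (\int[mu]_(x in eball r) `|f x|%:E < +oo)%E.
    apply: le_lt_trans (cube_L1_finite L0 f2); apply: ge0_subset_integral => //.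
    - exact: measurable_eball.
    - exact: measurable_cube.
    - by apply/measurable_EFinP; apply: measurable_funTS; exact: measurableT_comp.
    - move=> x xr i; rewrite /= in_itv/= -ler_norml.
      by apply: le_trans (coord_le_enorm _ _) _; apply: le_trans xr _; rewrite /L; lra.
  have iN : M.-integrable (dom r tau d) (EFin \o (fun z => `|f z.1| * (wave w 1 z * - s' z.2))).
    rewrite (_ : _ \o _ = (fun z => - (`|f z.1| * P4 z)%:E)%E); last first.
      by apply/funext => z; rewrite -EFinN /P4 l /=; congr EFin; ring.
    exact: integrableN.
  rewrite WE in iN *.
  have d11 : d <= 1 by lra.
  have low := initial_lower r0 d0 d11 dtau' mf fin wx iN.
  have := ler_wpM2l (ltW eps0) low; lra.
have le1 : \int[M]_(z in dom r tau d) (u z.1 z.2 * (wave w lam z *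
      (derive1 (derive1 B) z.2 - 2 * lam * derive1 B z.2))) <=
  \int[M]_(z in dom r tau d) (`|u z.1 z.2| * (wave w lam z *
      `|derive1 (derive1 B) z.2 - 2 * lam * derive1 B z.2|)).
  have cB : continuous (fun t => derive1 (derive1 B) t - 2 * lam * derive1 B t).
    move=> t; apply: cvgB; first by apply: smooth1_continuous; do 2 apply: smooth1_derive.
    by apply: (@cvgMl_tmp R R); apply: smooth1_continuous; exact: smooth1_derive.
  have cBn : continuous (fun t => `|derive1 (derive1 B) t - 2 * lam * derive1 B t|).
    by move=> t; apply: cvg_norm; exact: cB.
  have [c1 c10 hc1] := continuous_bounded (ltW tau0) cB.
  have hz z : dom r tau d z -> 0 <= z.2 <= tau.
    move=> /dom_time/andP[z1 ->]; rewrite andbT; apply: le_trans z1.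
    by rewrite divr_ge0// ltW.
  apply: le_Rintegral => //.
  - apply: (@integrable_dom_mul _ _ r u _ tau d (CL * c1) iu).
      by apply: measurable_funM; [exact: measurable_wave|exact: (measurable_time cB)].
    move=> z Dz; rewrite normrM; apply: ler_pM => //; first exact: wave_le wl l01 d0 Dz.
    by apply: hc1; exact: hz.
  - apply: (@integrable_dom_mul _ _ r (fun x t => `|u x t|) _ tau d (CL * c1)).
    + exact: (integrable_abse iu).
    + by apply: measurable_funM; [exact: measurable_wave|exact: (measurable_time cBn)].
    + move=> z Dz; rewrite normrM normr_id; apply: ler_pM => //; first exact: wave_le wl l01 d0 Dz.
      by apply: hc1; exact: hz.
  - move=> z Dz; apply: le_trans (ler_norm _) _; rewrite !normrM.
    by rewrite (ger0_norm (wave_ge0 _ _ _)).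
move: hv main le1; rewrite /P4; lra.
Qed.

End layer_removal.

(** * Averages of plane waves *)

Section grid.
Variable R : realType.
Implicit Types (x s t : R).

(** At the intermediate point [c] of the mean value theorem, [c^2 <= 2 x^2 + 2], hence
    [1 + c^2 <= 3 (1 + x^2)]. *)
Lemma atan_step x s : 0 < s -> s <= 1 ->
  s / (3 * (1 + x ^+ 2)) <= atan (x + s) - atan x.
Proof.
move=> s0 s1.
have xs : x < x + s by rewrite ltrDl.
have dA y : y \in `]x, (x + s)[%R -> is_derive y 1 (@atan R) (1 + y ^+ 2)^-1.
  by move=> _; exact: is_derive1_atan.
have cA : {within `[x, (x + s)], continuous (@atan R)}.
  by apply: continuous_subspaceT => y; exact: continuous_atan.
have [c cx ->] := MVT xs dA cA.
rewrite [x + s]addrC addrK [leRHS]mulrC ler_pM2l//.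
move: cx; rewrite in_itv/= => /andP[c1 c2].
have x2 := sqr_ge0 x; have c2' := sqr_ge0 c.
rewrite lef_pV2 ?posrE; [|lra|lra].
have h1 := sqr_ge0 (x - (c - x)); have h2 : (c - x) ^+ 2 <= 1.
  by rewrite expr_le1//; lra.
by nra.
Qed.

(* [e^(- X^2) <= 1 / (1 + X^2)] is dominated by an increment of [3 / s * atan]. *)
Lemma sum_gauss_le (N : nat) (s b : R) : 0 < s -> s <= 1 ->
  \sum_(k < N) expR (- (s * k%:R - b) ^+ 2) <= 3 * pi / s.
Proof.
move=> s0 s1.
have h (k : nat) : expR (- (s * k%:R - b) ^+ 2) <=
    3 / s * (atan (s * k.+1%:R - b) - atan (s * k%:R - b)).
  have := atan_step (s * k%:R - b) s0 s1.
  have -> : s * k%:R - b + s = s * k.+1%:R - b by rewrite -natr1; ring.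
  set X := s * k%:R - b => hX.
  have X1 : 0 < 1 + X ^+ 2 by have := sqr_ge0 X; lra.
  apply: (@le_trans _ _ (1 + X ^+ 2)^-1).
    by rewrite expRN lef_pV2 ?posrE ?expR_gt0// expR_ge1Dx.
  apply: le_trans (_ : 3 / s * (s / (3 * (1 + X ^+ 2))) <= _); last first.
    by rewrite ler_wpM2l// divr_ge0// ltW.
  rewrite le_eqVlt; apply/orP; left; apply/eqP; field.
  by rewrite !gt_eqF.
apply: le_trans (ler_sum _ (fun k _ => h (val k))) _.
rewrite -mulr_sumr -(big_mkord xpredT (fun k => atan (s * k.+1%:R - b) - atan (s * k%:R - b))).
rewrite telescope_sumr// mulrAC ler_wpM2r ?invr_ge0 ?(ltW s0)// ler_wpM2l//.
have := @atan_ltpi2 R (s * N%:R - b); have := @atan_gtNpi2 R (s * 0%:R - b); lra.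
Qed.

(* The directions are [(sqrt (1 - |y|^2), y)] with [y] in a fine grid near [0]: by
   [dotp_gap] the sum is dominated by a product of one-dimensional Gaussian sums,
   so no integration over the sphere is needed. *)
Lemma grid_average (m : nat) (lam1 : R) : 1 <= lam1 ->
  exists (I : finType) (w : I -> 'I_m.+1 -> R), [/\ (0 < #|I|)%N,
    forall k, \sum_i w k i ^+ 2 = 1 &
    forall x : 'rV[R]_m.+1, 0 < enorm x -> enorm x <= lam1 ->
    \sum_k expR (dotp (w k) x) <=
    #|I|%:R * (expR (enorm x) * (6 * pi * m.+1%:R / Num.sqrt (enorm x)) ^+ m)].
Proof.
move=> l1.
have [N hN] : exists N : nat, lam1 < N%:R.
  by eexists; apply: archi_boundP; apply: le_trans l1.
have N1 : 1 <= N%:R :> R by apply: le_trans l1 (ltW hN).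
have N0 : (0 < N)%N by rewrite -(ltr_nat R); exact: lt_le_trans N1.
have Nr : 0 < N%:R :> R by rewrite ltr0n.
(* The factor [m.+1] keeps the grid coordinates below [1 / (m + 1)], so that the sum of their
   squares is at most 1 and the first component of [w] exists. The factor [N > lam1] makes the grid
   fine enough for [sum_gauss_le] at every [|x| <= lam1]. *)
pose h : R := (N%:R * m.+1%:R)^-1.
have mr : 1 <= m.+1%:R :> R by rewrite ler1n.
have h0 : 0 < h by rewrite invr_gt0 mulr_gt0.
pose y (k : {ffun 'I_m -> 'I_N}) (i : 'I_m) : R := h * (k i)%:R.
have ysum k : \sum_i y k i ^+ 2 <= 1.
  have yi i : y k i <= m.+1%:R^-1.
    rewrite /y /h invfM mulrAC -[leRHS]mul1r ler_wpM2r ?invr_ge0//.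
    by rewrite mulrC ler_pdivrMr// mul1r ler_nat ltnW// ltn_ord.
  have y0 i : 0 <= y k i by rewrite mulr_ge0 ?ler0n// ltW.
  apply: (@le_trans _ _ (\sum_(i < m) m.+1%:R^-1)).
    apply: ler_sum => i _; rewrite expr2.
    have y1 : y k i <= 1 by apply: le_trans (yi i) _; rewrite invf_le1.
    by apply: (@le_trans _ _ (y k i)) => //; rewrite ler_piMl.
  rewrite sumr_const card_ord -[leLHS]mulr_natl ler_pdivrMr// mul1r ler_nat//.
pose w (k : {ffun 'I_m -> 'I_N}) (i : 'I_m.+1) : R :=
  oapp (y k) (Num.sqrt (1 - \sum_i y k i ^+ 2)) (unlift ord0 i).
have w1 k : \sum_i w k i ^+ 2 = 1.
  rewrite big_ord_recl /w unlift_none /= sqr_sqrtr; last by rewrite subr_ge0.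
  under [X in _ + X]eq_bigr do rewrite liftK /=.
  by ring.
exists {ffun 'I_m -> 'I_N}, w; split => //.
  by rewrite card_ffun !card_ord expn_gt0 N0.
move=> x x0 xl.
pose th (i : 'I_m) := x ord0 (lift ord0 i) / enorm x.
pose G (i : 'I_m) (j : 'I_N) := expR (- (enorm x / 2 * (h * j%:R - th i) ^+ 2)).
have wle k : expR (dotp (w k) x) <= expR (enorm x) * \prod_i G i (k i).
  rewrite /G -expR_sum -expRD ler_expR dotp_gap// ?gt_eqF//.
  rewrite lerD2l sumrN lerN2 -mulr_sumr ler_wpM2l//; first by rewrite divr_ge0// ltW.
  (* The first coordinate of [w - x / |x|] is discarded; the other [m] are free grid coordinates and
     make the bound a product. *)
  rewrite [leRHS]big_ord_recl.
  under [X in _ <= _ + X]eq_bigr do rewrite /w liftK /=.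
  by rewrite lerDr sqr_ge0.
apply: le_trans (ler_sum _ (fun k _ => wle k)) _.
rewrite -mulr_sumr mulrCA ler_wpM2l ?expR_ge0//.
(* The sum over grid points of a product becomes a product of [m] one-dimensional sums. *)
rewrite -(bigA_distr_bigA G) card_ffun !card_ord natrX -exprMn.
rewrite [leRHS](_ : _ = \prod_(i < m) (N%:R * (6 * pi * m.+1%:R / Num.sqrt (enorm x)))); last first.
  by rewrite prodr_const card_ord.
apply: ler_prod => i _; apply/andP; split; first by apply: sumr_ge0 => j _; exact: expR_ge0.
(* Rescaling by [sg] brings each factor to the form of [sum_gauss_le], with step [sg * h]. *)
pose sg := Num.sqrt (enorm x / 2).
have sg0 : 0 < sg by rewrite sqrtr_gt0 divr_gt0.
have sg2 : sg ^+ 2 = enorm x / 2 by rewrite sqr_sqrtr// divr_ge0// ltW.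
have sgN : sg <= N%:R.
  rewrite -(@ler_pXn2r _ 2)// ?nnegrE ?ltW// sg2; nra.
have sh0 : 0 < sg * h by rewrite mulr_gt0.
have sh1 : sg * h <= 1.
  by rewrite /h ler_pdivrMr ?mulr_gt0// mul1r; nra.
have -> : \sum_(j < N) G i j = \sum_(j < N) expR (- (sg * h * j%:R - sg * th i) ^+ 2).
  by apply: eq_bigr => j _; rewrite /G -sg2; congr expR; ring.
apply: le_trans (sum_gauss_le _ _ sh0 sh1) _.
have s1 : 0 < Num.sqrt (enorm x) by rewrite sqrtr_gt0.
have sgs : Num.sqrt (enorm x) <= 2 * sg.
  rewrite -(@ler_pXn2r _ 2)// ?nnegrE ?mulr_ge0 ?ltW// exprMn sg2 sqr_sqrtr ?ltW//; lra.
rewrite /h invfM invrK.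
have p0 : 0 < pi :> R := pi_gt0 R.
rewrite [leRHS](_ : _ = N%:R * (3 * pi * m.+1%:R) * (2 / Num.sqrt (enorm x))); last by field; rewrite gt_eqF.
rewrite [leLHS](_ : _ = N%:R * (3 * pi * m.+1%:R) * sg^-1); last by field; rewrite gt_eqF.
rewrite ler_wpM2l//; first by rewrite !mulr_ge0// ltW.
by rewrite ler_pdivlMr// mulrC ler_pdivrMr.
Qed.

End grid.

Section decay.
Variable R : realType.

(** Where [|x| >= tau / 4], [grid_average] gives the decay and half of the exponential is bounded by
    [e^(r / 2)]. Elsewhere [w . x <= |x|] suffices, since half of the exponential is already small.
    [Cw] adds the constants of the two regions. *)
Lemma average_decay (m : nat) (r : R) : 0 < r -> exists2 Cw, 0 < Cw &
  forall tau : R, 1 <= tau -> exists (I : finType) (w : I -> 'I_m.+1 -> R), [/\ (0 < #|I|)%N,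
    forall k, \sum_i w k i ^+ 2 = 1 &
    forall z : 'rV[R]_m.+1 * R, tau / 2 <= z.2 -> z.2 <= tau -> enorm z.1 <= z.2 + r ->
    \sum_k wave (w k) 1 z <=
    #|I|%:R * (Cw * (Num.sqrt tau)^-1 ^+ m * expR ((enorm z.1 - z.2) / 2))].
Proof.
move=> r0; pose C0 : R := 6 * pi * m.+1%:R.
have C00 : 0 < C0 by rewrite !mulr_gt0// pi_gt0.
exists (expR (r / 2) * (2 * C0) ^+ m + 8 ^+ m.+1 * m.+1`!%:R).
  by apply: addr_gt0; apply: mulr_gt0; rewrite ?expR_gt0 ?exprn_gt0 ?ltr0n ?fact_gt0//; exact: mulr_gt0.
move=> tau tau1; have tau0 : 0 < tau by apply: lt_le_trans tau1.
have [|I [w [I0 w1 hw]]] := @grid_average R m (tau + r); first lra.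
exists I, w; split => // -[x t] /= t1 t2 xt.
set E := expR ((enorm x - t) / 2); have E0 : 0 < E by exact: expR_gt0.
have EE : expR (enorm x - t) = E * E by rewrite /E -expRD; congr expR; lra.
have sq0 : 0 < Num.sqrt tau by rewrite sqrtr_gt0.
set sm := (Num.sqrt tau)^-1 ^+ m; have sm0 : 0 < sm by rewrite exprn_gt0// invr_gt0.
have IR : 0 < #|I|%:R :> R by rewrite ltr0n.
have waveE k : wave (w k) 1 (x, t) = expR (dotp (w k) x) * expR (- t).
  by rewrite /wave /= mul1r expRD.
have [xtau|xtau] := leP (tau / 4) (enorm x).
  have x0 : 0 < enorm x by apply: lt_le_trans xtau; rewrite divr_gt0.
  under eq_bigr do rewrite waveE.
  rewrite -mulr_suml.
  have xl : enorm x <= tau + r by apply: le_trans xt _; rewrite lerD2r.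
  apply: (@le_trans _ _ (#|I|%:R * (expR (enorm x) * (C0 / Num.sqrt (enorm x)) ^+ m) * expR (- t))).
    by rewrite ler_wpM2r ?expR_ge0// hw.
  rewrite -mulrA ler_wpM2l ?(ltW IR)//.
  rewrite mulrAC -expRD EE mulrAC.
  have sx : (C0 / Num.sqrt (enorm x)) ^+ m <= (2 * C0) ^+ m * sm.
    have h1 : 0 <= C0 / Num.sqrt (enorm x) by rewrite divr_ge0 ?sqrtr_ge0// ltW.
    have h2 : 0 <= 2 * C0 * (Num.sqrt tau)^-1.
      by rewrite mulr_ge0 ?invr_ge0 ?sqrtr_ge0// mulr_ge0// ltW.
    rewrite /sm -exprMn; apply: lerXn2r => //.
    rewrite [2 * C0]mulrC -(mulrA C0) ler_wpM2l ?(ltW C00)//.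
    have sx0 : 0 < Num.sqrt (enorm x) by rewrite sqrtr_gt0.
    rewrite -[leLHS]mul1r ler_pdivrMr// mulrAC ler_pdivlMr// mul1r.
    rewrite -(@ler_pXn2r _ 2)// ?nnegrE ?mulr_ge0 ?sqrtr_ge0// exprMn !sqr_sqrtr ?(ltW tau0) ?(ltW x0)//.
    lra.
  have Er : E <= expR (r / 2) by rewrite ler_expR ler_pM2r// lerBlDl.
  apply: ler_wpM2r; first exact: ltW.
  apply: (@le_trans _ _ (expR (r / 2) * ((2 * C0) ^+ m * sm))).
    by rewrite ler_pM ?(ltW E0)// exprn_ge0// divr_ge0 ?(ltW C00)// sqrtr_ge0.
  rewrite mulrA ler_wpM2r ?(ltW sm0)// lerDl mulr_ge0 ?exprn_ge0//.
apply: (@le_trans _ _ (\sum_(k : I) E * E)).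
  apply: ler_sum => k _; rewrite -EE ler_expR /= mul1r lerD2r.
  exact: le_trans (ler_norm _) (@dotp_le R _ (w k) x 1 (w1 k) (or_intror erefl)).
rewrite sumr_const -[leLHS]mulr_natl ler_wpM2l ?(ltW IR)// ler_wpM2r ?(ltW E0)//.
(* Here [|x| < tau / 4] and [t >= tau / 2]. The series bound [(tau / 8)^(m + 1) <= (m + 1)! e^(tau /
   8)] then yields the constant [8^(m + 1) (m + 1)!]. *)
have Et : E <= (expR (tau / 8))^-1 by rewrite -expRN ler_expR; lra.
apply: le_trans Et _.
apply: (@le_trans _ _ (8 ^+ m.+1 * m.+1`!%:R * sm)); last first.
  by rewrite ler_wpM2r ?(ltW sm0)// lerDr mulr_ge0 ?expR_ge0// exprn_ge0// mulr_ge0// ltW.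
rewrite /sm exprVn -[leLHS]mul1r ler_pdivrMr ?expR_gt0// mulrAC ler_pdivlMr ?exprn_gt0// mul1r.
have st : Num.sqrt tau <= tau.
  rewrite -(@ler_pXn2r _ 2)// ?nnegrE ?sqrtr_ge0 ?(ltW tau0)// sqr_sqrtr ?(ltW tau0)// expr2.
  by rewrite ler_peMr// ltW.
apply: (@le_trans _ _ (tau ^+ m.+1)).
  apply: (@le_trans _ _ (tau ^+ m)).
    by apply: lerXn2r; rewrite ?nnegrE ?sqrtr_ge0 ?(ltW tau0).
  by rewrite exprS ler_peMl// exprn_ge0// ltW.
have := @expR_ge1Dxn R (tau / 8) m (divr_ge0 (ltW tau0) (ler0n _ _)).
move=> h; have F0 : 0 < m.+1`!%:R :> R by rewrite ltr0n fact_gt0.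
have h2 : (tau / 8) ^+ m.+1 <= expR (tau / 8) * m.+1`!%:R.
  by rewrite -ler_pdivrMr//; apply: le_trans h; rewrite lerDr.
have -> : tau ^+ m.+1 = 8 ^+ m.+1 * (tau / 8) ^+ m.+1.
  by rewrite -exprMn mulrCA mulfV ?mulr1.
by rewrite -mulrA ler_wpM2l ?exprn_ge0// [leRHS]mulrC.
Qed.

(* Young's inequality up to constants; the two terms dominate in the two cases
   [b <= m a^(p-1)] and [m a^(p-1) < b]. *)
Lemma crude_young (p a b m : R) : 1 < p -> 0 <= a -> 0 <= b -> 0 < m ->
  a * b <= m * a `^ p + m `^ (- (p - 1)^-1) * b `^ (p / (p - 1)).
Proof.
move=> p1 a0 b0 m0; have p10 : 0 < p - 1 by rewrite subr_gt0.
have p0 : 0 < p by apply: lt_trans p1.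
have [h|h] := leP b (m * a `^ (p - 1)).
  rewrite ler_wpDr ?mulr_ge0 ?powR_ge0//.
  by rewrite -(mulr_powRB1 a0 p0) mulrCA ler_wpM2l.
have b00 : 0 < b by apply: le_lt_trans h; rewrite mulr_ge0 ?powR_ge0// ltW.
rewrite ler_wpDl ?mulr_ge0 ?powR_ge0 ?(ltW m0)//.
have -> : p / (p - 1) = (p - 1)^-1 + 1 by field; rewrite gt_eqF.
rewrite powRD ?(gt_eqF b00) ?implybT// powRr1 ?(ltW b00)// mulrA ler_wpM2r//.
have am : a `^ (p - 1) <= m^-1 * b by rewrite mulrC ler_pdivlMr// mulrC ltW.
have := @ge0_ler_powR R (p - 1)^-1 _ _ _ _ _ am.
rewrite !nnegrE powR_ge0 mulr_ge0 ?invr_ge0 ?(ltW m0) ?(ltW p10)// => /(_ isT isT isT).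
rewrite -powRrM mulfV ?gt_eqF// powRr1// powRM ?invr_ge0 ?(ltW m0)//.
by rewrite -(powR_inv1 (ltW m0)) -powRrM mulN1r.
Qed.

End decay.

(** * Integrals over the truncated cone *)

Section volume.
Variables (R : realType) (n : nat) (r : R).
Local Notation mu := (lebesgue_rV R n).
Local Notation leb := (@lebesgue_measure R).
Local Notation M := (mu \x leb)%E.
Local Notation X := 'rV[R]_n.

Lemma integrable_dom_bounded (G : X * R -> R) (tau d c : R) : 0 < r -> 0 <= tau -> d / 2 <= tau ->
  measurable_fun [set: X * measurableTypeR R] G ->
  (forall z, dom r tau d z -> `|G z| <= c) ->
  M.-integrable (dom r tau d) (EFin \o G).
Proof.
move=> r0 tau0 dtau mG Gc.
have mD : measurable (dom r tau d : set (X * measurableTypeR R)) by exact: measurable_dom.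
have i1 : M.-integrable (dom r tau d) (EFin \o cst 1).
  apply: (@integrableS _ (X * measurableTypeR R)%type R M (slab (2 * (tau + r + 1)) (d / 2) tau)) => //.
  - exact: measurable_slab.
  - by move=> z [].
  apply/integrableP; split; first by apply/measurable_EFinP; exact: measurable_cst.
  rewrite (_ : (fun z => _) = cst 1%E); last by apply/funext => z /=; rewrite normr1.
  rewrite integral_cst//; last exact: measurable_slab.
  have L0 : 0 <= 2 * (tau + r + 1) by lra.
  by rewrite mul1e; apply: le_lt_trans (le_of_eq (@slab_measure R n _ _ _ L0 dtau)) _; rewrite ltry.
rewrite (_ : _ \o _ = EFin \o (fun z => cst 1 z * G z)); last by apply/funext => z /=; rewrite mul1r.
apply: (@integrable_bounded_mul R _ (X * measurableTypeR R)%type M _ _ _ c) => //.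
exact: measurable_funTS.
Qed.

Lemma dom_volume (tau d : R) : 0 < r -> 0 < d -> d / 2 <= tau ->
  fine (M (dom r tau d)) <= (4 * (tau + r + 1)) ^+ n * tau.
Proof.
move=> r0 d0 dtau; have L0 : 0 <= 2 * (tau + r + 1) by lra.
have h : (M (dom r tau d) <= ((4 * (tau + r + 1)) ^+ n * tau)%:E)%E.
  apply: le_trans (le_measure M _ _ (_ : dom r tau d `<=` slab (2 * (tau + r + 1)) (d / 2) tau)) _.
  - by rewrite inE; exact: measurable_dom.
  - by rewrite inE; exact: measurable_slab.
  - by move=> z [].
  apply: le_trans (le_of_eq (@slab_measure R n _ _ _ L0 dtau)) _; rewrite lee_fin mulrA -natrM ler_wpM2l//; last lra.
  by rewrite exprn_ge0//; lra.
apply: fine_le_real h; exact: measure_ge0.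
Qed.

(* Integrating in time first makes polar coordinates unnecessary. *)
Lemma dom_exp_integral (tau d c : R) : 0 < r -> 0 < d -> d / 2 <= tau -> 0 < c ->
  \int[M]_(z in dom r tau d) expR (c * (enorm z.1 - z.2)) <=
  expR (c * r) / c * (4 * (tau + r + 1)) ^+ n.
Proof.
move=> r0 d0 dtau c0; have L0 : 0 <= 2 * (tau + r + 1) by lra.
set B := cube (n:=n) (2 * (tau + r + 1)); pose I := `[d / 2, tau]%classic : set R.
have mB : measurable B by exact: measurable_cube.
have mI : measurable (I : set (measurableTypeR R)) by exact: measurable_itv.
have mBI : measurable (B `*` I : set (X * measurableTypeR R)) by exact: measurableX.
have mC := @measurable_cone R n r.
have mE : measurable_fun [set: X * measurableTypeR R] (fun z => expR (c * (enorm z.1 - z.2))).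
  apply: (measurableT_comp (@measurable_expR R)); apply: measurable_funM => //.
  apply: measurable_funB; first exact: (measurable_space (@measurable_enorm R n)).
  exact: measurable_snd.
(* The indicator of the cone moves into the integrand, which leaves a product domain for Tonelli. *)
pose F (x : X) (t : R) : \bar R := (expR (c * (enorm x - t)) * \1_(cone r) (x, t))%:E.
have F0 x t : (0 <= F x t)%E by rewrite lee_fin mulr_ge0 ?expR_ge0.
apply: fine_le_real; first by apply: integral_ge0 => z _; rewrite lee_fin expR_ge0.
have -> : (\int[M]_(z in dom r tau d) (expR (c * (enorm z.1 - z.2)))%:E =
   \int[M]_(z in B `*` I) F z.1 z.2)%E.
  rewrite /dom -/B [LHS]integral_mkcondr; apply: eq_integral => z _.
  rewrite patchE /F indicE -surjective_pairing.
  by case: ifP => _; rewrite ?mulr1 ?mulr0.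
apply: (@le_trans _ _ ((expR (c * r) / c)%:E * mu B)%E); last first.
  by rewrite cube_measure// lee_fin mulrA -natrM.
apply: ge0_tonelli_le2 => //.
- apply/measurable_EFinP; apply: measurable_funM; first exact: measurable_funTS.
  rewrite (_ : (fun z => _) = \1_(cone r)); last by apply/funext => z; rewrite -surjective_pairing.
  by apply: measurable_funTS; exact: measurable_indic.
(* With this [N], the interval from [s - r] to [s - r + N] contains every time up to [tau] at which
   [x] lies in the cone. *)
move=> x Bx; pose s := enorm x; pose N := tau + r + 1.
have N0 : 0 < N by rewrite /N; lra.
have cG : continuous (fun t : R => expR (c * (s - t))).
  move=> t; apply: continuous_comp; last exact: continuous_expR.
  apply: (@cvgMl_tmp R R); apply: cvgB; [exact: cvg_cst|exact: cvg_id].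
apply: le_trans (integral_exp_le s r c0 N0).
rewrite integral_mkcond [leRHS]integral_mkcond; apply: ge0_le_integral => //.
- by move=> t _; apply: erestrict_ge0.
- apply/(measurable_restrictT _ mI); apply/measurable_EFinP.
  apply: measurable_funM; first by apply: measurable_funTS; exact: continuous_measurable_fun.
  rewrite (_ : (fun t => _) = \1_(`[s - r, +oo[%classic : set R)); last first.
    apply/funext => t; rewrite !indicE; congr (nat_of_bool _)%:R.
    by apply/idP/idP; rewrite !inE /cone /= in_itv/= andbT lerBlDr.
  by apply: measurable_funTS; exact: measurable_indic.
- apply/(measurable_restrictT _ (measurable_itv _)); apply/measurable_EFinP.
  by apply: measurable_funTS; exact: continuous_measurable_fun.
move=> t _; rewrite !patchE; case: ifPn => tI; last first.
  by case: ifP => // _; rewrite lee_fin expR_ge0.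
rewrite /F indicE; case: (boolP ((x, t) \in cone r)) => xt; last first.
  by rewrite mulr0; case: ifP => // _; rewrite lee_fin expR_ge0.
rewrite mulr1 mem_set//= in_itv/=; move: xt tI; rewrite !inE /cone /I /= in_itv/= => xt /andP[_ tt].
have s0 : 0 <= s by exact: enorm_ge0.
by apply/andP; split; rewrite /N; rewrite -/s in xt; lra.
Qed.

End volume.

(** * The lifespan estimate *)

Lemma Rintegral_sum d (T : measurableType d) (R : realType) (nu : {measure set T -> \bar R})
    (D : set T) (I : Type) (s : seq I) (g : I -> T -> R) :
  measurable D -> (forall k, nu.-integrable D (EFin \o g k)) ->
  nu.-integrable D (EFin \o (fun x => \sum_(k <- s) g k x)) /\
  \int[nu]_(x in D) (\sum_(k <- s) g k x) = \sum_(k <- s) \int[nu]_(x in D) g k x.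
Proof.
move=> mD ig; elim: s => [|k s [IH1 IH2]].
  have -> : (fun x => \sum_(k <- [::]) g k x) = cst 0 by apply/funext => x; rewrite big_nil.
  by split; [exact: integrable0|rewrite big_nil /Rintegral integral0].
have -> : (fun x => \sum_(j <- k :: s) g j x) = (fun x => g k x + \sum_(j <- s) g j x).
  by apply/funext => x; rewrite big_cons.
split; last by rewrite big_cons RintegralD// IH2.
rewrite (_ : _ \o _ = (fun x => (g k x)%:E + (\sum_(j <- s) g j x)%R%:E)%E); last first.
  by apply/funext => x /=; rewrite EFinD.
by have := integrableD mD (ig k) IH1.
Qed.

Lemma half_absorb (R : realType) (x y a b a' b' : R) :
  x <= a + b + y -> y <= x / 2 -> a <= a' -> b <= b' -> x / 2 <= a' + b'.
Proof. lra. Qed.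

Section estimate.
Variables (R : realType) (m : nat).
Local Notation n := m.+1.
Local Notation mu := (lebesgue_rV R n).
Local Notation leb := (@lebesgue_measure R).
Local Notation M := (mu \x leb)%E.
Local Notation X := 'rV[R]_n.
Local Notation S := (@smooth_step R).

(** The first power of [tau] is [(tau^(- 2))^q], from the second derivative of the cutoff, times the
    volume [tau^(n + 1)]. The second is [(tau^(- 1) tau^(- (n - 1) / 2))^q], from one derivative and
    the decay of the average, times [tau^n] for the exponential integral. [nu] stays free for a
    later choice in terms of [tau] and [eps]. *)
Lemma lifespan_estimate (p r : R) : 1 < p -> 0 < r ->
  let q := p / (p - 1) in
  exists a1 a2 : R, [/\ 0 < a1, 0 < a2 &
  forall (eps : R) (f : X -> R) (T : \bar R) (u v : X -> R -> R) (tau nu c0 : R),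
  0 < eps -> L2 f -> {ae mu, forall x, 0 <= f x} ->
  (0 < T)%E -> is_solution p f (cst 0) eps T u v -> supported_in_cone r T u v ->
  1 <= tau -> (tau%:E < T)%E -> 0 < nu ->
  c0 = expR (- r - 1) * \int[mu]_(x in eball r) `|f x| -> 0 < c0 ->
  eps * c0 / 2 <= nu * (a1 * tau `^ (n%:R + 1 - 2 * q)) +
    nu `^ (- (p - 1)^-1) * (a2 * tau `^ (n%:R - q * (n%:R + 1) / 2))].
Proof.
move=> p1 r0 q; have p0 : 0 < p by apply: lt_trans p1.
have p10 : 0 < p - 1 by rewrite subr_gt0.
have q0 : 0 < q by rewrite divr_gt0.
have [A [C [sA A1 A0 A01 [C0 hA1 hA2]]]] := @power_cutoff R p p1.
have [Cw Cw0 hCw] := @average_decay R m r r0.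
pose C' := C + 1; have C'0 : 0 < C' by rewrite ltr_wpDl.
pose h2 : R := 2^-1 `^ (- (p - 1)^-1).
pose v1 : R := (4 * (r + 2)) ^+ n.
have v10 : 0 < v1 by rewrite exprn_gt0//; lra.
have h20 : 0 < h2 by apply: powR_gt0; rewrite invr_gt0.
(* Young's inequality with weight [1 / 2] (hence [h2]) leaves [Y / 2] to absorb, which doubles the
   rest; the summand 2 is the doubled error [e]. In the second constant, 3 bounds the two cutoff
   derivatives together. *)
exists (2 * h2 * C' `^ q * v1 + 2), ((3 * C' * Cw) `^ q * (expR (q / 2 * r) / (q / 2)) * v1).
split.
- by rewrite ltr_wpDl// !mulr_ge0 ?powR_ge0// ltW.
- apply: mulr_gt0 => //; apply: mulr_gt0; last by apply: divr_gt0; [exact: expR_gt0|exact: divr_gt0].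
  by apply: powR_gt0; do 2 apply: mulr_gt0 => //.
move=> eps f T u v tau nu c0 eps0 f2 f0 T0 sol sc tau1 tauT nu0 c0E c00.
have tau0 : 0 < tau by apply: lt_le_trans tau1.
have PD x y : tau `^ x * tau `^ y = tau `^ (x + y).
  by rewrite powRD// (gt_eqF tau0) implybT.
have Pgt x : 0 < tau `^ x by exact: powR_gt0.
pose B (t : R) := A (tau^-1 * t).
have sB : smooth1 B by exact: smooth1_scale.
have dV t : (tau^-1 * t <= 2^-1) = (t <= tau / 2).
  by rewrite mulrC ler_pdivrMr// mulrC.
have B1 t : t <= tau / 2 -> B t = 1 by move=> tt; rewrite /B A1// dV.
have B0 t : tau <= t -> B t = 0.
  by move=> tt; rewrite /B A0// mulrC ler_pdivlMr// mul1r.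
have B01 t : 0 <= B t <= 1 by exact: A01.
have dB : derive1 B = fun t => tau^-1 * derive1 A (tau^-1 * t) by exact: derive1_scale.
have ddB t : derive1 (derive1 B) t = tau^-1 * (tau^-1 * derive1 (derive1 A) (tau^-1 * t)).
  have sA' := smooth1_derive sA.
  have -> : derive1 B = cst tau^-1 \* (fun t => derive1 A (tau^-1 * t)) by rewrite dB.
  rewrite derive1_mul; [|exact: smooth1_cst|exact: smooth1_scale].
  by rewrite /= derive1_cst mul0r add0r derive1_scale.
have B'0 t : t < tau / 2 -> derive1 B t = 0.
  apply: (@derive1_locally_cst _ B 1 [set x | x < tau / 2] (@open_lt _ _)) => y /= yt.
  by rewrite B1// ltW.
have B''0 t : t < tau / 2 -> derive1 (derive1 B) t = 0.
  by apply: (@derive1_locally_cst _ _ 0 [set x | x < tau / 2] (@open_lt _ _)) => y /= /B'0.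
pose Bp (t : R) := B t `^ p^-1.
have Bp0 t : 0 <= Bp t by exact: powR_ge0.
have tV0 : 0 < tau^-1 by rewrite invr_gt0.
have tV1 : tau^-1 <= 1 by rewrite invf_le1.
have hB1 t : `|derive1 B t| <= C' * tau^-1 * Bp t.
  rewrite dB normrM (ger0_norm (ltW tV0)) [C' * _]mulrC -mulrA ler_wpM2l ?(ltW tV0)//.
  by apply: le_trans (hA1 _) _; rewrite ler_wpM2r ?powR_ge0// /C' lerDl.
have hB2 t : `|derive1 (derive1 B) t| <= C' * tau^-1 ^+ 2 * Bp t.
  rewrite ddB !normrM (ger0_norm (ltW tV0)) [C' * _]mulrC expr2 -!mulrA.
  rewrite !ler_wpM2l ?(ltW tV0)//.
  by apply: le_trans (hA2 _) _; rewrite ler_wpM2r ?powR_ge0// /C' lerDl.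
have hB3 t : `|derive1 (derive1 B) t - 2 * 1 * derive1 B t| <= 3 * C' * tau^-1 * Bp t.
  apply: le_trans (ler_normB _ _) _; rewrite mulr1 normrM (@ger0_norm _ 2)//.
  have : C' * tau^-1 ^+ 2 * Bp t <= C' * tau^-1 * Bp t.
    by rewrite ler_wpM2r// ler_wpM2l ?(ltW C'0)// expr2 ler_piMl// ltW.
  by have := hB1 t; have := hB2 t; lra.
(* The first entry lets half of [eps * c0] absorb the error; the second keeps the error below the
   power of [tau] that bounds [Y]. *)
pose e := Num.min (eps * c0 / 2) (tau `^ (n%:R + 1 - 2 * q)).
have e0 : 0 < e by rewrite lt_min Pgt andbT divr_gt0// mulr_gt0.
have [d [d0 dtau hcore]] := test_inequality r0 p0 eps0 f2 f0 T0 sol sc tau1 tauT sB B1 B0 e0.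
have d2tau : d / 2 <= tau by lra.
have mD : measurable (dom (n:=n) r tau d : set (X * measurableTypeR R)) by exact: measurable_dom.
have [_ [uL _ _] [_ upL _] _ _] := sol.
have iu := integrable_dom r uL d0 tauT.
have iua : M.-integrable (dom r tau d) (EFin \o (fun z => `|u z.1 z.2|)).
  exact: (integrable_abse iu).
have iup : M.-integrable (dom r tau d) (EFin \o (fun z => `|u z.1 z.2| `^ p)).
  exact: (@integrable_dom _ _ r T (fun x t => `|u x t| `^ p) tau d upL d0 tauT).
have hz (z : X * R) : dom r tau d z -> 0 <= z.2 <= tau.
  move=> /dom_time/andP[z1 ->]; rewrite andbT; apply: le_trans z1.
  by rewrite divr_ge0// ltW.
pose s (t : R) := S (d^-1 * t).
have ss : smooth1 s by apply: smooth1_scale; exact: smooth1_step.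
pose H (z : X * R) := B z.2 * (1 - s z.2).
have s01 t : 0 <= 1 - s t <= 1.
  by rewrite subr_ge0 smooth_step_le1 gerBl smooth_step_ge0.
have H01 z : 0 <= H z <= 1.
  have /andP[b0 b1] := B01 z.2; have /andP[s0 s1] := s01 z.2.
  by rewrite mulr_ge0// mulr_ile1.
have mH : measurable_fun [set: X * measurableTypeR R] H.
  apply: measurable_funM; first exact: (measurable_time (smooth1_continuous sB)).
  by apply: measurable_funB => //; exact: (measurable_time (smooth1_continuous ss)).
have iupH : M.-integrable (dom r tau d) (EFin \o (fun z => `|u z.1 z.2| `^ p * H z)).
  apply: (@integrable_dom_mul _ _ r (fun x t => `|u x t| `^ p) H tau d 1 iup mH) => z _.
  by have /andP[? ?] := H01 z; rewrite ger0_norm.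
pose Y := \int[M]_(z in dom r tau d) (`|u z.1 z.2| `^ p * H z).
have iscale (k : R) : M.-integrable (dom r tau d) (EFin \o (fun z => k * (`|u z.1 z.2| `^ p * H z))).
  rewrite (_ : _ \o _ = (fun z => k%:E * (`|u z.1 z.2| `^ p * H z)%:E)%E); last first.
    by apply/funext => z /=; rewrite EFinM.
  exact: integrableZl.
(* Pointwise Young for [|u| Bp] and [G]. Derivatives of [B] live on [t >= tau / 2], where the inner
   cutoff is already 1, so [(|u| Bp)^p = |u|^p B] is exactly the integrand of [Y]. *)
have pw (z : X * R) (g G k : R) : 0 < k -> 0 <= G ->
    (z.2 < tau / 2 -> g = 0) -> (tau / 2 <= z.2 -> `|g| <= G * Bp z.2) ->
    `|u z.1 z.2| * `|g| <=
    k * (`|u z.1 z.2| `^ p * H z) + k `^ (- (p - 1)^-1) * G `^ q.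
  move=> k0 G0 g0 hg; have /andP[hH _] := H01 z.
  have [zt|zt] := ltP z.2 (tau / 2).
    rewrite g0// normr0 mulr0; apply: addr_ge0; apply: mulr_ge0; rewrite ?powR_ge0//.
      exact: ltW.
    by rewrite mulr_ge0 ?powR_ge0.
  apply: (@le_trans _ _ (`|u z.1 z.2| * Bp z.2 * G)).
    by rewrite -mulrA ler_wpM2l// mulrC hg.
  apply: le_trans (crude_young p1 _ G0 k0) _; first by rewrite mulr_ge0.
  rewrite lerD2r ler_wpM2l ?(ltW k0)// powRM// -powRrM mulVf ?gt_eqF// powRr1; last first.
    by have /andP[] := B01 z.2.
  rewrite /H /s smooth_step0 ?subr0 ?mulr1//.
  by rewrite mulrC ler_pdivlMr// mul1r ltW// (lt_le_trans dtau).
have cB (lam : R) : continuous (fun t => derive1 (derive1 B) t - 2 * lam * derive1 B t).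
  move=> t; apply: cvgB; first by apply: smooth1_continuous; do 2 apply: smooth1_derive.
  by apply: (@cvgMl_tmp R R); apply: smooth1_continuous; exact: smooth1_derive.
have cBn (lam : R) : continuous (fun t => `|derive1 (derive1 B) t - 2 * lam * derive1 B t|).
  by move=> t; apply: cvg_norm; exact: cB.
have iJ (lam : R) (w : 'I_n -> R) : lam = 0 \/ lam = 1 -> \sum_i w i ^+ 2 = lam ->
    M.-integrable (dom r tau d) (EFin \o (fun z => `|u z.1 z.2| * (wave w lam z *
      `|derive1 (derive1 B) z.2 - 2 * lam * derive1 B z.2|))).
  move=> l01 wl; have [c1 c10 hc1] := continuous_bounded (ltW tau0) (cB lam).
  apply: (@integrable_dom_mul _ _ r (fun x t => `|u x t|) _ tau d (expR (tau + r) * c1) iua).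
    by apply: measurable_funM; [exact: measurable_wave|exact: (measurable_time (cBn lam))].
  move=> z Dz; rewrite normrM normr_id; apply: ler_pM => //; first exact: wave_le wl l01 d0 Dz.
  by apply: hc1; exact: hz.
(* Since [1 <= tau], [tau + r + 1 <= (r + 2) tau]. *)
have vol : (4 * (tau + r + 1)) ^+ n <= v1 * tau ^+ n.
  rewrite -exprMn; apply: lerXn2r; rewrite ?nnegrE; [lra|by rewrite mulr_ge0 ?(ltW tau0)//; lra|].
  by nra.
have taun : tau ^+ n = tau `^ n%:R by rewrite powR_mulrn// ltW.
have tauV : tau^-1 = tau `^ (- 1) by rewrite powR_inv1// ltW.
have Yle : Y <= (2 * h2 * C' `^ q * v1 + 2) * tau `^ (n%:R + 1 - 2 * q).
  (* The case [lam = 0]: the wave is 1 and no data term appears. *)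
  pose w0 (i : 'I_n) : R := 0.
  have w00 : \sum_i w0 i ^+ 2 = 0 by rewrite big1// => i _; rewrite expr0n.
  have wave0 z : wave w0 0 z = 1.
    by rewrite /wave /dotp big1 ?mul0r ?subr0 ?expR0// => i _; rewrite mul0r.
  have := hcore 0 w0 (or_introl erefl) w00; rewrite mul0r addr0.
  have -> : \int[M]_(z in dom r tau d) (`|u z.1 z.2| `^ p *
      (B z.2 * (1 - S (d^-1 * z.2)) * wave w0 0 z)) = Y.
    by apply: eq_Rintegral => z _; rewrite wave0 mulr1.
  pose K1 := h2 * (C' * tau^-1 ^+ 2) `^ q.
  have iK : M.-integrable (dom r tau d) (EFin \o (fun z : X * R => K1)).
    apply: (@integrable_dom_bounded R n r (cst K1) tau d `|K1|) => //; exact: ltW.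
  have J1 : \int[M]_(z in dom r tau d) (`|u z.1 z.2| * (wave w0 0 z *
      `|derive1 (derive1 B) z.2 - 2 * 0 * derive1 B z.2|)) <=
    \int[M]_(z in dom r tau d) (2^-1 * (`|u z.1 z.2| `^ p * H z) + K1).
    apply: le_Rintegral => //; first exact: iJ (or_introl erefl) w00.
      rewrite (_ : _ \o _ = (fun z => (2^-1 * (`|u z.1 z.2| `^ p * H z))%:E + K1%:E)%E); last first.
        by apply/funext => z /=; rewrite EFinD.
      by have := integrableD mD (iscale 2^-1) iK.
    move=> z Dz; rewrite wave0 mul1r mulr0 mul0r subr0.
    apply: pw; [by rewrite invr_gt0|by rewrite mulr_ge0 ?exprn_ge0 ?(ltW C'0) ?(ltW tV0)|exact: B''0|].
    by move=> _; exact: hB2.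
  rewrite (RintegralD mD (iscale _) iK) in J1.
  rewrite RintegralZl// -/Y in J1.
  have V := @dom_volume R n r tau d r0 d0 d2tau.
  have K10 : 0 <= K1 by rewrite mulr_ge0 ?powR_ge0.
  have KV : K1 * fine (M (dom r tau d)) <= h2 * C' `^ q * v1 * tau `^ (n%:R + 1 - 2 * q).
    apply: (@le_trans _ _ (K1 * (v1 * tau ^+ n * tau))).
      rewrite ler_wpM2l//; apply: le_trans V _; by rewrite ler_wpM2r// ltW.
    have -> : v1 * tau ^+ n * tau = v1 * tau `^ (n%:R + 1).
      by rewrite -PD powRr1 ?(ltW tau0)// taun mulrA.
    rewrite /K1 tauV -(powR_mulrn 2 (powR_ge0 _ _)) powRM ?powR_ge0 ?(ltW C'0)//.
    rewrite -!powRrM.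
    have -> : n%:R + 1 - 2 * q = (-1 * (2 * q)) + (n%:R + 1) :> R by ring.
    rewrite -(PD (-1 * (2 * q)) (n%:R + 1)); apply: le_of_eq; ring.
  have eT : e <= tau `^ (n%:R + 1 - 2 * q) by rewrite ge_min lexx orbT.
  rewrite Rintegral_cst// in J1.
  move=> hY; have {J1}hY := le_trans hY (lerD J1 (lexx e)).
  set P := h2 * C' `^ q * v1 * tau `^ (n%:R + 1 - 2 * q) in KV.
  have -> : (2 * h2 * C' `^ q * v1 + 2) * tau `^ (n%:R + 1 - 2 * q) =
    2 * P + 2 * tau `^ (n%:R + 1 - 2 * q) by rewrite /P; ring.
  by move: hY KV eT; rewrite -/Y; lra.
have [I [w [I0 w1 hW]]] := hCw tau tau1.
have IR : 0 < #|I|%:R :> R by rewrite ltr0n.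
pose sm := (Num.sqrt tau)^-1 ^+ m.
have smE : sm = tau `^ (- (m%:R / 2)).
  rewrite /sm -powR12_sqrt ?(ltW tau0)// -(powR_inv1 (powR_ge0 _ _)) -powRrM.
  by rewrite -(powR_mulrn _ (powR_ge0 _ _)) -powRrM; congr powR; field.
have sm0 : 0 < sm by rewrite smE.
pose K2 := nu `^ (- (p - 1)^-1) * (3 * C' * tau^-1 * (Cw * sm)) `^ q.
have K20 : 0 <= K2 by rewrite mulr_ge0 ?powR_ge0.
pose E (z : X * R) := expR (q / 2 * (enorm z.1 - z.2)).
have q2 : 0 < q / 2 by rewrite divr_gt0.
have mE : measurable_fun [set: X * measurableTypeR R] E.
  apply: (measurableT_comp (@measurable_expR R)); apply: measurable_funM => //.
  apply: measurable_funB; first exact: (measurable_space (@measurable_enorm R n)).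
  exact: measurable_snd.
have iE : M.-integrable (dom r tau d) (EFin \o E).
  apply: (@integrable_dom_bounded R n r E tau d (expR (q / 2 * (tau + r)))) => //; first exact: ltW.
  move=> z Dz; rewrite ger0_norm ?expR_ge0// ler_expR ler_wpM2l ?(ltW q2)//.
  have := dom_enorm Dz; have /andP[] := hz z Dz; lra.
have iKE : M.-integrable (dom r tau d) (EFin \o (fun z => K2 * E z)).
  rewrite (_ : _ \o _ = (fun z => K2%:E * (E z)%:E)%E); last first.
    by apply/funext => z /=; rewrite EFinM.
  exact: integrableZl.
pose J k z := `|u z.1 z.2| * (wave (w k) 1 z * `|derive1 (derive1 B) z.2 - 2 * 1 * derive1 B z.2|).
have iJk k : M.-integrable (dom r tau d) (EFin \o J k) by apply: iJ => //; right.
have [iJs sumJ] := Rintegral_sum (index_enum I) mD iJk.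
(* The nonlinear term on the left is nonnegative and is dropped. *)
have ineq k : eps * c0 <= \int[M]_(z in dom r tau d) J k z + e.
  apply: le_trans (hcore 1 (w k) (or_intror erefl) (w1 k)); rewrite mul1r -c0E lerDr.
  apply: Rintegral_ge0 => z _; rewrite mulr_ge0 ?powR_ge0// mulr_ge0 ?wave_ge0//.
  by have /andP[] := H01 z.
have iRHS : M.-integrable (dom r tau d)
    (EFin \o (fun z => nu * (`|u z.1 z.2| `^ p * H z) + K2 * E z)).
  rewrite (_ : _ \o _ = (fun z => (nu * (`|u z.1 z.2| `^ p * H z))%:E + (K2 * E z)%:E)%E); last first.
    by apply/funext => z /=; rewrite EFinD.
  by have := integrableD mD (iscale nu) iKE.
(* The sum over directions goes under the integral before Young's inequality is applied. Direction
   by direction, Young would see undamped waves and lose the decay of the average. *)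
have Jle : \sum_k \int[M]_(z in dom r tau d) J k z <= #|I|%:R * (nu * Y + K2 * \int[M]_(z in dom r tau d) E z).
  rewrite -sumJ -!RintegralZl// -(RintegralD mD (iscale nu) iKE).
  rewrite -RintegralZl//; apply: le_Rintegral => //.
    rewrite (_ : _ \o _ = (fun z => #|I|%:R%:E * (nu * (`|u z.1 z.2| `^ p * H z) + K2 * E z)%:E)%E); last first.
      by apply/funext => z /=; rewrite EFinM.
    exact: integrableZl.
  move=> z Dz; rewrite -mulr_sumr -mulr_suml.
  pose g := (#|I|%:R^-1 * \sum_k wave (w k) 1 z) * (derive1 (derive1 B) z.2 - 2 * 1 * derive1 B z.2).
  have sum0 : 0 <= \sum_k wave (w k) 1 z by apply: sumr_ge0 => k _; exact: wave_ge0.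
  have -> : `|u z.1 z.2| * ((\sum_k wave (w k) 1 z) * `|derive1 (derive1 B) z.2 - 2 * 1 * derive1 B z.2|) =
     #|I|%:R * (`|u z.1 z.2| * `|g|).
    rewrite /g !normrM (ger0_norm sum0) (@ger0_norm _ #|I|%:R^-1) ?invr_ge0//.
    by field; rewrite gt_eqF.
  rewrite ler_wpM2l//.
  pose F := expR ((enorm z.1 - z.2) / 2).
  have FE : F `^ q = E z by rewrite /F -expRM; congr expR; field.
  have -> : K2 * E z = nu `^ (- (p - 1)^-1) * (3 * C' * tau^-1 * (Cw * sm) * F) `^ q.
    rewrite [X in _ = _ * X]powRM ?expR_ge0 ?FE 1?mulrA// !mulr_ge0// ltW//.
  apply: pw => //.
  - by rewrite !mulr_ge0 ?expR_ge0// ltW.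
  - by move=> zt; rewrite /g B'0// B''0// mulr0 subr0 mulr0.
  move=> zt; rewrite /g normrM ger0_norm ?mulr_ge0 ?invr_ge0//.
  have /andP[_ ztau] := hz z Dz.
  have zc : enorm z.1 <= z.2 + r by case: Dz.
  have hs : #|I|%:R^-1 * \sum_k wave (w k) 1 z <= Cw * sm * F.
    by rewrite mulrC ler_pdivrMr// [leRHS]mulrC hW.
  have := ler_pM (mulr_ge0 _ sum0) (normr_ge0 _) hs (hB3 z.2).
  rewrite invr_ge0 ler0n => /(_ isT) /le_trans; apply.
  by apply: le_of_eq; ring.
have Isum : #|I|%:R * (eps * c0) <= \sum_k \int[M]_(z in dom r tau d) J k z + #|I|%:R * e.
  rewrite !mulr_natl -!sumr_const -big_split/=; apply: ler_sum => k _; exact: ineq.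
have fin : eps * c0 <= nu * Y + K2 * \int[M]_(z in dom r tau d) E z + e.
  by rewrite -(ler_pM2l IR) mulrDr; apply: le_trans Isum _; rewrite lerD2r.
have eT : e <= eps * c0 / 2 by rewrite ge_min lexx.
have Eint := @dom_exp_integral R n r tau d (q / 2) r0 d0 d2tau q2.
have KE : K2 * \int[M]_(z in dom r tau d) E z <= nu `^ (- (p - 1)^-1) *
   ((3 * C' * Cw) `^ q * (expR (q / 2 * r) / (q / 2)) * v1 * tau `^ (n%:R - q * (n%:R + 1) / 2)).
  apply: (@le_trans _ _ (K2 * (expR (q / 2 * r) / (q / 2) * (v1 * tau ^+ n)))).
    rewrite ler_wpM2l//; apply: le_trans Eint _; rewrite ler_wpM2l//.
    by rewrite divr_ge0 ?expR_ge0// ltW.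
  rewrite /K2 taun tauV smE.
  have -> : 3 * C' * tau `^ (-1) * (Cw * tau `^ (- (m%:R / 2))) =
      3 * C' * Cw * tau `^ (- 1 - m%:R / 2).
    by rewrite -(PD (-1) (- (m%:R / 2))); ring.
  rewrite powRM ?powR_ge0//; last by rewrite !mulr_ge0// ltW.
  rewrite -powRrM.
  have -> : n%:R - q * (n%:R + 1) / 2 = (-1 - m%:R / 2) * q + n%:R :> R.
    by rewrite -natr1; field.
  rewrite -(PD ((-1 - m%:R / 2) * q) n%:R); apply: le_of_eq; ring.
exact: half_absorb fin eT (ler_wpM2l (ltW nu0) Yle) KE.
Qed.

End estimate.

Section exponents.
Variable R : realType.

(** Completing the square, [4 (n - 1) gamma = D - (2 (n - 1) p - (n + 1))^2]. The base of the square
    lies between [- sqrt D] and [sqrt D]: above because [p < p0], below because [p > 1] makes it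
    exceed [n - 3 >= - 1]. *)
Lemma gamma_gt0 (n : nat) (p : R) : (2 <= n)%N -> 1 < p -> p < p0 R n -> 0 < gamma p n.
Proof.
move=> n2 p1; have {}n2 : 2 <= n%:R :> R by rewrite ler_nat.
rewrite /p0 /gamma; set N : R := n%:R in n2 *; set D := N ^+ 2 + 10 * N - 7.
have D1 : 1 < D by rewrite /D; nra.
have sD : Num.sqrt D ^+ 2 = D by rewrite sqr_sqrtr// ltW// (lt_trans _ D1).
have s1 : 1 < Num.sqrt D.
  by rewrite -[ltLHS]sqrtr1 ltr_sqrt// (lt_trans _ D1).
rewrite ltr_pdivlMr; last lra.
move=> h; set y := Num.sqrt D in sD s1 h.
have h1 : 2 * (N - 1) * p - (N + 1) < y by lra.
have h2 : - y < 2 * (N - 1) * p - (N + 1) by nra.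
have h3 : (2 * (N - 1) * p - (N + 1)) ^+ 2 < y ^+ 2 by nra.
have N1 : 0 < 4 * (N - 1) by lra.
rewrite -(pmulr_rgt0 _ N1).
rewrite sD /D in h3; nra.
Qed.

(** After a suitable choice of [nu], taking logarithms gives a linear inequality between [ln tau]
    and [ln eps]. Solving it for [ln tau] produces the exponent and, from its constant term [k0],
    the factor [C]. *)
Lemma optimized_bound (n : nat) (p a1 a2 c0 : R) : 1 < p -> 0 < gamma p n ->
  0 < a1 -> 0 < a2 -> 0 < c0 ->
  let q := p / (p - 1) in
  exists2 C : R, 0 < C & forall eps tau : R, 0 < eps -> 0 < tau ->
  (forall nu, 0 < nu -> eps * c0 / 2 <= nu * (a1 * tau `^ (n%:R + 1 - 2 * q)) +
    nu `^ (- (p - 1)^-1) * (a2 * tau `^ (n%:R - q * (n%:R + 1) / 2))) ->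
  tau <= C * eps `^ (- (2 * p * (p - 1)) / gamma p n).
Proof.
move=> p1 g0 a10 a20 c00 q; have p10 : 0 < p - 1 by rewrite subr_gt0.
pose k0 := ln a2 - ln (c0 / 4) - (p - 1)^-1 * ln (c0 / (4 * a1)).
exists (expR (2 * (p - 1) ^+ 2 / gamma p n * k0)); first exact: expR_gt0.
move=> eps tau eps0 tau0 h.
pose x := ln tau; pose y := ln eps; set E1 := n%:R + 1 - 2 * q in h.
set E2 := n%:R - q * (n%:R + 1) / 2 in h.
have tE : tau = expR x by rewrite lnK.
have eE : eps = expR y by rewrite lnK.
have powE z e : 0 < z -> z `^ e = expR (e * ln z) by move=> z0; rewrite /powR gt_eqF.
have tP e : 0 < tau `^ e by exact: powR_gt0.
have c40 : 0 < c0 / 4 by rewrite divr_gt0.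
have ca0 : 0 < c0 / (4 * a1) by rewrite divr_gt0// mulr_gt0.
(* With this choice the first term on the right is exactly half of the left side. *)
pose nu := eps * (c0 / (4 * a1)) * tau `^ (- E1).
have nu0 : 0 < nu by exact: (mulr_gt0 (mulr_gt0 eps0 ca0) (tP _)).
have nuE : nu * (a1 * tau `^ E1) = eps * (c0 / 4).
  have e1 : tau `^ (- E1) * tau `^ E1 = 1 by rewrite powRN mulVf// gt_eqF.
  have -> : nu * (a1 * tau `^ E1) = eps * (c0 / (4 * a1)) * a1 * (tau `^ (- E1) * tau `^ E1).
    by rewrite /nu; ring.
  by rewrite e1; field; rewrite gt_eqF.
have := h nu nu0; rewrite nuE => {}h.
have h1 : eps * (c0 / 4) <= nu `^ (- (p - 1)^-1) * (a2 * tau `^ E2) by lra.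
have lnM' (a b : R) : 0 < a -> 0 < b -> ln (a * b) = ln a + ln b by move=> ? ?; rewrite lnM ?posrE.
have lnu : ln nu = y + ln (c0 / (4 * a1)) - E1 * x.
  by rewrite /nu (lnM' _ _ (mulr_gt0 eps0 ca0) (tP _)) (lnM' _ _ eps0 ca0) ln_powR mulNr.
have nuP := powR_gt0 (- (p - 1)^-1) nu0.
have := h1; rewrite -ler_ln ?posrE; [|exact: mulr_gt0|exact: (mulr_gt0 nuP (mulr_gt0 a20 (tP _)))].
rewrite (lnM' _ _ eps0 c40) (lnM' _ _ nuP (mulr_gt0 a20 (tP _))) (lnM' _ _ a20 (tP _)).
rewrite !ln_powR lnu -/x -/y => h2.
have key : x <= 2 * (p - 1) ^+ 2 / gamma p n * k0 + - (2 * p * (p - 1)) / gamma p n * y.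
  have -> : 2 * (p - 1) ^+ 2 / gamma p n * k0 + - (2 * p * (p - 1)) / gamma p n * y =
     (2 * (p - 1) ^+ 2 * k0 - 2 * p * (p - 1) * y) / gamma p n by ring.
  rewrite ler_pdivlMr// -subr_ge0.
  set l1 := ln a2 in k0 h2 *; set l2 := ln (c0 / 4) in k0 h2 *.
  set l3 := ln (c0 / (4 * a1)) in k0 h2 *.
  (* The coefficient of [x] in the bracket is [E1 / (p - 1) + E2], which equals
     [- gamma / (2 (p - 1)^2)]. *)
  have -> : 2 * (p - 1) ^+ 2 * k0 - 2 * p * (p - 1) * y - x * gamma p n =
    2 * (p - 1) ^+ 2 * (- (p - 1)^-1 * (y + l3 - E1 * x) + (l1 + E2 * x) - (y + l2)).
    by rewrite /k0 /E1 /E2 /q /gamma; field; rewrite gt_eqF.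
  by rewrite mulr_ge0 ?subr_ge0// mulr_ge0// exprn_ge0// ltW.
rewrite tE powE// -expRD ler_expR; exact: key.
Qed.

End exponents.

Unset Implicit Arguments.

Theorem theorem3p2 (R : realType) (n : nat) (p r : R) (f : 'rV[R]_n -> R) :
  (2 <= n)%N -> 1 < p -> p < p0 R n -> 0 < r ->
  H1 f ->
  {ae lebesgue_rV R n, forall x, 0 <= f x} ->
  ~ {ae lebesgue_rV R n, forall x, f x = 0} ->
  exists eps1 C : R, [/\ 0 < eps1, 0 < C &
    forall eps : R, 0 < eps -> eps <= eps1 ->
    forall u v : 'rV[R]_n -> R -> R,
      let T := lifespan p f (cst 0) eps in
      (0 < T)%E ->
      is_solution p f (cst 0) eps T u v ->
      supported_in_cone r T u v ->
      (T <= (C * eps `^ (- (2 * p * (p - 1)) / gamma p n))%:E)%E].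
Proof.
case: n f => // m f n2 p1 pp0 r0 [f2 _] f0 fN0.
have g0 := gamma_gt0 n2 p1 pp0.
have p10 : 0 < p - 1 by rewrite subr_gt0.
have ppos : 0 < p by apply: lt_trans p1.
have mf := L2_measurable f2.
have mball := @measurable_eball R m.+1 r.
have ballfin : (\int[lebesgue_rV R m.+1]_(x in eball r) `|f x|%:E < +oo)%E.
  apply: le_lt_trans (cube_L1_finite (ltW r0) f2); apply: ge0_subset_integral => //.
  - exact: measurable_cube.
  - by apply/measurable_EFinP; apply: measurable_funTS; exact: measurableT_comp.
  - move=> x xr i; rewrite /= in_itv/= -ler_norml.
    exact: le_trans (coord_le_enorm _ _) xr.
pose F0 := \int[lebesgue_rV R m.+1]_(x in eball r) `|f x|.
have F00 : 0 <= F0 by exact: Rintegral_ge0.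
(* The support of [f] is known only through a solution, yet the constants are chosen before one is
   given. If [f] vanishes almost everywhere on the ball, a solution would force it to vanish outside
   as well, against [fN0], so any constants do. *)
have [F0z|F0z] := eqVneq F0 0.
  exists 1, 1; split => // eps eps0 _ u v T T0 sol sc; exfalso; apply: fN0.
  have I0 : (\int[lebesgue_rV R m.+1]_(x in eball r) `|(EFin \o f) x| = 0)%E.
    rewrite -[LHS]fineK; first by rewrite -[fine _]/F0 F0z.
    by rewrite ge0_fin_numE//; exact: integral_ge0.
  have mfE : measurable_fun (eball r) (EFin \o f).
    by apply/measurable_EFinP; exact: measurable_funTS.
  have hin := (ae_eq_integral_abs (lebesgue_rV R m.+1) mball mfE).1 I0.
  have hout := sc 0 (conj (lexx 0) T0).
  have hinit := solution_init sol.
  move: hin hout hinit; apply: filterS3 => x hin hout hinit.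
  have [xr|xr] := leP (enorm x) r; first by case: (hin xr).
  have := hout; rewrite add0r => /(_ xr)[]; rewrite hinit => /eqP.
  by rewrite mulf_eq0 gt_eqF//= => /eqP.
have {F0z}F0pos : 0 < F0 by rewrite lt_neqAle eq_sym F0z.
have c00 : 0 < expR (- r - 1) * F0 by rewrite mulr_gt0 ?expR_gt0.
have [a1 [a2 [a10 a20 est]]] := @lifespan_estimate R m p r p1 r0.
have [C C0 opt] := @optimized_bound R m.+1 p a1 a2 _ p1 g0 a10 a20 c00.
(* The estimates require [1 <= tau]. For [eps <= 1] the nonpositive power of [eps] is at least 1,
   and so is the claimed bound [K] thanks to the maximum; hence every [tau] beyond [K] is
   admissible. *)
exists 1, (Num.max C 1); split => //; first by rewrite lt_max C0.
move=> eps eps0 eps1 u v T T0 sol sc.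
set e := - (2 * p * (p - 1)) / gamma p m.+1.
have e0 : e <= 0 by rewrite /e mulNr oppr_le0 divr_ge0 ?mulr_ge0// ltW.
have pe1 : 1 <= eps `^ e.
  by rewrite -(powRr0 eps) ger_powR// eps0.
set K := Num.max C 1 * eps `^ e.
have K1 : 1 <= K.
  by rewrite -[leLHS]mulr1 ler_pM// le_max lexx orbT.
rewrite leNgt; apply/negP => KT.
(* The estimate is available only for real [tau] strictly below [T], which may be infinite. *)
have [tau Ktau tauT] : exists2 tau : R, K < tau & (tau%:E < T)%E.
  case: T KT {T0 sol sc} => [t| |]//.
  - by rewrite lte_fin => Kt; exists ((K + t) / 2); rewrite ?lte_fin; lra.
  - by exists (K + 1); rewrite ?ltry//; lra.
have tau1 : 1 <= tau by apply: le_trans K1 (ltW Ktau).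
have : tau <= C * eps `^ e.
  apply: opt => //; first exact: lt_le_trans tau1.
  move=> nu nu0; apply: (est eps f T u v tau nu _ eps0 f2 f0 T0 sol sc) => //.
apply/negP; rewrite -ltNge; apply: le_lt_trans Ktau.
by rewrite /K ler_wpM2r ?powR_ge0// le_max lexx.
Qed.
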